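(* Let $N\ge2$, let $A=(a_{ij})$ be the Cartan matrix of $\mathfrak{sl}_N$ with simple roots $\alpha_1,\dots,\alpha_{N-1}$, and $B_{ij}=\frac12(\alpha_i,\alpha_j)$. For $c=0$, the Fourier components $h_{ik}$, $x^{+}_{ik}=e_{ik}$, $x^{-}_{ik}=f_{ik}$ $(1\le i\le N-1,\ k\in\mathbb{Z})$ of the currents of $\mathcal{D}Y_{\hbar}(\mathfrak{sl}_N)$ satisfy, for all $k,l,k_1,\dots,k_m\in\mathbb{Z}$, $$[h_{ik},h_{jl}]=0,\qquad [h_{i0},x_{jl}^{\pm}]=\pm2B_{ij}x_{jl}^{\pm},\qquad [x_{ik}^+,x_{jl}^-]=\delta_{ij}h_{i,k+l},$$ $$[h_{i,k+1},x_{jl}^{\pm}]-[h_{ik},x_{j,l+1}^{\pm}]=\pm\hbar B_{ij}[h_{ik},x_{jl}^{\pm}]_{+},$$ $$[x_{i,k+1}^{\pm},x_{jl}^{\pm}]-[x_{ik}^{\pm},x_{j,l+1}^{\pm}]=\pm\hbar B_{ij}[x_{ik}^{\pm},x_{jl}^{\pm}]_{+},$$ $$\sum_{\sigma\in\mathfrak{S}_m}[x_{ik_{\sigma(1)}}^{\pm},[x_{ik_{\sigma(2)}}^{\pm},\cdots,[x_{ik_{\sigma(m)}}^{\pm},x_{jl}^{\pm}]\cdots]]=0\qquad(i\ne j,\ m=1-a_{ij}),$$ where $[x,y]_+=xy+yx$.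
   Context: Let $\mathcal{A}=\mathbb{C}[[\hbar]]$, let $V$ be a free $\mathcal{A}$-module of rank $N$, $\mathcal{P}\in\mathrm{End}(V\otimes V)$ the permutation $\mathcal{P}(v\otimes w)=w\otimes v$, and $R(u)=\frac{1}{u+\hbar}(uI+\hbar\mathcal{P})$, expanded in nonnegative powers of $\hbar$. $\mathcal{D}Y_{\hbar}(\mathfrak{gl}_N)$ is the topological ($\hbar$-adically complete) algebra over $\mathcal{A}$ generated by $\{t_{ij}^k\mid 1\le i,j\le N,\ k\in\mathbb{Z}\}$ and $c$; with $t_{ij}^{+}(u)=\delta_{ij}-\hbar\sum_{k\ge0}t_{ij}^{k}u^{-k-1}$, $t_{ij}^{-}(u)=\delta_{ij}+\hbar\sum_{k<0}t_{ij}^{k}u^{-k-1}$, $T^{\pm}(u)=(t^{\pm}_{ij}(u))$, the defining relations are $$[T^{\pm}(u),c]=0,\qquad R(u-v)\overset{1}{T^{\pm}}(u)\overset{2}{T^{\pm}}(v)=\overset{2}{T^{\pm}}(v)\overset{1}{T^{\pm}}(u)R(u-v),$$ $$R(u_{-}-v_{+})\overset{1}{T^{+}}(u)\overset{2}{T^{-}}(v)=\overset{2}{T^{-}}(v)\overset{1}{T^{+}}(u)R(u_{+}-v_{-}),$$ where $\overset{1}{T}(u)=T(u)\otimes\mathrm{id}$, $\overset{2}{T}(u)=\mathrm{id}\otimes T(u)$, $u_{\pm}=u\pm\frac14\hbar c$, $v_\pm=v\pm\frac14\hbar c$; in the last relation powers of $(u-v)^{-1}$ are expanded in $u^{-1}$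 and $v$. Gauss decomposition: $T^{\pm}(u)=F^{\pm}(u)\,\mathrm{diag}(k^{\pm}_1(u),\dots,k^{\pm}_N(u))\,E^{\pm}(u)$ with $F^{\pm}(u)$ lower unitriangular with entries $f^{\pm}_{i,j}(u)$ and $E^{\pm}(u)$ upper unitriangular with entries $e^{\pm}_{i,j}(u)$, entries in $\mathcal{D}Y_{\hbar}(\mathfrak{gl}_N)[[u^{\mp1}]]$. Put $X_{i}^-(u)=f_{i+1,i}^+(u_+)-f_{i+1,i}^-(u_-)$, $X_{i}^+(u)=e_{i,i+1}^+(u_-)-e_{i,i+1}^-(u_+)$, and for $1\le i\le N-1$ $$H_i^{\pm}(u)=k_{i+1}^{\pm}(u+\tfrac12\hbar i)k_{i}^{\pm}(u+\tfrac12\hbar i)^{-1},\quad E_i(u)=\tfrac1\hbar X_i^{+}(u+\tfrac12\hbar i),\quad F_i(u)=\tfrac1\hbar X_i^{-}(u+\tfrac12\hbar i).$$ $\mathcal{D}Y_{\hbar}(\mathfrak{sl}_N)$ is the subalgebra of $\mathcal{D}Y_{\hbar}(\mathfrak{gl}_N)$ generated by $H_i^{\pm}(u),E_i(u),F_i(u)$ and $c$. Fourier components: $$H_{i}^{+}(u)=1+\hbar\sum_{k\ge0}h_{ik}u^{-k-1},\quad H_{i}^{-}(u)=1-\hbar\sum_{k<0}h_{ik}u^{-k-1},\quad E_i(u)=\sum_{k\in\mathbb{Z}}e_{ik}u^{-k-1},\quad F_i(u)=\sum_{k\in\mathbb{Z}}f_{ik}u^{-k-1}.$$ The form is normalized by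 $(\alpha_i,\alpha_i)=2$. ''For $c=0$'' means in the quotient in which the central element $c$ is set to $0$. *)

(* Defs.v *)
From HB Require Import structures.
From mathcomp Require Import all_boot all_order all_algebra perm.
From mathcomp Require Import boolp classical_sets reals.
From mathcomp.real_closed Require Import complex mxtens.
From mathcomp.multinomials Require Import monalg.

Set Implicit Arguments.
Unset Strict Implicit.
Unset Printing Implicit Defensive.
Import GRing.Theory.
Local Open Scope quotient_scope.
Local Open Scope classical_set_scope.
Local Open Scope ring_scope.

(** * Formal power series in one central variable

   The same type is used for series in hbar, in u and in u^-1; what the
   variable stands for is said where it matters. *)

Record fps (R : Type) := Fps { fpscoef : nat -> R }.
Notation "f ``_ n" := (fpscoef f n)
  (at level 3, n at level 2, left associativity, format "f ``_ n").

HB.instance Definition _ (R : Type) := gen_eqMixin (fps R).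
HB.instance Definition _ (R : Type) := gen_choiceMixin (fps R).

Section FpsRing.
Variable R : pzRingType.
Implicit Types f g h : fps R.

Definition fpsC (a : R) : fps R := Fps (fun n => if n is 0%N then a else 0).
Definition fpsX : fps R := Fps (fun n => (n == 1%N)%:R).
Definition fps_add f g := Fps (fun n => f``_n + g``_n).
Definition fps_opp f := Fps (fun n => - f``_n).
Definition fps_mul f g := Fps (fun n => \sum_(i < n.+1) f``_i * g``_(n - i)).

Lemma fpsP f g : (forall n, f``_n = g``_n) -> f = g.
Proof. by case: f g => f [g] /= e; congr Fps; apply: funext. Qed.

Lemma fps_addA : associative fps_add.
Proof. by move=> f g h; apply: fpsP => n /=; rewrite addrA. Qed.
Lemma fps_addC : commutative fps_add.
Proof. by move=> f g; apply: fpsP => n /=; rewrite addrC. Qed.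
Lemma fps_add0 : left_id (fpsC 0) fps_add.
Proof. by move=> f; apply: fpsP => -[|n] /=; rewrite add0r. Qed.
Lemma fps_addN : left_inverse (fpsC 0) fps_opp fps_add.
Proof. by move=> f; apply: fpsP => -[|n] /=; rewrite addNr. Qed.

Lemma fps_mul_rev f g n :
  (fps_mul f g)``_n = \sum_(i < n.+1) f``_(n - i) * g``_i.
Proof.
rewrite /= (reindex_inj rev_ord_inj) /=.
by apply: eq_bigr => i _; rewrite subSS subKn // -ltnS.
Qed.

Lemma fps_mulA : associative fps_mul.
Proof.
move=> f g h; apply: fpsP => n; rewrite [RHS]fps_mul_rev /fps_mul /=.
pose F i k := f``_i * (g``_(n - i - k) * h``_k).
transitivity (\sum_(i < n.+1) \sum_(k < n.+1 | (k <= n - i)%N) F i k).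
  apply: eq_bigr => i _; have /= -> := fps_mul_rev g h (n - i).
  by rewrite big_distrr /= (big_ord_narrow_leq (leq_subr _ _)).
rewrite (exchange_big_dep predT) //=; apply: eq_bigr => k _.
transitivity (\sum_(i < n.+1 | (i <= n - k)%N) F i k).
  apply: eq_bigl => i; rewrite -ltnS -(ltnS i) -!subSn ?leq_ord //.
  by rewrite -subn_gt0 -(subn_gt0 i) -!subnDA addnC.
rewrite (big_ord_narrow_leq (leq_subr _ _)) big_distrl /=.
by apply: eq_bigr => i _; rewrite /F -!subnDA addnC mulrA.
Qed.

Lemma fps_mul1 : left_id (fpsC 1) fps_mul.
Proof.
move=> f; apply: fpsP => n /=; rewrite big_ord_recl subn0 mul1r big1 ?addr0 //.
by move=> i _; rewrite mul0r.
Qed.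
Lemma fps_mulr1 : right_id (fpsC 1) fps_mul.
Proof.
move=> f; apply: fpsP => n; rewrite fps_mul_rev big_ord_recl subn0 mulr1.
by rewrite big1 ?addr0 // => i _; rewrite mulr0.
Qed.
Lemma fps_mulDl : left_distributive fps_mul fps_add.
Proof.
move=> f g h; apply: fpsP => n /=; rewrite -big_split.
by apply: eq_bigr => i _; rewrite mulrDl.
Qed.
Lemma fps_mulDr : right_distributive fps_mul fps_add.
Proof.
move=> f g h; apply: fpsP => n /=; rewrite -big_split.
by apply: eq_bigr => i _; rewrite mulrDr.
Qed.

HB.instance Definition _ := GRing.isPzRing.Build (fps R)
  fps_addA fps_addC fps_add0 fps_addN
  fps_mulA fps_mul1 fps_mulr1 fps_mulDl fps_mulDr.
End FpsRing.
Arguments fpsX {R}.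

Definition fps_map (R S : Type) (phi : R -> S) (f : fps R) : fps S :=
  Fps (fun n => phi f``_n).

(** * Topological quotients

   [hb] is a central element and [R] carries the [hb]-adic topology.
   [topspan hb S] is the smallest closed two-sided ideal containing [S] whose
   quotient has no [hb]-torsion, so [topquot hb S] is the quotient of [R] by
   the relations [S] among [hb]-adically complete [hb]-torsion-free rings.
   Torsion has to be killed: the RTT relations below are all divisible by
   hbar^2, while the currents involve a division by hbar. *)

Section Quotient.
Variable R : pzRingType.
Implicit Types (hb : R) (S I : set R).

Record topideal hb I : Prop := TopIdeal {
  topideal0 : I 0;
  topidealB : forall x y, I x -> I y -> I (x - y);
  topidealMl : forall a x, I x -> I (a * x);
  topidealMr : forall a x, I x -> I (x * a);
  topideal_torsion : forall x, I (hb * x) -> I x;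
  topideal_closed : forall x,
    (forall n, exists y, I (x - hb ^+ n * y)) -> I x }.

Definition topspan hb S : set R :=
  [set x | forall I, topideal hb I -> S `<=` I -> I x].

Lemma topspan_ideal hb S : topideal hb (topspan hb S).
Proof.
split.
- by move=> I [].
- by move=> x y Sx Sy I tI SI; apply: (topidealB tI); [apply: Sx|apply: Sy].
- by move=> a x Sx I tI SI; apply: (topidealMl tI); apply: Sx.
- by move=> a x Sx I tI SI; apply: (topidealMr tI); apply: Sx.
- by move=> x Sx I tI SI; apply: (topideal_torsion tI); apply: Sx.
- move=> x Sx I tI SI; apply: (topideal_closed tI) => n.
  by have [y Sy] := Sx n; exists y; apply: Sy.
Qed.

Definition topcong hb S : rel R := fun x y => `[< topspan hb S (x - y) >].

Lemma topcong_refl hb S : reflexive (topcong hb S).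
Proof.
by move=> x; apply/asboolP; rewrite subrr; apply: topideal0 (topspan_ideal _ _).
Qed.

Lemma topcong_sym hb S : symmetric (topcong hb S).
Proof.
have tI := topspan_ideal hb S.
move=> x y; apply/asboolP/asboolP => Sxy; rewrite -opprB -sub0r;
  exact: (topidealB tI) (topideal0 tI) Sxy.
Qed.

Lemma topcong_trans hb S : transitive (topcong hb S).
Proof.
have tI := topspan_ideal hb S.
move=> y x z /asboolP Sxy; rewrite topcong_sym => /asboolP Szy; apply/asboolP.
by rewrite -[x](subrK y) -addrA -[y - z]opprB; exact: (topidealB tI).
Qed.

Canonical topcong_equiv hb S :=
  EquivRel (topcong hb S) (@topcong_refl hb S) (@topcong_sym hb S)
    (@topcong_trans hb S).

Definition topquot hb S := {eq_quot topcong hb S}.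
HB.instance Definition _ hb S := Choice.on (topquot hb S).

Section Ops.
Variables (hb : R) (S : set R).
Local Notation Q := (topquot hb S).
Let tI := topspan_ideal hb S.

Definition topproj (x : R) : Q := \pi_Q x.

Lemma topprojP x y : topproj x = topproj y <-> topspan hb S (x - y).
Proof.
split=> [/eqmodP|Sxy]; first by move/asboolP.
by apply/eqmodP; apply/asboolP.
Qed.

Lemma topprojK (q : Q) : topproj (repr q) = q.
Proof. exact: reprK. Qed.

Lemma topspan_repr x : topspan hb S (repr (topproj x) - x).
Proof. by apply/topprojP; rewrite topprojK. Qed.

Lemma topspanD x y :
  topspan hb S x -> topspan hb S y -> topspan hb S (x + y).
Proof.
move=> Sx Sy; rewrite -[y]opprK; apply: (topidealB tI) => //.
by rewrite -sub0r; apply: (topidealB tI) => //; exact: (topideal0 tI).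
Qed.

Definition tq_add (p q : Q) : Q := topproj (repr p + repr q).
Definition tq_opp (p : Q) : Q := topproj (- repr p).
Definition tq_mul (p q : Q) : Q := topproj (repr p * repr q).

Lemma tq_addE x y : tq_add (topproj x) (topproj y) = topproj (x + y).
Proof.
apply/topprojP; rewrite opprD addrACA.
by apply: topspanD; exact: topspan_repr.
Qed.

Lemma tq_oppE x : tq_opp (topproj x) = topproj (- x).
Proof.
apply/topprojP; rewrite -opprD -sub0r.
by apply: (topidealB tI); [exact: (topideal0 tI)|exact: topspan_repr].
Qed.

Lemma tq_mulE x y : tq_mul (topproj x) (topproj y) = topproj (x * y).
Proof.
apply/topprojP; set x' := repr _; set y' := repr _.
have -> : x' * y' - x * y = (x' - x) * y' + x * (y' - y).
  by rewrite mulrBl mulrBr addrA subrK.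
apply: topspanD; [apply: (topidealMr tI)|apply: (topidealMl tI)];
  exact: topspan_repr.
Qed.

Lemma tq_ind (P : Q -> Prop) : (forall x, P (topproj x)) -> forall q, P q.
Proof. by move=> Px q; rewrite -(topprojK q). Qed.

Lemma tq_addA : associative tq_add.
Proof.
by elim/tq_ind=> x; elim/tq_ind=> y; elim/tq_ind=> z; rewrite !tq_addE addrA.
Qed.
Lemma tq_addC : commutative tq_add.
Proof. by elim/tq_ind=> x; elim/tq_ind=> y; rewrite !tq_addE addrC. Qed.
Lemma tq_add0 : left_id (topproj 0) tq_add.
Proof. by elim/tq_ind=> x; rewrite tq_addE add0r. Qed.
Lemma tq_addN : left_inverse (topproj 0) tq_opp tq_add.
Proof. by elim/tq_ind=> x; rewrite tq_oppE tq_addE addNr. Qed.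
Lemma tq_mulA : associative tq_mul.
Proof.
by elim/tq_ind=> x; elim/tq_ind=> y; elim/tq_ind=> z; rewrite !tq_mulE mulrA.
Qed.
Lemma tq_mul1 : left_id (topproj 1) tq_mul.
Proof. by elim/tq_ind=> x; rewrite tq_mulE mul1r. Qed.
Lemma tq_mulr1 : right_id (topproj 1) tq_mul.
Proof. by elim/tq_ind=> x; rewrite tq_mulE mulr1. Qed.
Lemma tq_mulDl : left_distributive tq_mul tq_add.
Proof.
elim/tq_ind=> x; elim/tq_ind=> y; elim/tq_ind=> z.
by rewrite !(tq_addE, tq_mulE) mulrDl.
Qed.
Lemma tq_mulDr : right_distributive tq_mul tq_add.
Proof.
elim/tq_ind=> x; elim/tq_ind=> y; elim/tq_ind=> z.
by rewrite !(tq_addE, tq_mulE) mulrDr.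
Qed.

HB.instance Definition _ := GRing.isPzRing.Build (topquot hb S)
  tq_addA tq_addC tq_add0 tq_addN tq_mulA tq_mul1 tq_mulr1 tq_mulDl tq_mulDr.
End Ops.
End Quotient.

(** * Generating series and RTT relations

   A sign is a boolean, [true] standing for +.  A series of sign [s] is an
   [fps] whose variable is u^-1 if [s] is + and u if [s] is -.  In a series of
   two variables, of type [fps (fps D)], the outer variable comes from the
   first argument u and the inner one from the second argument v. *)

Section RTT.
Variables (N : nat) (D : pzRingType).
(* [c4] stands for (1/4) hbar c. *)
Variables (hb : D) (t : 'I_N -> 'I_N -> int -> D) (c c4 : D).

(* [Negz m] is -(m+1), so that t_ij^(Negz m) is the coefficient of u^m. *)
Definition Tmx (s : bool) : 'M[fps D]_N :=
  \matrix_(i, j) Fps (fun m =>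
    if s then (if m is p.+1 then - (hb * t i j (Posz p)) else (i == j)%:R)
    else ((m == 0%N) && (i == j))%:R + hb * t i j (Negz m)).

Definition T1 (s : bool) : 'M[fps (fps D)]_(N * N) :=
  map_mx (fps_map (@fpsC D)) (Tmx s) *t 1%:M.
Definition T2 (s : bool) : 'M[fps (fps D)]_(N * N) :=
  1%:M *t map_mx (@fpsC (fps D)) (Tmx s).

Definition Pmx (S : pzRingType) : 'M[S]_(N * N) :=
  \matrix_(a, b) (mxtens_unindex a == ((mxtens_unindex b).2, (mxtens_unindex b).1))%:R.

(* When both signs agree, the factor 1 / (u - v + hbar) of R(u - v) occurs on
   both sides of the RTT relation and is removed.  Here
   [RTnum s] is (u - v) I + hbar P, multiplied by u^-1 v^-1 when [s] is +. *)
Definition RTnum (s : bool) : 'M[fps (fps D)]_(N * N) :=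
  let x : fps (fps D) := fpsX in let y : fps (fps D) := fpsC fpsX in
  let h : fps (fps D) := fpsC (fpsC hb) in
  if s then (y - x)%:M + (h * x * y) *: Pmx _ else (x - y)%:M + h *: Pmx _.

(* 1 / (u - v + a) = \sum_k (v - a)^k u^(-k-1), as a series in u^-1 and v. *)
Definition invdiff (a : D) : fps (fps D) :=
  Fps (fun m => if m is k.+1 then (fpsX - fpsC a) ^+ k else 0).

(* R(w) = (w I + hbar P) / (w + hbar) at w = u - v + a, using
   w / (w + hbar) = 1 - hbar / (w + hbar). *)
Definition Rmx (a : D) : 'M[fps (fps D)]_(N * N) :=
  let g := fpsC (fpsC hb) * invdiff (a + hb) in
  (1 - g)%:M + g *: Pmx _.

(* u_- - v_+ = u - v - (1/2) hbar c and u_+ - v_- = u - v + (1/2) hbar c. *)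
Definition RTTdefect_same (s : bool) : 'M[fps (fps D)]_(N * N) :=
  RTnum s *m T1 s *m T2 s - T2 s *m T1 s *m RTnum s.
Definition RTTdefect_mixed : 'M[fps (fps D)]_(N * N) :=
  Rmx (- (c4 + c4)) *m T1 true *m T2 false
  - T2 false *m T1 true *m Rmx (c4 + c4).

Definition coefs2 (M : 'M[fps (fps D)]_(N * N)) : set D :=
  [set x | exists i j m n, x = (M i j)``_m``_n].

Definition RTTrels : set D :=
  [set x | exists s i j m, x = (Tmx s i j)``_m * c - c * (Tmx s i j)``_m]
  `|` [set x | exists s, coefs2 (RTTdefect_same s) x]
  `|` coefs2 RTTdefect_mixed.

End RTT.

(** * The double Yangian of gl_N *)

Section DoubleYangian.
Variables (R : realType) (N : nat).

(* [Some (i, j, k)] is t_ij^k, and [None] is c. *)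
Definition gen := option ('I_N * 'I_N * int).

(* The hbar-adic completion of the free C[[hbar]]-algebra on [gen]: series in
   hbar over the free complex algebra. *)
Definition FA := fps {malg R[i][{fmonom gen}]}.
HB.instance Definition _ := GRing.PzRing.on FA.

Definition FA_scal (z : R[i]) : FA := fpsC (z%:MP).
Definition FA_hb : FA := fpsX.
Definition FA_gen (x : gen) : FA := fpsC << fmu x >>.
Definition FA_t i j k : FA := FA_gen (Some (i, j, k)).
Definition FA_c : FA := FA_gen None.

Definition DYgl := topquot FA_hb
  (RTTrels FA_hb FA_t FA_c (FA_scal (4%:R^-1) * FA_hb * FA_c)).
HB.instance Definition _ := GRing.PzRing.on DYgl.

Definition FA_to_DYgl (x : FA) : DYgl := topproj _ _ x.
Definition scal (z : R[i]) : DYgl := FA_to_DYgl (FA_scal z).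
Definition hb : DYgl := FA_to_DYgl FA_hb.
Definition cc : DYgl := FA_to_DYgl FA_c.
Definition tgl i j k : DYgl := FA_to_DYgl (FA_t i j k).

Definition Tgl (s : bool) : 'M[fps DYgl]_N := Tmx hb tgl s.

(** ** Gauss decomposition *)

Definition gauss_data := ('M[fps DYgl]_N * 'rV[fps DYgl]_N * 'M[fps DYgl]_N)%type.

Definition is_gauss (T : 'M[fps DYgl]_N) : set gauss_data :=
  [set d | let: (F, K, E) := d in
    [/\ T = F *m diag_mx K *m E,
        forall i j : 'I_N, (i <= j)%N -> F i j = (i == j)%:R
      & forall i j : 'I_N, (j <= i)%N -> E i j = (i == j)%:R]].

(* The decomposition of [Tgl s] exists and is unique, [Tgl s] being congruent
   to 1 modulo hbar. *)
Definition gauss (s : bool) : gauss_data := xget (0, 0, 0) (is_gauss (Tgl s)).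
Definition Fgl s := (gauss s).1.1.
Definition Kgl s := (gauss s).1.2.
Definition Egl s := (gauss s).2.

(** ** Limits, division by hbar, and the substitution of u + a for u *)

Definition hlim (w : nat -> DYgl) : DYgl :=
  xget 0 [set l | forall n, exists m0, forall m, (m0 <= m)%N ->
    exists y, l - w m = hb ^+ n * y].

Definition hdiv (x : DYgl) : DYgl := xget 0 [set y | hb * y = x].

Definition series_inv (f : fps DYgl) : fps DYgl :=
  xget 0 [set g | f * g = 1 /\ g * f = 1].

(* The series g(u + a), for [g] of sign [s] and [a] a central multiple of hbar:
   (u + a)^(-k) = \sum_(m >= k) (-1)^(m-k) 'C(m-1, m-k) a^(m-k) u^(-m) and
   (u + a)^k = \sum_(m <= k) 'C(k, m) a^(k-m) u^m. *)
Definition shift (s : bool) (a : DYgl) (g : fps DYgl) : fps DYgl :=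
  Fps (fun m =>
    if s then \sum_(k < m.+1) ((- a) ^+ (m - k) * g``_k) *+ 'C(m.-1, m - k)
    else hlim (fun n => \sum_(j < n) (a ^+ j * g``_(m + j)) *+ 'C(m + j, m))).

(* The coefficient of u^(-k-1) in a series of sign [s]. *)
Definition fourier (s : bool) (g : fps DYgl) (k : int) : DYgl :=
  if (if s then 0 <= k + 1 else k + 1 <= 0) then g``_(absz (k + 1)) else 0.

(** ** Currents of sl_N

   [i : 'I_N.-1] stands for the node i.+1 of the Dynkin diagram; [lo i] and
   [hi i] are the two consecutive rows that it relates. *)

Definition lo (i : 'I_N.-1) : 'I_N := widen_ord (leq_pred N) i.

Lemma hi_proof (i : 'I_N.-1) : (i.+1 < N)%N.
Proof. by rewrite -ltn_predRL. Qed.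
Definition hi (i : 'I_N.-1) : 'I_N := Ordinal (hi_proof i).

Definition hshift (i : 'I_N.-1) : DYgl := scal ((i.+1)%:R / 2%:R) * hb.
Definition c4 : DYgl := scal (4%:R^-1) * hb * cc.

Definition Hser (s : bool) (i : 'I_N.-1) : fps DYgl :=
  shift s (hshift i) (Kgl s 0 (hi i) * series_inv (Kgl s 0 (lo i))).

(* E_i(u) and F_i(u) are the series [s = +] minus the series [s = -]. *)
Definition Eser (s : bool) (i : 'I_N.-1) : fps DYgl :=
  shift s (hshift i) (shift s (if s then - c4 else c4) (Egl s (lo i) (hi i))).
Definition Fser (s : bool) (i : 'I_N.-1) : fps DYgl :=
  shift s (hshift i) (shift s (if s then c4 else - c4) (Fgl s (hi i) (lo i))).

Definition hgl (i : 'I_N.-1) (k : int) : DYgl :=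
  if 0 <= k then hdiv (fourier true (Hser true i - 1) k)
  else hdiv (fourier false (1 - Hser false i) k).
Definition egl (i : 'I_N.-1) (k : int) : DYgl :=
  hdiv (fourier true (Eser true i) k - fourier false (Eser false i) k).
Definition fgl (i : 'I_N.-1) (k : int) : DYgl :=
  hdiv (fourier true (Fser true i) k - fourier false (Fser false i) k).

(** ** The quotient at c = 0

   DY(sl_N) is the subalgebra of [DYgl] generated by the currents above and c;
   identities between Fourier components for c = 0 are equalities in its image
   in [DY0]. *)

Definition DY0 := topquot hb [set cc].
HB.instance Definition _ := GRing.PzRing.on DY0.

Definition to_DY0 (x : DYgl) : DY0 := topproj _ _ x.
Definition hb0 : DY0 := to_DY0 hb.
Definition scal0 (z : R[i]) : DY0 := to_DY0 (scal z).
Definition hcomp (i : 'I_N.-1) (k : int) : DY0 := to_DY0 (hgl i k).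
Definition xcomp (s : bool) (i : 'I_N.-1) (k : int) : DY0 :=
  to_DY0 (if s then egl i k else fgl i k).

(* The entries of the Cartan matrix of sl_N; as (alpha_i, alpha_i) = 2 they are
   also the values of the form (alpha_i, alpha_j). *)
Definition cartan (i j : 'I_N.-1) : int :=
  if i == j then 2 else if (i.+1 == j) || (j.+1 == i) then -1 else 0.
Definition Bform (i j : 'I_N.-1) : R[i] := (cartan i j)%:~R / 2%:R.

End DoubleYangian.

Definition comm (D : pzRingType) (x y : D) : D := x * y - y * x.
Definition acomm (D : pzRingType) (x y : D) : D := x * y + y * x.
Definition sgn (D : pzRingType) (s : bool) (x : D) : D := if s then x else - x.

(* [a_1, [a_2, ... [a_m, y] ... ]] *)
Definition iter_comm (D : pzRingType) (a : seq D) (y : D) : D :=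
  foldr (@comm D) y a.

(* Main.v *)
(* At c = 0 all four RTT relations take the form
     p [t_ij(u), t_kl(v)] = q (t_kj(v) t_il(u) - t_kj(u) t_il(v))
   with p and q the homogenized u - v and hbar; p and p +- q are not zero
   divisors, so p can be cancelled.  The Schur complement of T(u) at its first
   diagonal entry satisfies the same relation and commutes with that entry; the
   Gauss coordinates being read off the successive Schur complements, their
   commutation relations follow by induction, those of the f's by transposition
   in the opposite ring.  Taking modes turns
   (u - v) [X(u), Y(v)] = hbar (b X(u) Y(v) + b' Y(v) X(u) + ...) into an exchange
   relation between Fourier components, and replacing u by u + hbar i / 2 and v by
   v + hbar j / 2 makes both b and b' equal to B_ij.

   For the Serre relation, only the bracket S(0, 0, l) of zero modes is computed
   from the Gauss coordinates.  Let L be the ideal generated by all the S(a, b, l).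
   By induction on m, in both directions, modulo hbar L
     [h_m, S(a, b, l)] = 2c (S(a, b, l + m) - 2 S(a + m, b, l) - 2 S(a, b + m, l)),
   where c = -1/2 or 1/2 according to the sign.  Applied to S(0, 0, l) = 0 and then
   to S(n, 0, l) this gives L = hbar L, hence L = 0 by separation. *)

From HB Require Import structures.
Require Import Defs.
From mathcomp Require Import all_boot all_order all_algebra perm.
From mathcomp Require Import boolp classical_sets reals.
From mathcomp.real_closed Require Import complex mxtens.
From mathcomp.multinomials Require Import monalg.
From mathcomp Require Import zify.
Set Implicit Arguments.
Unset Strict Implicit.
Unset Printing Implicit Defensive.
Import GRing.Theory.
Local Open Scope ring_scope.

(** Two divisions shape the proof. The first is by u - v: depending on its sign a series expands in
    u^-1 or in u, so [p] is u - v with denominators cleared, and its regularity has to be checked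
    for each pair of signs. The second is by hbar: the off-diagonal Gauss coordinates and H - 1 are
    multiples of hbar, so [hdiv] is a genuine division, but relations are first proved for the
    undivided modes X = hbar x, and hbar is cancelled at the end in the torsion-free quotient.
    Besides products in both variables, the relations between Gauss coordinates contain terms in one
    variable only. Such a term does not depend on the sign of the other series, so it disappears
    from a current, which is a difference of the two signs. For e against f nothing else is present,
    so the bracket of modes k and l depends on k + l only. Zero modes are the natural base case for
    Serre: a bracket with one is a single coefficient of a two-variable relation, and it is
    unchanged by the shifts of u. Modulo hbar, h_m acts as a derivation raising indices by m, which
    spreads the base case to all modes. The shifts are infinite sums for sign -; they are described
    by congruences modulo powers of hbar and identified by separation. *)

Definition central (D : pzRingType) (z : D) := forall x, z * x = x * z.

(** * Noncommutative ring identities with central atoms *)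

Module NC.
Inductive expr := Atom of nat | Zero | One | Add of expr & expr
  | Opp of expr | Mul of expr & expr | Muln of expr & nat.

(* A sum of signed words is a pair: the positive words and the negative ones. *)
Definition sgsum := (seq (seq nat) * seq (seq nat))%type.
Definition sgadd (a b : sgsum) : sgsum := (a.1 ++ b.1, a.2 ++ b.2).
Definition wprods (a b : seq (seq nat)) := [seq x ++ y | x <- a, y <- b].

Fixpoint expand (e : expr) : sgsum :=
  match e with
  | Atom n => ([:: [:: n]], [::])
  | Zero => ([::], [::])
  | One => ([:: [::]], [::])
  | Add e f => sgadd (expand e) (expand f)
  | Opp e => let a := expand e in (a.2, a.1)
  | Mul e f => let a := expand e in let b := expand f in
      (wprods a.1 b.1 ++ wprods a.2 b.2, wprods a.1 b.2 ++ wprods a.2 b.1)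
  | Muln e n => let a := expand e in iter n (sgadd a) ([::], [::])
  end.

(* A rule (x, y, w) stands for the hypothesis that x * y is the word w. *)
Definition rule := (nat * nat * seq nat)%type.
Fixpoint find_rule (rs : seq rule) x y :=
  if rs is (x', y', w) :: rs' then
    if (x' == x) && (y' == y) then Some w else find_rule rs' x y
  else None.

(** Puts one letter in front of a reduced word, and pushes the letters of the right-hand side of a
    rule in turn. Running out of fuel is harmless: the word is then merely less reduced and keeps
    its value. *)
Fixpoint cons_red (rs : seq rule) (fuel : nat) (x : nat) (w : seq nat) :=
  if fuel is f.+1 then
    if w is y :: w' then
      if find_rule rs x y is Some v then foldr (cons_red rs f) w' v else x :: w
    else [:: x]
  else x :: w.

(* Atoms below [c] are central. *)
Definition reduce c rs (w : seq nat) :=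
  sort leq [seq i <- w | (i < c)%N]
  ++ foldr (cons_red rs 12) [::] [seq i <- w | ~~ (i < c)%N].

Definition check c rs e :=
  let a := expand e in
  perm_eq (map (reduce c rs) a.1) (map (reduce c rs) a.2).

Section Eval.
Variables (D : pzRingType) (env : seq D).
Implicit Types (w : seq nat) (rs : seq rule).
Definition at_ n := nth 0 env n.

Fixpoint eval (e : expr) : D :=
  match e with
  | Atom n => at_ n | Zero => 0 | One => 1
  | Add e f => eval e + eval f | Opp e => - eval e | Mul e f => eval e * eval f
  | Muln e n => eval e *+ n
  end.

Definition evw w : D := foldr (fun n x => at_ n * x) 1 w.
Definition evs (s : seq (seq nat)) : D := \sum_(w <- s) evw w.
Definition evd (a : sgsum) : D := evs a.1 - evs a.2.

Lemma evw_cat v w : evw (v ++ w) = evw v * evw w.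
Proof. by elim: v => [|x v IH] /=; rewrite ?mul1r // IH mulrA. Qed.

Lemma evs_cat s t : evs (s ++ t) = evs s + evs t.
Proof. by rewrite /evs big_cat. Qed.

Lemma evs_wprods s t : evs (wprods s t) = evs s * evs t.
Proof.
rewrite /evs /wprods big_allpairs_dep big_distrl /=.
by apply: eq_bigr => v _; rewrite big_distrr; apply: eq_bigr => w _; exact: evw_cat.
Qed.

Lemma evd_add a b : evd (sgadd a b) = evd a + evd b.
Proof. by rewrite /evd !evs_cat opprD addrACA. Qed.

Lemma evd_expand e : evd (expand e) = eval e.
Proof.
elim: e => [n|||e IHe f IHf|e IHe|e IHe f IHf|e IHe n] /=; rewrite -?IHe -?IHf.
- by rewrite /evd /evs /= big_nil big_seq1 subr0 /= mulr1.
- by rewrite /evd subrr.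
- by rewrite /evd /evs /= big_nil big_seq1 subr0.
- exact: evd_add.
- by rewrite /evd opprB.
- rewrite /evd /= !evs_cat !evs_wprods mulrBl !mulrBr.
  by rewrite opprB opprD addrACA.
- clear IHe; elim: n => [|n IH] /=; first by rewrite /evd /= subrr mulr0n.
  by rewrite evd_add IH mulrS.
Qed.

Definition ok_rules rs := foldr (fun r P =>
  at_ r.1.1 * at_ r.1.2 = evw r.2 /\ P) True rs.

Lemma find_ruleP rs x y v : ok_rules rs -> find_rule rs x y = Some v ->
  at_ x * at_ y = evw v.
Proof.
elim: rs => [|[[x' y'] w] rs IH] //= [h /IH{IH}IH].
by case: ifP => // /andP[/eqP<- /eqP<-] [<-].
Qed.

Lemma cons_redP rs f x w : ok_rules rs -> evw (cons_red rs f x w) = at_ x * evw w.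
Proof.
move=> ok; elim: f x w => [|f IH] x [|y w] //=.
case E: find_rule => [v|] //; rewrite mulrA (find_ruleP ok E).
by elim: v {E} => [|z v IHv] /=; rewrite ?mul1r // IH IHv mulrA.
Qed.

Arguments cons_red : simpl never.

Fixpoint ok_central c := if c is c'.+1 then central (at_ c') /\ ok_central c' else True.

Lemma ok_centralP c i : ok_central c -> (i < c)%N -> central (at_ i).
Proof.
elim: c => [|c IH] //= [h /IH{IH}IH]; rewrite ltnS leq_eqVlt => /orP[/eqP->|/IH] //.
Qed.

Lemma reduceP c rs w : ok_central c -> ok_rules rs -> evw (reduce c rs w) = evw w.
Proof.
move=> okc okr; have cE i : (i < c)%N -> central (at_ i) := ok_centralP okc.
(* Sorting the central letters preserves the value: the head of one word is found inside the other
   and, being central, can be brought to the front. *)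
have evw_perm u v : all (fun i => (i < c)%N) u -> perm_eq u v -> evw u = evw v.
  move=> allu puv; have allv : all (fun i => (i < c)%N) v by rewrite -(perm_all _ puv).
  elim: u v allu allv puv => [|x u IH] v; first by case: v => // y v _ _ /perm_size.
  move=> /= /andP[xc allu] allv puv.
  have xv : x \in v by rewrite -(perm_mem puv) mem_head.
  move: allv puv; case/splitPr: xv => v1 v2; rewrite all_cat /= => /and3P[a1 _ a2] puv.
  rewrite (IH (v1 ++ v2)) ?all_cat ?a1 ?a2 //.
    by rewrite !evw_cat /= !mulrA cE.
  rewrite -(perm_cons x); apply: (perm_trans puv).
  by rewrite -cat_rcons perm_catC perm_sym -cat_cons perm_catC perm_cat2l perm_sym perm_rcons.
rewrite evw_cat; transitivity (evw [seq i <- w | (i < c)%N] * evw [seq i <- w | ~~ (i < c)%N]).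
  congr (_ * _).
    by apply: evw_perm; rewrite ?all_sort ?filter_all //; rewrite perm_sort.
  by elim: [seq i <- w | _] => //= x v IHv; rewrite cons_redP // IHv.
elim: w => [|x w IH] /=; first by rewrite mulr1.
case: ltnP => xc /=; first by rewrite -mulrA IH.
rewrite -IH; move: (evw [seq i <- w | ~~ _]) => r.
have : all (fun i => (i < c)%N) [seq i <- w | (i < c)%N] by rewrite filter_all.
elim: [seq i <- w | (i < c)%N] => [|y u IHu] /=; first by rewrite !mul1r.
by move=> /andP[yc /IHu uE]; rewrite -!mulrA uE !mulrA cE.
Qed.

Lemma checkP c rs e f : ok_central c -> ok_rules rs ->
  check c rs (Add e (Opp f)) = true -> eval e = eval f.
Proof.
move=> okc okr chk; apply/eqP; rewrite -subr_eq0 -[eval e - _]/(eval (Add e (Opp f))).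
rewrite -evd_expand /evd subr_eq0; apply/eqP.
move: chk; rewrite /check; case: (expand _) => s t /= pst.
have evsE u : evs u = \sum_(w <- map (reduce c rs) u) evw w.
  by rewrite big_map; apply: eq_bigr => w _; rewrite reduceP.
by rewrite !evsE; exact: perm_big pst.
Qed.
End Eval.

Ltac memb x l :=
  lazymatch l with
  | nil => constr:(false)
  | cons x _ => constr:(true)
  | cons _ ?l' => memb x l'
  end.
Ltac index x l :=
  lazymatch l with
  | cons x _ => constr:(0%N)
  | cons _ ?l' => let n := index x l' in constr:(S n)
  end.
Ltac rcons_new x l :=
  lazymatch l with
  | nil => constr:(cons x nil)
  | cons x _ => l
  | cons ?y ?l' => let r := rcons_new x l' in constr:(cons y r)
  end.
Ltac is_numeral n :=
  lazymatch n with O => constr:(true) | S ?m => is_numeral m | _ => constr:(false) end.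
Ltac atoms t l :=
  lazymatch t with
  | GRing.zero => l
  | GRing.one _ => l
  | GRing.add ?a ?b => let l := atoms a l in atoms b l
  | GRing.mul ?a ?b => let l := atoms a l in atoms b l
  | GRing.opp ?a => atoms a l
  | GRing.natmul ?a ?n => lazymatch is_numeral n with
      | true => atoms a l | false => rcons_new t l end
  | ?x => rcons_new x l
  end.
Ltac reify t l :=
  lazymatch t with
  | GRing.zero => constr:(Zero)
  | GRing.one _ => constr:(One)
  | GRing.add ?a ?b =>
      let a := reify a l in let b := reify b l in constr:(Add a b)
  | GRing.mul ?a ?b =>
      let a := reify a l in let b := reify b l in constr:(Mul a b)
  | GRing.opp ?a => let a := reify a l in constr:(Opp a)
  | GRing.natmul ?a ?n => lazymatch is_numeral n with
      | true => let a := reify a l in constr:(Muln a n)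
      | false => let n := index t l in constr:(Atom n) end
  | ?x => let n := index x l in constr:(Atom n)
  end.
Ltac reify_word t l :=
  lazymatch t with
  | GRing.one _ => constr:(@nil nat)
  | GRing.mul ?a ?b =>
      let a := reify_word a l in let b := reify_word b l in
      let r := eval cbv [cat] in (a ++ b) in constr:(r)
  | ?x => let n := index x l in constr:(cons n nil)
  end.

(* [cs] and [rs] are nested pairs, ended by [I], of proofs of centrality and of
   equations x * y = w between atoms. *)
Ltac central_atoms cs l :=
  lazymatch cs with
  | pair ?cs' ?h => let l := central_atoms cs' l in
      lazymatch type of h with central ?z => rcons_new z l end
  | _ => l
  end.
Ltac rule_atoms rs l :=
  lazymatch rs with
  | pair ?rs' ?h => let l := rule_atoms rs' l in
      lazymatch type of h with ?a = ?b => let l := atoms a l in atoms b l end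
  | _ => l
  end.
Ltac reify_rules rs l :=
  lazymatch rs with
  | pair ?rs' ?h => let r := reify_rules rs' l in
      lazymatch type of h with ?a * ?b = ?w =>
        let i := index a l in let j := index b l in
        let w := reify_word w l in constr:(cons (i, j, w) r) end
  | _ => constr:(@nil rule)
  end.
Ltac len l := lazymatch l with nil => constr:(0%N)
  | cons _ ?l' => let n := len l' in constr:(S n) end.
Ltac prove_central cs :=
  lazymatch cs with
  | pair ?cs' ?h => split; [exact h | prove_central cs']
  | _ => exact Logic.I
  end.
Ltac prove_rules rs :=
  lazymatch rs with
  | pair ?rs' ?h => split; [rewrite /= ?mulr1; exact h | prove_rules rs']
  | _ => exact Logic.I
  end.

Ltac solve cs rs :=
  lazymatch goal with
  | |- @eq ?T ?a ?b =>
    let l0 := central_atoms cs (@nil T) in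
    let c := len l0 in
    let l := rule_atoms rs l0 in
    let l := atoms a l in let l := atoms b l in
    let r := reify_rules rs l in
    let e := reify a l in let f := reify b l in
    refine (@checkP _ l c r e f _ _ _);
    [ prove_central cs | prove_rules rs | vm_compute; reflexivity ]
  end.
End NC.

Tactic Notation "nc" := NC.solve I I.
Tactic Notation "nc" "central" constr(cs) := NC.solve cs I.
Tactic Notation "nc" "rules" constr(rs) := NC.solve I rs.
Tactic Notation "nc" "central" constr(cs) "rules" constr(rs) := NC.solve cs rs.

(** Used when the goal is a two-sided multiple of a known equation: [u] and [v] are supplied, and
    the second premise is a pure ring identity left to [nc]. With [l = r = 0] it only turns the goal
    into a difference. *)
Lemma nc_lin (D : pzRingType) (x y l r u v : D) :
  l = r -> x - y = u * (l - r) * v -> x = y.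
Proof. by move=> -> /eqP; rewrite subrr mulr0 mul0r subr_eq0 => /eqP. Qed.

(** * RTT relations and Schur complements *)

Definition nonzerodiv (D : pzRingType) (z : D) := forall x, z * x = 0 -> x = 0.

Section Ideals.
Variable D : pzRingType.
Record ideal2 (J : D -> Prop) : Prop := Ideal2 {
  ideal2_0 : J 0;
  ideal2B : forall u v, J u -> J v -> J (u - v);
  ideal2Ml : forall u v, J v -> J (u * v);
  ideal2Mr : forall u v, J u -> J (u * v) }.

Lemma ideal2N J u : ideal2 J -> J u -> J (- u).
Proof. by move=> iJ Ju; rewrite -sub0r; apply: (ideal2B iJ) Ju; exact: ideal2_0. Qed.
Lemma ideal2D J u v : ideal2 J -> J u -> J v -> J (u + v).
Proof. by move=> iJ Ju Jv; rewrite -[v]opprK; apply: (ideal2B iJ) Ju _; exact: ideal2N. Qed.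
End Ideals.

Section Rtt.
Variables (A : pzRingType) (I : Type).
Implicit Types (p q : A) (t s : I -> I -> A).

(** Here [p], [q] stand for u - v and hbar, [t] for T(u) and [s] for T(v). Each line is the other
    one for the pair ([s], [t]) with [p] negated; carrying both makes the notion stable under
    exchange of the variables. The second is obtained from the first in [rtt_of_form1]. *)
Definition rtt p q t s : Prop :=
  (forall i j k l, p * (t i j * s k l - s k l * t i j)
                   = q * (s k j * t i l - t k j * s i l)) /\
  (forall i j k l, p * (t i j * s k l - s k l * t i j)
                   = q * (t i l * s k j - s i l * t k j)).

Lemma rtt_swap p q t s : rtt p q t s -> rtt (- p) q s t.
Proof.
by case=> h1 h2; split=> i j k l; rewrite mulNr -mulrN opprB; [rewrite h2|rewrite h1].
Qed.

(** The index type is kept: with [ai] the inverse of [t o o], row and column [o] become zero instead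
    of being deleted, so that all iterated complements have the same type. *)
Definition schur (t : I -> I -> A) (o : I) (ai : A) i j := t i j - t i o * ai * t o j.

Section Step.
Variables (p q : A) (t s : I -> I -> A) (o : I) (ai bi : A).
Hypotheses (cp : central p) (cq : central q).
Hypotheses (rp : nonzerodiv p) (rpq : nonzerodiv (p + q)).
Hypotheses (ha : t o o * ai = 1) (ha' : ai * t o o = 1).
Hypotheses (hb : s o o * bi = 1) (hb' : bi * s o o = 1).
Hypothesis H : rtt p q t s.
Let H1 := H.1.
Local Notation s' := (schur s o bi).
Local Notation e j := (ai * t o j).
Local Notation e' j := (bi * s o j).
Local Notation f' i := (s i o * bi).

Lemma schur0l j : s' o j = 0.
Proof. by rewrite /schur; nc rules (I, hb). Qed.
Lemma schur0r i : s' i o = 0.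
Proof. by rewrite /schur; nc rules (I, hb'). Qed.

(** With all four indices equal to [o], the right-hand side of the relation is [q] times the
    opposite commutator, so that [p + q] kills the commutator. *)
Lemma corner_comm : t o o * s o o = s o o * t o o.
Proof.
apply/eqP; rewrite -subr_eq0; apply/eqP/rpq; rewrite mulrDl H1.
nc central (I, cp, cq).
Qed.

(** Leibniz rule for the commutator with [s k o * bi * s o l], the bracket with [bi] being [- bi
    [t i j, s o o] bi]; the first form of the relation then evaluates each bracket. *)
Lemma comm_schur_gen i j k l :
  p * (t i j * s' k l - s' k l * t i j)
  = q * (s' k j * (t i l - t i o * e' l) - (t k j - f' k * t o j) * s' i l).
Proof.
rewrite /schur.
have -> : p * (t i j * (s k l - s k o * bi * s o l) - (s k l - s k o * bi * s o l) * t i j)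
  = p * (t i j * s k l - s k l * t i j) - (p * (t i j * s k o - s k o * t i j)) * bi * s o l
    + s k o * bi * (p * (t i j * s o o - s o o * t i j)) * bi * s o l
    - s k o * bi * (p * (t i j * s o l - s o l * t i j)).
  by nc central (I, cp) rules (I, hb, hb').
by rewrite !H1; nc central (I, cq) rules (I, hb, hb').
Qed.

(** For [i = j = o] each term of [comm_schur_gen] has a factor in row or column [o] of the
    complement, which is zero. *)
Lemma comm_corner_schur k l : t o o * s' k l = s' k l * t o o.
Proof.
apply/eqP; rewrite -subr_eq0; apply/eqP/rp; rewrite comm_schur_gen schur0l schur0r.
by rewrite mul0r mulr0 subrr mulr0.
Qed.

Lemma comm_cornerV_schur k l : ai * s' k l = s' k l * ai.
Proof.
transitivity (ai * (s' k l * t o o) * ai); last first.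
  by rewrite -comm_corner_schur !mulrA ha' mul1r.
by rewrite -!mulrA ha mulr1.
Qed.

Lemma comm_row_schur j k l :
  p * (e j * s' k l - s' k l * e j) = q * (s' k j * (e l - e' l)).
Proof.
have -> : p * (e j * s' k l - s' k l * e j) = ai * (p * (t o j * s' k l - s' k l * t o j)).
  by nc central (I, cp) rules (I, esym (comm_cornerV_schur k l)).
rewrite comm_schur_gen schur0l.
by nc central (I, cq) rules (I, comm_cornerV_schur k j, ha').
Qed.

Lemma schur_rtt1 i j k l :
  p * (schur t o ai i j * s' k l - s' k l * schur t o ai i j)
  = q * (s' k j * schur t o ai i l - schur t o ai k j * s' i l).
Proof.
apply/eqP; rewrite -subr_eq0; apply/eqP/rp.
have Hf : p * (t i o * s' k j - s' k j * t i o) = - q * (t k o - f' k * t o o) * s' i j.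
  by rewrite comm_schur_gen schur0r; nc central (I, cq).
have He := comm_row_schur j i l.
have E : p * (schur t o ai i j * s' k l - s' k l * schur t o ai i j)
    = q * (s' k j * (t i l - t i o * e' l) - (t k j - f' k * t o j) * s' i l)
      + q * ((t k o - f' k * t o o) * s' i l * e j)
      - q * (t i o * (s' k j * (e l - e' l))).
  have -> : p * (schur t o ai i j * s' k l - s' k l * schur t o ai i j)
     = p * (t i j * s' k l - s' k l * t i j) - p * (t i o * s' k l - s' k l * t i o) * e j
       - t i o * (p * (e j * s' k l - s' k l * e j)).
    by rewrite /(schur t); nc central (I, cp).
  rewrite comm_row_schur !comm_schur_gen schur0r.
  by nc central (I, cq).
rewrite E.
(* The defect from the wanted right-hand side is visibly zero only after multiplication by [p]: it
   then contains two brackets with [s'], and by [Hf] and [He] both evaluate to the same product with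
   [s' i j] in the middle, with opposite signs. *)
have -> : p * (q * (s' k j * (t i l - t i o * e' l) - (t k j - f' k * t o j) * s' i l)
      + q * ((t k o - f' k * t o o) * s' i l * e j)
      - q * (t i o * (s' k j * (e l - e' l)))
      - q * (s' k j * schur t o ai i l - schur t o ai k j * s' i l))
  = q * (- (p * (t i o * s' k j - s' k j * t i o)) * (e l - e' l)
     - (t k o - f' k * t o o) * (p * (e j * s' i l - s' i l * e j))).
  by rewrite /(schur t); nc central (I, cp, cq) rules (I, ha).
by rewrite Hf He; nc central (I, cq).
Qed.
End Step.

Lemma schur_rtt p q t s o ai bi :
  central p -> central q -> nonzerodiv p -> nonzerodiv (p + q) ->
  t o o * ai = 1 -> ai * t o o = 1 -> s o o * bi = 1 -> bi * s o o = 1 ->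
  rtt p q t s -> rtt p q (schur t o ai) (schur s o bi).
Proof.
move=> cp cq rp rpq ha ha' hb hb' H; split=> i j k l.
  exact: schur_rtt1.
have cp' : central (- p) by move=> x; rewrite mulNr mulrN cp.
have rp' : nonzerodiv (- p) by move=> x; rewrite mulNr => /eqP; rewrite oppr_eq0 => /eqP /rp.
have := @schur_rtt1 (- p) q s t o bi ai cp' cq rp' hb hb' ha ha' (rtt_swap H) k l i j.
by rewrite mulNr -mulrN opprB.
Qed.
End Rtt.

Lemma rtt_tr (A : pzRingType) I (p q : A) (t s : I -> I -> A) :
  central p -> central q -> rtt p q t s ->
  @rtt A^c I p q (fun i j => t j i) (fun i j => s j i).
Proof.
move=> cp cq [h1 h2].
have opp_pq (x y z w : A) : p * (x - y) = q * (z - w) -> (y - x) * p = (w - z) * q.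
  by move=> E; rewrite -cp -cq; apply: oppr_inj; rewrite -!mulrN !opprB.
by split=> i j k l; [exact: opp_pq (h1 j i l k)|exact: opp_pq (h2 j i l k)].
Qed.

Lemma commute_inv (A : pzRingType) (x y yi : A) :
  y * yi = 1 -> yi * y = 1 -> x * y = y * x -> x * yi = yi * x.
Proof.
move=> h h' c; transitivity (yi * (y * x) * yi); first by rewrite mulrA h' mul1r.
by rewrite -c -!mulrA h mulr1.
Qed.

Lemma rtt_ext (A : pzRingType) (I : Type) (p q : A) (t t' s s' : I -> I -> A) :
  (forall i j, t i j = t' i j) -> (forall i j, s i j = s' i j) ->
  rtt p q t s -> rtt p q t' s'.
Proof. by move=> et es [h1 h2]; split=> i j k l; rewrite -!et -!es; [exact: h1|exact: h2]. Qed.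

(* Uniqueness of the Gauss decomposition, in the only form that is needed: the
   chosen factors inherit unipotency modulo J. *)
Lemma gauss_triangular_mod (A : pzRingType) (J : A -> Prop) N
    (t F E : 'I_N -> 'I_N -> A) (K : 'I_N -> A) :
  ideal2 J -> (forall m, J (K m - 1) -> exists z, K m * z = 1 /\ z * K m = 1) ->
  (forall i j, t i j = \sum_a F i a * K a * E a j) ->
  (forall i j : 'I_N, (i <= j)%N -> F i j = (i == j)%:R) ->
  (forall i j : 'I_N, (j <= i)%N -> E i j = (i == j)%:R) ->
  (forall i j, J (t i j - (i == j)%:R)) ->
  [/\ forall m, J (K m - 1), forall i j, J (E i j - (i == j)%:R)
    & forall i j, J (F i j - (i == j)%:R)].
Proof.
move=> iJ uJ ht hF hE Jt.
have JM a b : J a -> J (a * b) by exact: ideal2Mr.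
have JM' a b : J b -> J (a * b) by exact: ideal2Ml.
have JB a b : J a -> J b -> J (a - b) by exact: ideal2B.
have Jsum (r : seq 'I_N) (P : pred 'I_N) (G : 'I_N -> A) : (forall a, P a -> J (G a)) -> J (\sum_(a <- r | P a) G a).
  move=> h; elim/big_rec: _ => [|a x Pa Jx]; first exact: ideal2_0.
  by apply: (ideal2D iJ) => //; exact: h.
suff main n : forall m : 'I_N, (m < n)%N -> [/\ J (K m - 1),
    forall j : 'I_N, (m < j)%N -> J (E m j) & forall i : 'I_N, (m < i)%N -> J (F i m)].
  have {}main m := main N m (ltn_ord m).
  split=> [m|i j|i j]; first by have [] := main m.
    have [ij|ij] := leqP j i; first by rewrite hE // subrr; exact: ideal2_0.
    by rewrite -val_eqE /= (ltn_eqF ij) subr0; have [_ h _] := main i; exact: h.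
  have [ij|ij] := leqP i j; first by rewrite hF // subrr; exact: ideal2_0.
  by rewrite -val_eqE /= (gtn_eqF ij) subr0; have [_ _ h] := main j; exact: h.
elim: n => [|n IH] m //; rewrite ltnS => mn.
have {mn}IH (a : 'I_N) : (a < m)%N -> _ := fun am => IH a (leq_trans am mn).
(* In row or column [m] of the product, the terms with [a < m] lie in [J] by induction and those
   with [a > m] vanish by triangularity. *)
have tm (i j : 'I_N) : (m <= i)%N -> (m <= j)%N -> i == m \/ j == m ->
    exists2 x, J x & t i j = x + F i m * K m * E m j.
  move=> mi mj ij; exists (\sum_(a | a != m) F i a * K a * E a j); last first.
    by rewrite ht (bigD1 m) //= addrC.
  apply: Jsum => a am; have [lt|ge] := ltnP a m.
    have [_ Ja _] := IH a lt; apply: JM'; apply: Ja; exact: leq_trans lt mj.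
  have gt : (m < a)%N by rewrite ltn_neqAle eq_sym am ge.
  case: ij => /eqP e.
    by rewrite e hF ?(ltnW gt) // -val_eqE /= (ltn_eqF gt) !mul0r; exact: ideal2_0.
  by rewrite e hE ?(ltnW gt) // -val_eqE /= (gtn_eqF gt) mulr0; exact: ideal2_0.
have Fm : F m m = 1 by rewrite hF // eqxx.
have Em : E m m = 1 by rewrite hE // eqxx.
have JK : J (K m - 1).
  have [x Jx e] := tm m m (leqnn m) (leqnn m) (or_introl (eqxx m)).
  have := JB _ _ (Jt m m) Jx; rewrite e Fm Em mul1r mulr1 eqxx.
  by congr J; rewrite addrAC (addrC x) addrK.
have [ki [k1 k2]] := uJ m JK.
split=> // j mj.
  have [x Jx e] := tm m j (leqnn m) (ltnW mj) (or_introl (eqxx m)).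
  have := JM' ki _ (JB _ _ (Jt m j) Jx); rewrite e Fm mul1r -val_eqE /= (ltn_eqF mj) subr0.
  by congr J; rewrite addrC addKr mulrA k2 mul1r.
have [x Jx e] := tm j m (ltnW mj) (leqnn m) (or_intror (eqxx m)).
have := JM _ ki (JB _ _ (Jt j m) Jx); rewrite e Em mulr1 -val_eqE /= (gtn_eqF mj) subr0.
by congr J; rewrite addrC addKr -mulrA k1 mulr1.
Qed.

Record gaussdec (A : pzRingType) N (t F : 'I_N -> 'I_N -> A) (K Ki : 'I_N -> A)
    (E : 'I_N -> 'I_N -> A) : Prop := GaussDec {
  gd_mul : forall i j, t i j = \sum_a F i a * K a * E a j;
  gd_F : forall i j : 'I_N, (i <= j)%N -> F i j = (i == j)%:R;
  gd_E : forall i j : 'I_N, (j <= i)%N -> E i j = (i == j)%:R;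
  gd_inv : forall a, K a * Ki a = 1;
  gd_invl : forall a, Ki a * K a = 1 }.

Lemma gaussdec_tr (A : pzRingType) N (t F : 'I_N -> 'I_N -> A) K Ki E :
  gaussdec t F K Ki E ->
  @gaussdec A^c N (fun i j => t j i) (fun i j => E j i) K Ki (fun i j => F j i).
Proof.
case=> h hF hE h1 h2; split=> //.
- by move=> i j; rewrite h; apply: eq_bigr => a _; exact: (esym (@mulrA A (F j a) (K a) (E a i))).
- by move=> i j ij; rewrite hE // eq_sym.
- by move=> i j ij; rewrite hF // eq_sym.
Qed.

(** * Iterated Schur complements and Gauss coordinates *)

Section Tower.
Variables (A : pzRingType) (N : nat) (t F : 'I_N -> 'I_N -> A) (K Ki : 'I_N -> A).
Variable E : 'I_N -> 'I_N -> A.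
Hypothesis gd : gaussdec t F K Ki E.

(* By the Gauss decomposition this is the Schur complement of the first m rows and
   columns. *)
Definition tower m i j := \sum_(a : 'I_N | (m <= a)%N) F i a * K a * E a j.

Lemma tower0 i j : tower 0 i j = t i j.
Proof. by rewrite /tower (gd_mul gd). Qed.

Lemma tower_row (m : 'I_N) j : tower m m j = K m * E m j.
Proof.
rewrite /tower (bigD1 m) //= big1 => [|a /andP[ma am]]; rewrite (gd_F gd) //.
  by rewrite eqxx mul1r addr0.
by rewrite eq_sym (negPf am) !mul0r.
Qed.

Lemma tower_col (m : 'I_N) i : tower m i m = F i m * K m.
Proof.
rewrite /tower (bigD1 m) //= big1 => [|a /andP[ma am]]; rewrite (gd_E gd) //.
  by rewrite eqxx mulr1 addr0.
by rewrite (negPf am) mulr0.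
Qed.

Lemma tower_diag (m : 'I_N) : tower m m m = K m.
Proof. by rewrite tower_row (gd_E gd) // eqxx mulr1. Qed.

(** By triangularity, row [m] is [K m * E m j] and column [m] is [F i m * K m]; the product
    subtracted by the Schur complement is therefore the term [a = m] of the sum. *)
Lemma towerS (m : 'I_N) i j : tower m.+1 i j = schur (tower m) m (Ki m) i j.
Proof.
rewrite /schur tower_row tower_col.
have -> : F i m * K m * Ki m * (K m * E m j) = F i m * K m * E m j.
  by nc rules (Logic.I, gd_inv gd m).
apply/eqP; rewrite eq_sym subr_eq; apply/eqP.
rewrite {1}/tower (bigD1 m) //= addrC; congr (_ + _).
by apply: eq_bigl => a; rewrite ltn_neqAle andbC [m == a :> nat]eq_sym.
Qed.

(** The entries of later complements are obtained from earlier ones with products and inverses of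
    pivots, so commutation is inherited. All commutation between distant Gauss coordinates comes
    from here. *)
Lemma commute_tower x (m : nat) : (forall i j, x * tower m i j = tower m i j * x) ->
  forall n : nat, (m <= n <= N)%N -> forall i j, x * tower n i j = tower n i j * x.
Proof.
move=> c n /andP[mn nN]; elim: n mn nN => [|n IH].
  by rewrite leqn0 => /eqP <-.
rewrite leq_eqVlt => /orP[/eqP <- //|mn nN i j].
have {}IH := IH mn (ltnW nN).
rewrite (towerS (Ordinal nN)) /schur.
have c1 := IH i j; have c2 := IH i (Ordinal nN); have c3 := IH (Ordinal nN) j.
have c4 : x * Ki (Ordinal nN) = Ki (Ordinal nN) * x.
  apply: commute_inv (gd_inv gd _) (gd_invl gd _) _.
  by rewrite -tower_diag IH.
by rewrite mulrBr mulrBl c1 !mulrA c2 -(mulrA _ x) c4 -!mulrA c3.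
Qed.

Lemma commute_tower_entries x (m n : 'I_N) :
  (forall i j, x * tower m i j = tower m i j * x) -> (m <= n)%N ->
  [/\ x * K n = K n * x, forall l, x * E n l = E n l * x
    & forall l, x * F l n = F l n * x].
Proof.
move=> c mn; have {}c i j : x * tower n i j = tower n i j * x.
  by apply: commute_tower c _ _ i j; rewrite mn ltnW.
have cK : x * K n = K n * x by rewrite -tower_diag c.
have cKi := commute_inv (gd_inv gd n) (gd_invl gd n) cK.
split=> // l.
  have := c n l; rewrite tower_row => h.
  transitivity (Ki n * (x * (K n * E n l))).
    by rewrite mulrA -cKi -mulrA (mulrA (Ki n)) (gd_invl gd) mul1r.
  by rewrite h !mulrA (gd_invl gd) mul1r.
have := c l n; rewrite tower_col => h.
transitivity (x * (F l n * K n) * Ki n); first by rewrite -!mulrA (gd_inv gd) mulr1.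
by rewrite h -!mulrA cKi !mulrA -(mulrA _ (K n)) (gd_inv gd) mulr1.
Qed.
End Tower.

Section TwoFamilies.
Variables (A : pzRingType) (N : nat) (p q : A).
Variables (t F : 'I_N -> 'I_N -> A) (K Ki : 'I_N -> A) (E : 'I_N -> 'I_N -> A).
Variables (s F2 : 'I_N -> 'I_N -> A) (K2 Ki2 : 'I_N -> A) (E2 : 'I_N -> 'I_N -> A).
Hypotheses (cp : central p) (cq : central q).
Hypotheses (rp : nonzerodiv p) (rpq : nonzerodiv (p + q)).
Hypotheses (gd : gaussdec t F K Ki E) (gd2 : gaussdec s F2 K2 Ki2 E2).
Hypothesis H : rtt p q t s.
Local Notation tw := (tower F K E).
Local Notation tw2 := (tower F2 K2 E2).

Lemma rtt_tower m : (m <= N)%N -> rtt p q (tw m) (tw2 m).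
Proof.
elim: m => [|m IH] mN.
  by apply: rtt_ext H => i j; rewrite ?(tower0 gd) ?(tower0 gd2).
have {}IH := IH (ltnW mN); pose o := Ordinal mN.
have ha : tw m o o * Ki o = 1 by rewrite (tower_diag gd o) (gd_inv gd).
have ha' : Ki o * tw m o o = 1 by rewrite (tower_diag gd o) (gd_invl gd).
have hb : tw2 m o o * Ki2 o = 1 by rewrite (tower_diag gd2 o) (gd_inv gd2).
have hb' : Ki2 o * tw2 m o o = 1 by rewrite (tower_diag gd2 o) (gd_invl gd2).
apply: rtt_ext (schur_rtt cp cq rp rpq ha ha' hb hb' IH) => i j.
  exact: esym (towerS gd o i j).
exact: esym (towerS gd2 o i j).
Qed.

Section Node.
Variable o : 'I_N.
Let Ho : rtt p q (tw o) (tw2 o) := rtt_tower (ltnW (ltn_ord o)).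
Let ha : tw o o o * Ki o = 1. Proof. by rewrite (tower_diag gd) (gd_inv gd). Qed.
Let ha' : Ki o * tw o o o = 1. Proof. by rewrite (tower_diag gd) (gd_invl gd). Qed.
Let hb : tw2 o o o * Ki2 o = 1. Proof. by rewrite (tower_diag gd2) (gd_inv gd2). Qed.
Let hb' : Ki2 o * tw2 o o o = 1. Proof. by rewrite (tower_diag gd2) (gd_invl gd2). Qed.
Let eE l : Ki o * tw o o l = E o l.
Proof. by rewrite (tower_row gd) mulrA (gd_invl gd) mul1r. Qed.
Let eE2 l : Ki2 o * tw2 o o l = E2 o l.
Proof. by rewrite (tower_row gd2) mulrA (gd_invl gd2) mul1r. Qed.

Lemma K_tower i j : K o * tw2 o.+1 i j = tw2 o.+1 i j * K o.
Proof.
rewrite !(towerS gd2) -(tower_diag gd).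
exact: comm_corner_schur cp cq rp hb hb' Ho i j.
Qed.

Lemma K_K_same : K o * K2 o = K2 o * K o.
Proof.
by have := corner_comm o cp cq rpq Ho; rewrite (tower_diag gd) (tower_diag gd2).
Qed.

Lemma E_tower j k l : p * (E o j * tw2 o.+1 k l - tw2 o.+1 k l * E o j)
  = q * (tw2 o.+1 k j * (E o l - E2 o l)).
Proof.
rewrite !(towerS gd2) -!eE -!eE2.
exact: comm_row_schur cp cq rp ha ha' hb hb' Ho j k l.
Qed.

Lemma K_E_same l :
  p * (K o * E2 o l - E2 o l * K o) = q * (K o * (E o l - E2 o l)).
Proof.
have := Ho.1 o o o l.
rewrite !(tower_row gd) !(tower_row gd2) (gd_E gd2 (leqnn o)) (gd_E gd (leqnn o)) eqxx !mulr1 => h.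
have -> : p * (K o * E2 o l - E2 o l * K o)
   = Ki2 o * (p * (K o * (K2 o * E2 o l) - K2 o * E2 o l * K o)).
  by nc central (Logic.I, cp) rules (Logic.I, gd_invl gd2 o, K_K_same).
rewrite h.
by nc central (Logic.I, cq) rules (Logic.I, gd_invl gd2 o, K_K_same).
Qed.

Lemma E_row_row j l :
  p * (K o * E o j * (K2 o * E2 o l) - K2 o * E2 o l * (K o * E o j))
  = q * (K2 o * E2 o j * (K o * E o l) - K o * E o j * (K2 o * E2 o l)).
Proof. by have := Ho.1 o j o l; rewrite !(tower_row gd) !(tower_row gd2). Qed.

Lemma E_row_K j :
  p * (K o * E o j * K2 o - K2 o * (K o * E o j))
  = q * (K2 o * E2 o j * K o - K o * E o j * K2 o).
Proof. by have := E_row_row j o; rewrite (gd_E gd2 (leqnn o)) (gd_E gd (leqnn o)) eqxx !mulr1. Qed.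

(** By [E_tower] the bracket of [E o j] with an entry of the complement after [o] has an entry of
    column [j] as a left factor, and eliminating [j] makes this column zero. *)
Lemma E_tower2 (j : 'I_N) k l : j = o.+1 :> nat ->
  E o j * tw2 j.+1 k l = tw2 j.+1 k l * E o j.
Proof.
move=> jo; apply/eqP; rewrite -subr_eq0; apply/eqP/rp; rewrite !(towerS gd2) /schur.
rewrite jo; have h k l := E_tower j k l.
have dj : tw2 o.+1 j j = K2 j by rewrite -jo (tower_diag gd2).
have hj := h j j; rewrite !dj in hj.
have i1 := gd_inv gd2 j; have i2 := gd_invl gd2 j.
have -> : forall x y z w, p * (E o j * (x - y * w * z) - (x - y * w * z) * E o j) =
  p * (E o j * x - x * E o j) - (p * (E o j * y - y * E o j)) * w * z
  - y * (p * (E o j * w - w * E o j)) * z - y * w * (p * (E o j * z - z * E o j)).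
  by move=> x y z w; nc central (Logic.I, cp).
have -> : p * (E o j * Ki2 j - Ki2 j * E o j)
  = - (Ki2 j * (p * (E o j * K2 j - K2 j * E o j)) * Ki2 j).
  by nc central (Logic.I, cp) rules (Logic.I, i1, i2).
by rewrite !h hj dj; nc central (Logic.I, cq) rules (Logic.I, i1, i2).
Qed.
End Node.
End TwoFamilies.

(** * Relations between Gauss coordinates *)

Record gaussfam (A : pzRingType) N := GaussFam {
  gT : 'I_N -> 'I_N -> A; gF : 'I_N -> 'I_N -> A; gK : 'I_N -> A;
  gKi : 'I_N -> A; gE : 'I_N -> 'I_N -> A;
  gP : gaussdec gT gF gK gKi gE }.

Definition gaussfam_tr (A : pzRingType) N (g : gaussfam A N) : gaussfam A^c N :=
  GaussFam (gaussdec_tr (gP g)).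

(** The regularity of [p - q] is there for the exchange of the two families, which replaces [p] by
    [- p] and hence [p + q] by [- (p - q)]. *)
Record rttpair (A : pzRingType) N (p q : A) (g h : gaussfam A N) : Prop := RttPair {
  rtt_cp : central p; rtt_cq : central q; rtt_rp : nonzerodiv p;
  rtt_rpD : nonzerodiv (p + q); rtt_rpB : nonzerodiv (p - q);
  rtt_rel : rtt p q (gT g) (gT h) }.

Lemma nonzerodivN (A : pzRingType) (p : A) : nonzerodiv p -> nonzerodiv (- p).
Proof. by move=> rp x; rewrite mulNr => /eqP; rewrite oppr_eq0 => /eqP /rp. Qed.

Lemma centralN (A : pzRingType) (p : A) : central p -> central (- p).
Proof. by move=> cp x; rewrite mulNr mulrN cp. Qed.

Lemma rttpair_swap (A : pzRingType) N (p q : A) (g h : gaussfam A N) :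
  rttpair p q g h -> rttpair (- p) q h g.
Proof.
case=> cp cq rp rD rB r; split=> //; [exact: centralN|exact: nonzerodivN| | |exact: rtt_swap].
  by rewrite addrC -opprB; exact: nonzerodivN.
by rewrite -opprD; exact: nonzerodivN.
Qed.

Lemma rttpair_tr (A : pzRingType) N (p q : A) (g h : gaussfam A N) :
  rttpair p q g h -> @rttpair A^c N p q (gaussfam_tr g) (gaussfam_tr h).
Proof.
case=> cp cq rp rD rB r; have cpq : central (p + q).
  by move=> x; rewrite mulrDl mulrDr cp cq.
have cpq' : central (p - q) by move=> x; rewrite mulrBl mulrBr cp cq.
split=> //.
- by move=> x; exact: esym (cp x).
- by move=> x; exact: esym (cq x).
- by move=> x h0; apply: rp; rewrite cp.
- by move=> x h0; apply: rD; rewrite cpq.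
- by move=> x h0; apply: rB; rewrite cpq'.
- exact: rtt_tr.
Qed.

Section Relations.
Variables (A : pzRingType) (N : nat) (p q : A) (g h : gaussfam A N).
Hypothesis P : rttpair p q g h.
Let cp := rtt_cp P.
Let cq := rtt_cq P.
Let rp := rtt_rp P.
Let rpq := rtt_rpD P.
Let H := rtt_rel P.
Let gd := gP g.
Let gd2 := gP h.
Let P' := rttpair_swap P.
Local Notation K := (gK g).
Local Notation Ki := (gKi g).
Local Notation E := (gE g).
Local Notation F := (gF g).
Local Notation K2 := (gK h).
Local Notation Ki2 := (gKi h).
Local Notation E2 := (gE h).
Local Notation F2 := (gF h).
Local Notation T := Logic.I.

Lemma cancel_p (x y : A) : p * x = p * y -> x = y.
Proof.
move=> e; apply/eqP; rewrite -subr_eq0; apply/eqP/rp.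
by rewrite mulrBr e subrr.
Qed.

Lemma K_comm_after (i j : 'I_N) : (i < j)%N ->
  [/\ K i * K2 j = K2 j * K i, forall l, K i * E2 j l = E2 j l * K i
    & forall l, K i * F2 l j = F2 l j * K i].
Proof.
move=> ij; have iN : (i.+1 < N)%N := leq_ltn_trans ij (ltn_ord j).
apply: (commute_tower_entries gd2 (m := Ordinal iN)) => // k l.
exact: K_tower cp cq rp rpq gd gd2 H i k l.
Qed.

Lemma E_comm_after (o j n : 'I_N) : j = o.+1 :> nat -> (j < n)%N ->
  [/\ E o j * K2 n = K2 n * E o j, forall l, E o j * E2 n l = E2 n l * E o j
    & forall l, E o j * F2 l n = F2 l n * E o j].
Proof.
move=> jo jn; have jN : (j.+1 < N)%N := leq_ltn_trans jn (ltn_ord n).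
apply: (commute_tower_entries gd2 (m := Ordinal jN)) => // k l.
exact: E_tower2 cp cq rp rpq gd gd2 H o j k l jo.
Qed.

Lemma E_K_next (o j : 'I_N) : j = o.+1 :> nat ->
  p * (E o j * K2 j - K2 j * E o j) = q * (K2 j * (E o j - E2 o j)).
Proof.
move=> jo; have := E_tower cp cq rp rpq gd gd2 H o j j j.
by rewrite -jo (tower_diag gd2).
Qed.

(** Row [j] of the complement is [K2 j * E2 j l]; the bracket with [K2 j] is known from [E_K_next]
    and is removed by the Leibniz rule. *)
Lemma E_E_next (o j l : 'I_N) : j = o.+1 :> nat ->
  p * (E o j * E2 j l - E2 j l * E o j)
  = q * (E o l - E2 o l - (E o j - E2 o j) * E2 j l).
Proof.
move=> jo; have := E_tower cp cq rp rpq gd gd2 H o j j l.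
have hj := E_K_next jo; have i2 := gd_invl gd2 j.
rewrite -jo (tower_diag gd2) (tower_row gd2) => hl.
have -> : p * (E o j * E2 j l - E2 j l * E o j)
  = Ki2 j * (p * (E o j * (K2 j * E2 j l) - K2 j * E2 j l * E o j)
             - (p * (E o j * K2 j - K2 j * E o j)) * E2 j l).
  by nc central (T, cp) rules (T, i2).
by rewrite hl hj; nc central (T, cq) rules (T, i2).
Qed.

(** Column [j] of the complement is [F2 k j * K2 j], and its bracket with [E o j] equals [F2 k j]
    times the bracket with [K2 j] alone. Nothing is left for [F2 k j]. *)
Lemma E_F_after (o j k : 'I_N) : j = o.+1 :> nat -> k = j.+1 :> nat ->
  E o j * F2 k j = F2 k j * E o j.
Proof.
move=> jo kj; apply: cancel_p; apply/eqP; rewrite -subr_eq0 -mulrBr; apply/eqP.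
have := E_tower cp cq rp rpq gd gd2 H o j k j.
have hj := E_K_next jo; have i1 := gd_inv gd2 j.
rewrite -jo (tower_col gd2) => hl.
have -> : p * (E o j * F2 k j - F2 k j * E o j)
  = (p * (E o j * (F2 k j * K2 j) - F2 k j * K2 j * E o j)
     - F2 k j * (p * (E o j * K2 j - K2 j * E o j))) * Ki2 j.
  by nc central (T, cp) rules (T, i1).
by rewrite hl hj; nc central (T, cq) rules (T, i1).
Qed.

Lemma E_row_tower (o j l : 'I_N) : j = o.+1 :> nat ->
  p * (E o l * (K2 j * E2 j l) - K2 j * E2 j l * E o l)
  = q * (K2 j * E2 j l * (E o l - E2 o l)).
Proof.
move=> jo; have := E_tower cp cq rp rpq gd gd2 H o l j l.
by rewrite -jo (tower_row gd2).
Qed.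

Lemma Ki_E_same (o l : 'I_N) :
  p * (Ki o * E2 o l - E2 o l * Ki o) = - (q * ((E o l - E2 o l) * Ki o)).
Proof.
have h1 := gd_inv gd o; have h2 := gd_invl gd o.
have -> : p * (Ki o * E2 o l - E2 o l * Ki o)
  = - (Ki o * (p * (K o * E2 o l - E2 o l * K o)) * Ki o).
  by nc central (T, cp) rules (T, h1, h2).
rewrite (K_E_same cp cq rp rpq gd gd2 H).
by nc central (T, cq) rules (T, h1, h2).
Qed.
End Relations.

Section Relations2.
Variables (A : pzRingType) (N : nat) (p q : A) (g h : gaussfam A N).
Hypothesis P : rttpair p q g h.
Let cp := rtt_cp P.
Let cq := rtt_cq P.
Let rp := rtt_rp P.
Let rpq := rtt_rpD P.
Let H := rtt_rel P.
Let gd := gP g.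
Let gd2 := gP h.
Let P' := rttpair_swap P.
Local Notation K := (gK g).
Local Notation Ki := (gKi g).
Local Notation E := (gE g).
Local Notation F := (gF g).
Local Notation K2 := (gK h).
Local Notation Ki2 := (gKi h).
Local Notation E2 := (gE h).
Local Notation F2 := (gF h).
Local Notation T := Logic.I.

Lemma K_K i j : K i * K2 j = K2 j * K i.
Proof.
have [ij|ji|ij] := ltngtP i j.
- by have [] := K_comm_after P ij.
- by have [-> _ _] := K_comm_after P' ji.
- by rewrite -(val_inj ij); exact: K_K_same cp cq rp rpq gd gd2 H i.
Qed.

Lemma K_E_corner o l :
  p * (K o * E2 o l - E2 o l * K o) = q * (K o * (E o l - E2 o l)).
Proof. exact: K_E_same cp cq rp rpq gd gd2 H o l. Qed.

Lemma K_E_next (o j : 'I_N) : j = o.+1 :> nat ->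
  p * (K j * E2 o j - E2 o j * K j) = - (q * (K j * (E o j - E2 o j))).
Proof.
move=> jo; have := E_K_next P' jo.
by rewrite mulNr -mulrN opprB => ->; rewrite -mulrN -mulrN opprB.
Qed.

Lemma K_E_far (i o j : 'I_N) : j = o.+1 :> nat -> i != o -> i != j ->
  K i * E2 o j = E2 o j * K i.
Proof.
move=> jo io ij; have [lt_io|lt_oi|eq_io] := ltngtP i o.
- by have [_ -> _] := K_comm_after P lt_io.
- have lt_ji : (j < i)%N by rewrite ltn_neqAle jo lt_oi -jo eq_sym andbT.
  by have [-> _ _] := E_comm_after P' jo lt_ji.
- by rewrite (val_inj eq_io) eqxx in io.
Qed.

Lemma E_E_same o j :
  p * (E o j * E2 o j - E2 o j * E o j)
  = q * (E2 o j * E o j + E o j * E2 o j - E o j * E o j - E2 o j * E2 o j).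
Proof.
have hr := E_row_row cp cq rp rpq gd gd2 H o j j.
have h1 := K_E_corner o j; have h2 := K_E_same (rtt_cp P') cq (rtt_rp P') (rtt_rpD P') gd2 gd (rtt_rel P') o j.
have [i1 i2 i3 i4] : [/\ K o * Ki o = 1, Ki o * K o = 1, K2 o * Ki2 o = 1 & Ki2 o * K2 o = 1].
  by rewrite !(gd_inv gd) !(gd_invl gd) !(gd_inv gd2) !(gd_invl gd2).
have c := K_K o o.
move: hr h1 h2; move: (E o j) (E2 o j) (K o) (K2 o) (Ki o) (Ki2 o) i1 i2 i3 i4 c.
move=> e e' a b ai bi i1 i2 i3 i4 c hr h1 h2.
(* For equal column indices the right-hand side of [E_row_row] is [- q] times the same commutator,
   so [p + q] is cancelled. It remains to pull the diagonal factors out of this commutation. *)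
have hr' : a * e * (b * e') = b * e' * (a * e).
  apply/eqP; rewrite -subr_eq0; apply/eqP/rpq; rewrite mulrDl hr.
  by nc central (T, cq).
apply/eqP; rewrite -subr_eq0; apply/eqP.
transitivity (bi * ai * (p * (a * e * (b * e') - b * e' * (a * e))
    - a * (- p * (b * e - e * b) - q * (b * (e' - e))) * e'
    - b * (p * (a * e' - e' * a) - q * (a * (e - e'))) * e)); last first.
  by rewrite h1 h2 hr' !subrr !(mulr0, mul0r) !subr0 mulr0.
by nc central (T, cp, cq) rules (T, i1, i2, i3, i4, esym c).
Qed.

Lemma E_E_far (i i' o o' : 'I_N) : i' = i.+1 :> nat -> o' = o.+1 :> nat ->
  (i.+1 < o)%N || (o.+1 < i)%N -> E i i' * E2 o o' = E2 o o' * E i i'.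
Proof.
move=> hi ho /orP[] lt.
  by have [_ -> _] := E_comm_after P hi (n := o) (eq_ind_r (fun n => n < o)%N lt hi).
by have [_ -> _] := E_comm_after P' ho (n := i) (eq_ind_r (fun n => n < i)%N lt ho).
Qed.

Lemma E_F_lt (i i' o o' : 'I_N) : i' = i.+1 :> nat -> o' = o.+1 :> nat ->
  (i < o)%N -> E i i' * F2 o' o = F2 o' o * E i i'.
Proof.
move=> hi ho; rewrite leq_eqVlt => /orP[/eqP e|lt].
  have ei : i' = o by apply: val_inj; rewrite /= hi.
  by rewrite ei; apply: (E_F_after P) => //; rewrite -ei.
by have [_ _ ->] := E_comm_after P hi (n := o) (eq_ind_r (fun n => n < o)%N lt hi).
Qed.

Lemma H_E_same (o j : 'I_N) : j = o.+1 :> nat ->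
  p * (K j * Ki o * E2 o j - E2 o j * (K j * Ki o))
  = q * (K j * Ki o * E2 o j + E2 o j * (K j * Ki o) - K j * E o j * Ki o *+ 2).
Proof.
move=> jo; have hb := K_E_next jo; have hc := Ki_E_same P o j.
apply: cancel_p P _ _ _; apply/eqP; rewrite -subr_eq0; apply/eqP.
move: (E o j) (E2 o j) (K j) (Ki o) hb hc => e e' b c hb hc.
(* The Leibniz rule with weights [p], [p] would leave the product [b * e' * c], with [e'] in the
   middle. The additional weights [q], [- q] trade it for the symmetric sum of [b * c * e'] and
   [e' * b * c]; the price is the factor [p] cancelled above. *)
transitivity ((p + q) * (p * (b * e' - e' * b) - - (q * (b * (e - e')))) * c
   + (p - q) * b * (p * (c * e' - e' * c) - - (q * ((e - e') * c)))).
  by nc central (T, cp, cq).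
by rewrite hb hc !subrr !(mul0r, mulr0) addr0.
Qed.

Lemma H_E_after (o j l : 'I_N) : j = o.+1 :> nat -> l = j.+1 :> nat ->
  p * (K j * Ki o * E2 j l - E2 j l * (K j * Ki o))
  = q * (K j * E j l * Ki o - K j * Ki o * E2 j l).
Proof.
move=> jo lj; have hb := K_E_corner j l.
have oj : o != j by rewrite -val_eqE /= jo neq_ltn ltnSn.
have ol : o != l by rewrite -val_eqE /= lj jo neq_ltn leqnSn.
have hc := commute_inv (gd_inv gd o) (gd_invl gd o) (esym (K_E_far lj oj ol)).
have -> : p * (K j * Ki o * E2 j l - E2 j l * (K j * Ki o))
  = p * (K j * E2 j l - E2 j l * K j) * Ki o by nc central (T, cp) rules (T, esym hc).
by rewrite hb; nc central (T, cq) rules (T, esym hc).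
Qed.

Lemma H_E_before (o j l : 'I_N) : j = o.+1 :> nat -> l = j.+1 :> nat ->
  p * (K l * Ki j * E2 o j - E2 o j * (K l * Ki j))
  = q * (K l * E o j * Ki j - E2 o j * (K l * Ki j)).
Proof.
move=> jo lj; have hb := K_E_next jo.
have i1 := gd_inv gd j; have i2 := gd_invl gd j.
have oj : l != o by rewrite -val_eqE /= lj jo neq_ltn leqnSn orbT.
have ol : l != j by rewrite -val_eqE /= lj neq_ltn ltnSn orbT.
have hc := K_E_far jo oj ol.
have -> : p * (K l * Ki j * E2 o j - E2 o j * (K l * Ki j))
  = - (K l * Ki j * (p * (K j * E2 o j - E2 o j * K j)) * Ki j).
  by nc central (T, cp) rules (T, i1, i2, hc).
by rewrite hb; nc central (T, cq) rules (T, i1, i2, hc).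
Qed.

Lemma H_E_far (i i' o o' : 'I_N) : i' = i.+1 :> nat -> o' = o.+1 :> nat ->
  (i.+1 < o)%N || (o.+1 < i)%N ->
  K i' * Ki i * E2 o o' = E2 o o' * (K i' * Ki i).
Proof.
move=> hi ho lt.
have ne (x y : 'I_N) : (x < y)%N || (y < x)%N -> x != y by rewrite -val_eqE neq_ltn.
have c1 : K i' * E2 o o' = E2 o o' * K i'.
  apply: K_E_far => //; apply: ne; rewrite hi ?ho.
    by case/orP: lt => [->//|lt]; rewrite (ltn_trans _ (leqW lt)) ?orbT.
  by rewrite !ltnS; case/orP: lt => [/ltnW ->//|/ltnW ->]; rewrite orbT.
have c2 : K i * E2 o o' = E2 o o' * K i.
  apply: K_E_far => //; apply: ne; rewrite ?ho.
    by case/orP: lt => /ltnW ->; rewrite ?orbT.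
  by case/orP: lt => lt; [rewrite (leq_trans (leqnSn _)) // ltnW // ltnW|rewrite lt orbT].
by rewrite -mulrA -(commute_inv (gd_inv gd i) (gd_invl gd i) (esym c2)) mulrA c1 mulrA.
Qed.

End Relations2.

Section Relations3.
Variables (A : pzRingType) (N : nat) (p q : A) (g h : gaussfam A N).
Hypothesis P : rttpair p q g h.
Let cp := rtt_cp P.
Let cq := rtt_cq P.
Let P' := rttpair_swap P.
Local Notation K := (gK g).
Local Notation Ki := (gKi g).
Local Notation E := (gE g).
Local Notation F := (gF g).
Local Notation K2 := (gK h).
Local Notation Ki2 := (gKi h).
Local Notation E2 := (gE h).
Local Notation F2 := (gF h).
Local Notation T := Logic.I.

Lemma E_F_neq (i i' o o' : 'I_N) : i' = i.+1 :> nat -> o' = o.+1 :> nat ->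
  i != o -> E i i' * F2 o' o = F2 o' o * E i i'.
Proof.
move=> hi ho; rewrite -val_eqE neq_ltn => /orP[lt|lt].
  exact: (E_F_lt P hi ho lt).
(* Transposition exchanges [E] and [F], so this is the previous case for the swapped pair in the
   opposite ring. *)
exact: (E_F_lt (rttpair_tr P') ho hi lt).
Qed.

Lemma K_F_same o l :
  p * (F2 l o * K o - K o * F2 l o) = q * ((F l o - F2 l o) * K o).
Proof. by rewrite cp cq; exact: (K_E_corner (rttpair_tr P) o l). Qed.

(** Start from the RTT relation between entries (o, j) and (j, o) of the complement, whose
    right-hand side contains the diagonal entries [K j + F j o * K o * E o j]. Moving [E] and [F]
    past the diagonal factors with [K_E_corner] and [K_F_same] cancels the cubic terms and leaves
    the quotients of pivots. *)
Lemma E_F_same (o j : 'I_N) : j = o.+1 :> nat ->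
  p * (E o j * F2 j o - F2 j o * E o j) = q * (K2 j * Ki2 o - Ki o * K j).
Proof.
move=> jo.
have tw (f : gaussfam A N) : tower (gF f) (gK f) (gE f) o j j = gK f j + gF f j o * gK f o * gE f o j.
  have := towerS (gP f) o j j; rewrite -jo (tower_diag (gP f)) /schur.
  rewrite (tower_row (gP f)) (tower_col (gP f)) => ->.
  by nc rules (T, gd_invl (gP f) o).
have := (rtt_tower cp cq (rtt_rp P) (rtt_rpD P) (gP g) (gP h) (rtt_rel P) (ltnW (ltn_ord o))).1 o j j o.
rewrite !(tower_row (gP g)) !(tower_col (gP h)) !tw.
rewrite (gd_E (gP g) (leqnn o)) (gd_F (gP h) (leqnn o)) eqxx mulr1 mul1r.
have hA := K_E_corner P o j; have hB := K_E_corner P' o j; have hC := K_F_same o j.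
have ne : o != j by rewrite -val_eqE /= jo neq_ltn ltnSn.
have c1 := K_K P o o; have c2 := K_K P o j; have c3 := K_K P j o.
have i1 := gd_inv (gP g) o; have i2 := gd_invl (gP g) o.
have i3 := gd_inv (gP h) o; have i4 := gd_invl (gP h) o.
move: hA hB hC c1 c2 c3 i1 i2 i3 i4.
move: (E o j) (E2 o j) (F j o) (F2 j o) (K o) (K2 o) (K j) (K2 j) (Ki o) (Ki2 o).
move=> e e' f f' a a' b b' ai ai' hA hB hC c1 c2 c3 i1 i2 i3 i4 hH.
apply: cancel_p P _ _ _.
apply/eqP; rewrite -subr_eq0; apply/eqP.
transitivity (ai * (p * (p * (a * e * (f' * a') - f' * a' * (a * e))
      - q * ((b' + f' * a' * e') * a - (b + f * a * e) * a'))
  + p * (p * (f' * a - a * f') - q * ((f - f') * a)) * a' * e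
  - p * a * f' * (- p * (a' * e - e * a') - q * (a' * (e' - e)))
  - q * f' * a' * (p * (a * e' - e' * a) - q * (a * (e - e')))
  - q * f * a * (- p * (a' * e - e * a') - q * (a' * (e' - e)))
  + q * (p * (f' * a - a * f') - q * ((f - f') * a)) * a' * (e' - e)) * ai'); last first.
  by rewrite hH hA hB hC !subrr !(mul0r, mulr0) !(addr0, subr0) mulr0 mul0r.
by nc central (T, cp, cq) rules (T, i1, i2, i3, i4, esym c1, esym c2).
Qed.
End Relations3.

(** * The Serre relation *)

Definition separated (D : pzRingType) (hb : D) :=
  forall x : D, (forall n, exists y, x = hb ^+ n * y) -> x = 0.

Section CubicOperator.
Variables (D : pzRingType).
Local Notation T := Logic.I.
Local Notation fn := (int -> int -> int -> int -> D).
Implicit Types (F G : fn) (e : D).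

(* In generating series these multiply F by w - u - e, where w belongs to the first
   index and u to the second, third or fourth one. *)
Definition d1 e F : fn := fun m a b l => F (m + 1) a b l - F m (a + 1) b l - e * F m a b l.
Definition d2 e F : fn := fun m a b l => F (m + 1) a b l - F m a (b + 1) l - e * F m a b l.
Definition d3 e F : fn := fun m a b l => F (m + 1) a b l - F m a b (l + 1) - e * F m a b l.
Definition cubic e1 e2 e3 F := d1 e1 (d2 e2 (d3 e3 F)).

(* The modes of (w - v - e) h(w) z(v) = (w - v + e) z(v) h(w). *)
Definition exchange e (h z : int -> D) := forall m l : int,
  h (m + 1) * z l - h m * z (l + 1) - e * (h m * z l)
  = z l * h (m + 1) - z (l + 1) * h m + e * (z l * h m).

(** One factor of the operator is used each time [h] passes a letter. The three factors commute, so
    the one needed can be brought innermost and applied directly to the word. *)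
Lemma cubic_word e1 e2 e3 (h z1 z2 z3 : int -> D) :
  central e1 -> central e2 -> central e3 ->
  exchange e1 h z1 -> exchange e2 h z2 -> exchange e3 h z3 ->
  cubic e1 e2 e3 (fun m a b l => h m * (z1 a * z2 b * z3 l))
  = cubic (- e1) (- e2) (- e3) (fun m a b l => z1 a * z2 b * z3 l * h m).
Proof.
move=> c1 c2 c3 x1 x2 x3.
have d12 e e' F : central e -> central e' -> d1 e (d2 e' F) = d2 e' (d1 e F).
  move=> c c'; apply/funext => m; apply/funext => a; apply/funext => b; apply/funext => l.
  by rewrite /d1 /d2; nc central (T, c, c').
have d13 e e' F : central e -> central e' -> d1 e (d3 e' F) = d3 e' (d1 e F).
  move=> c c'; apply/funext => m; apply/funext => a; apply/funext => b; apply/funext => l.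
  by rewrite /d1 /d3; nc central (T, c, c').
have d23 e e' F : central e -> central e' -> d2 e (d3 e' F) = d3 e' (d2 e F).
  move=> c c'; apply/funext => m; apply/funext => a; apply/funext => b; apply/funext => l.
  by rewrite /d2 /d3; nc central (T, c, c').
have cN e : central e -> central (- e) by move=> c x; rewrite mulNr mulrN c.
have E1 : d1 e1 (fun m a b l => h m * (z1 a * z2 b * z3 l))
    = d1 (- e1) (fun m a b l => z1 a * h m * z2 b * z3 l).
  apply/funext => m; apply/funext => a; apply/funext => b; apply/funext => l; cbv beta delta [d1].
  by apply: (nc_lin (u := 1) (v := z2 b * z3 l) (x1 m a)); nc central (T, c1).
have E2 : d2 e2 (fun m a b l => z1 a * h m * z2 b * z3 l)
    = d2 (- e2) (fun m a b l => z1 a * z2 b * h m * z3 l).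
  apply/funext => m; apply/funext => a; apply/funext => b; apply/funext => l; cbv beta delta [d2].
  by apply: (nc_lin (u := z1 a) (v := z3 l) (x2 m b)); nc central (T, c2).
have E3 : d3 e3 (fun m a b l => z1 a * z2 b * h m * z3 l)
    = d3 (- e3) (fun m a b l => z1 a * z2 b * z3 l * h m).
  apply/funext => m; apply/funext => a; apply/funext => b; apply/funext => l; cbv beta delta [d3].
  by apply: (nc_lin (u := z1 a * z2 b) (v := 1) (x3 m l)); nc central (T, c3).
have {c1 c2 c3} := (c1, c2, c3, cN _ c1, cN _ c2, cN _ c3) => -[[[[[c1 c2] c3] c1'] c2'] c3'].
by rewrite /cubic d12 // d13 // E1 -d13 // -d12 // d23 // E2 -d23 // E3.
Qed.

End CubicOperator.

Section Serre.
Variables (D : pzRingType) (hb c ci half : D) (h x y : int -> D).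
Hypotheses (chb : central hb) (cc : central c).
Hypotheses (rhb : nonzerodiv hb) (sep : separated hb).
Hypotheses (cK : ci * c = 1) (halfK : half *+ 2 = 1).
Hypothesis hx : forall m l : int, (h (m + 1) * x l - x l * h (m + 1))
  - (h m * x (l + 1) - x (l + 1) * h m) = - (hb * c *+ 2) * (h m * x l + x l * h m).
Hypothesis hy : forall m l : int, (h (m + 1) * y l - y l * h (m + 1))
  - (h m * y (l + 1) - y (l + 1) * h m) = hb * c * (h m * y l + y l * h m).
Hypothesis h0x : forall l, h 0 * x l - x l * h 0 = - (c * x l *+ 4).
Hypothesis h0y : forall l, h 0 * y l - y l * h 0 = c * y l *+ 2.
Local Notation T := Logic.I.

Definition serre (a b l : int) : D :=
  (x a * (x b * y l - y l * x b) - (x b * y l - y l * x b) * x a)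
  + (x b * (x a * y l - y l * x a) - (x a * y l - y l * x a) * x b).
Hypothesis base : forall l, serre 0 0 l = 0.

Local Notation S := serre.
Lemma serreC a b l : S a b l = S b a l.
Proof. by rewrite /serre addrC. Qed.

(** The two-sided ideal generated by the Serre brackets, as an intersection: to use membership one
    instantiates [J], with [hb_serre_ideal] in the separation argument. *)
Definition serre_ideal (z : D) := forall J, ideal2 J -> (forall a b l : int, J (S a b l)) -> J z.
Definition hb_serre_ideal (z : D) := exists2 u, serre_ideal u & z = hb * u.

Lemma serre_ideal2 : ideal2 serre_ideal.
Proof.
split=> [J iJ _|u v Lu Lv J iJ JS|u v Lv J iJ JS|u v Lu J iJ JS].
- exact: ideal2_0.
- by apply: (ideal2B iJ); [exact: Lu|exact: Lv].
- by apply: (ideal2Ml iJ); exact: Lv.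
- by apply: (ideal2Mr iJ); exact: Lu.
Qed.

Lemma hb_serre_ideal2 : ideal2 hb_serre_ideal.
Proof.
have iL := serre_ideal2.
split=> [|_ _ [u Lu ->] [v Lv ->]|u _ [v Lv ->]|_ v [u Lu ->]].
- by exists 0; rewrite ?mulr0 //; exact: (ideal2_0 iL).
- by exists (u - v); rewrite ?mulrBr //; exact: (ideal2B iL).
- by exists (u * v); [exact: (ideal2Ml iL)|rewrite !mulrA chb].
- by exists (u * v); [exact: (ideal2Mr iL)|rewrite !mulrA].
Qed.

Lemma serre_ideal_serre a b l : serre_ideal (S a b l). Proof. by move=> J _; exact. Qed.

Lemma serre_eq0_of_ideal : (forall a b l : int, hb_serre_ideal (S a b l)) -> forall a b l : int, S a b l = 0.
Proof.
move=> SL a b l; apply: sep => n.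
suff [u _ ->] : exists2 u, serre_ideal u & S a b l = hb ^+ n * u by exists u.
elim: n => [|n [u Lu ->]]; first by exists (S a b l); rewrite ?mul1r //; exact: serre_ideal_serre.
have [v Lv ->] := Lu _ hb_serre_ideal2 SL; exists v => //.
by rewrite exprSr !mulrA.
Qed.

Let cN (e : D) : central e -> central (- e).
Proof. by move=> ce z; rewrite mulNr mulrN ce. Qed.
Let ce_y : central (hb * c). Proof. by move=> z; nc central (T, chb, cc). Qed.
Let ce_x : central (- (hb * c *+ 2)). Proof. by move=> z; nc central (T, chb, cc). Qed.
Local Notation ex := (- (hb * c *+ 2)).
Local Notation ey := (hb * c).

(** A Serre bracket is a combination of six words, in each of which [k] passes two letters [x] and
    one letter [y]. The cubic operator attaches its coefficients to the letters, not to their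
    positions, so it is the same for all six words. *)
Lemma cubic_serre (k : int -> D) : exchange ex k x -> exchange ey k y ->
  cubic ex ex ey (fun m a b l => k m * S a b l)
  = cubic (- ex) (- ex) (- ey) (fun m a b l => S a b l * k m).
Proof.
move=> kx ky.
have xxy := cubic_word ce_x ce_x ce_y kx kx ky.
have xyx := cubic_word ce_x ce_y ce_x kx ky kx.
have yxx := cubic_word ce_y ce_x ce_x ky kx kx.
have cx' := cN ce_x; have cy' := cN ce_y.
apply/funext => m; apply/funext => a; apply/funext => b; apply/funext => l.
have at4 (F G : int -> int -> int -> int -> D) m' a' b' l' : F = G -> F m' a' b' l' = G m' a' b' l'.
  by move->.
have := (at4 _ _ m a b l xxy, at4 _ _ m b a l xxy, at4 _ _ m a l b xyx,
         at4 _ _ m b l a xyx, at4 _ _ m l a b yxx, at4 _ _ m l b a yxx).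
rewrite /cubic /d1 /d2 /d3 => -[[[[[E1 E2] E3] E4] E5] E6].
apply/eqP; rewrite -subr_eq0; apply/eqP; rewrite /serre.
move/eqP: E1; rewrite -subr_eq0 => /eqP E1; move/eqP: E2; rewrite -subr_eq0 => /eqP E2.
move/eqP: E3; rewrite -subr_eq0 => /eqP E3; move/eqP: E4; rewrite -subr_eq0 => /eqP E4.
move/eqP: E5; rewrite -subr_eq0 => /eqP E5; move/eqP: E6; rewrite -subr_eq0 => /eqP E6.
have comb (a1 a2 a3 a4 a5 a6 z : D) : a1 = 0 -> a2 = 0 -> a3 = 0 -> a4 = 0 -> a5 = 0 ->
    a6 = 0 -> z = a1 + a2 + (a5 + a6) + (- a3 - a3 + (- a4 - a4)) -> z = 0.
  by move=> -> -> -> -> -> -> ->; rewrite !(oppr0, addr0).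
(* The words have coefficient 1 when [y] is at an end and -2 when it is in the middle. *)
apply: (comb _ _ _ _ _ _ _ E1 E2 E3 E4 E5 E6).
move: (ce_x) (ce_y); move: (ex) (ey) => f e cf ce.
by nc central (T, cf, ce).
Qed.

Lemma hb_serre_idealM e u : serre_ideal u -> hb_serre_ideal (hb * e * u).
Proof. by move=> Lu; exists (e * u); [exact: (ideal2Ml serre_ideal2)|rewrite mulrA]. Qed.

(** Telescoping over the three factors: each difference of operators contributes hbar times an
    element of the ideal, to which the remaining shifts are applied. *)
Lemma cubic_mod k1 k2 k3 (F : int -> int -> int -> int -> D) m a b l :
  (forall m a b l : int, serre_ideal (F m a b l)) ->
  hb_serre_ideal (cubic (hb * k1) (hb * k2) (hb * k3) F m a b l - cubic 0 0 0 F m a b l).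
Proof.
have iL := serre_ideal2; have ih := hb_serre_ideal2.
have Ld (J : D -> Prop) (iJ : ideal2 J) e G : (forall m a b l : int, J (G m a b l)) ->
    [/\ forall m a b l : int, J (d1 e G m a b l), forall m a b l : int, J (d2 e G m a b l)
      & forall m a b l : int, J (d3 e G m a b l)].
  by move=> JG; split=> *; apply: (ideal2B iJ);
    first [by apply: (ideal2B iJ)|by apply: (ideal2Ml iJ)].
move=> LF; have [_ _ L3] := Ld _ iL (hb * k3) _ LF; have [_ L2 _] := Ld _ iL (hb * k2) _ L3.
have M1 := fun m a b l => hb_serre_idealM k1 (L2 m a b l).
have M2 := fun m a b l => hb_serre_idealM k2 (L3 m a b l).
have M3 := fun m a b l => hb_serre_idealM k3 (LF m a b l).
have [M2' _ _] := Ld _ ih 0 _ M2.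
have [_ M3' _] := Ld _ ih 0 _ M3; have [{}M3' _ _] := Ld _ ih 0 _ M3'.
have := ideal2N ih (ideal2D ih (M1 m a b l) (ideal2D ih (M2' m a b l) (M3' m a b l))).
congr hb_serre_ideal; rewrite /cubic /d1 /d2 /d3; move: (hb * k1) (hb * k2) (hb * k3) => e1 e2 e3.
by nc.
Qed.

(** The subtracted term is what a derivation would give that sends [x a] to [-4 c x (a + m)] and
    [y l] to [2 c y (l + m)], the weights being those of [h 0]. *)
Definition dev (m a b l : int) := h m * S a b l - S a b l * h m
  - c * (S a b (l + m) - S (a + m) b l *+ 2 - S a (b + m) l *+ 2) *+ 2.

Let idx1 (a m : int) : a + (m + 1) = a + m + 1. Proof. by rewrite addrA. Qed.
Let idx2 (a m : int) : a + 1 + m = a + m + 1. Proof. by rewrite addrAC. Qed.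

Lemma exchange_hx : exchange ex h x.
Proof.
by move=> m l; apply: (nc_lin (u := 1) (v := 1) (hx m l)); nc central (T, chb, cc).
Qed.
Lemma exchange_hy : exchange ey h y.
Proof.
by move=> m l; apply: (nc_lin (u := 1) (v := 1) (hy m l)); nc central (T, chb, cc).
Qed.

(** The commutator part is handled by [cubic_serre] modulo hbar. The subtracted terms are
    annihilated: [S a b (l + m)] depends on [m] and [l] through their sum, so [d3 0] kills it, and
    [d1 0], [d2 0] kill the two others in the same way. *)
Lemma cubic_dev m a b l : hb_serre_ideal (cubic 0 0 0 dev m a b l).
Proof.
have ih := hb_serre_ideal2; have iL := serre_ideal2.
have E := congr1 (fun F => F m a b l) (cubic_serre exchange_hx exchange_hy).
have LhS m' a' b' l' : serre_ideal (h m' * S a' b' l') by apply: (ideal2Ml iL); exact: serre_ideal_serre.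
have LSh m' a' b' l' : serre_ideal (S a' b' l' * h m') by apply: (ideal2Mr iL); exact: serre_ideal_serre.
have H1 := cubic_mod (- (c *+ 2)) (- (c *+ 2)) c m a b l LhS.
have H2 := cubic_mod (c *+ 2) (c *+ 2) (- c) m a b l LSh.
have := ideal2B ih H2 H1.
have -> : hb * - (c *+ 2) = ex by nc.
have -> : hb * (c *+ 2) = - ex by nc.
have -> : hb * - c = - ey by nc.
have gen (z u v : D) : z - v - (z - u) = u - v by nc.
move: E => /= ->; congr hb_serre_ideal; rewrite gen /cubic /d1 /d2 /d3 /dev.
by rewrite ?idx1 ?idx2 ?idx1 ?idx2; nc central (T, cc).
Qed.

Definition dev0 (m : int) := forall a b l : int, hb_serre_ideal (dev m a b l).

(** [cubic_dev] is a recurrence of order three in [m] whose extreme coefficients are 1 and -1; three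
    consecutive values give the next one, and also the previous one. *)
Lemma dev_up (m : int) : dev0 m -> dev0 (m + 1) -> dev0 (m + 1 + 1) -> dev0 (m + 1 + 1 + 1).
Proof.
move=> h0 h1 h2 a b l; have := cubic_dev m a b l; have ih := hb_serre_ideal2.
rewrite /cubic /d1 /d2 /d3 => hE.
have := ideal2D ih (ideal2B ih (ideal2B ih hE (h1 (a + 1) (b + 1) l)) (h1 (a + 1) b (l + 1)))
  (ideal2B ih (ideal2D ih (h2 (a + 1) b l) (ideal2D ih (h2 a (b + 1) l) (h2 a b (l + 1))))
   (ideal2B ih (h1 a (b + 1) (l + 1)) (h0 (a + 1) (b + 1) (l + 1)))).
by congr hb_serre_ideal; nc.
Qed.

Lemma dev_down (m : int) : dev0 (m + 1) -> dev0 (m + 1 + 1) -> dev0 (m + 1 + 1 + 1) -> dev0 m.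
Proof.
move=> h1 h2 h3 a' b' l'.
suff H (a b l : int) : hb_serre_ideal (dev m (a + 1) (b + 1) (l + 1)).
  by have := H (a' - 1) (b' - 1) (l' - 1); rewrite !subrK.
have := cubic_dev m a b l; have ih := hb_serre_ideal2.
rewrite /cubic /d1 /d2 /d3 => hE.
have := ideal2N ih (ideal2B ih (ideal2B ih (ideal2B ih hE (h1 (a + 1) (b + 1) l)) (h1 (a + 1) b (l + 1)))
  (ideal2B ih (ideal2B ih (h3 a b l) (ideal2D ih (h2 (a + 1) b l) (ideal2D ih (h2 a (b + 1) l) (h2 a b (l + 1)))))
   (ideal2N ih (h1 a (b + 1) (l + 1))))).
by congr hb_serre_ideal; nc.
Qed.

Lemma ad_serre u dx dy dx' a b l :
  u * x a - x a * u = dx -> u * x b - x b * u = dx' -> u * y l - y l * u = dy ->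
  u * S a b l - S a b l * u =
  (dx * (x b * y l - y l * x b) - (x b * y l - y l * x b) * dx
    + (x b * (dx * y l - y l * dx) - (dx * y l - y l * dx) * x b))
  + (x a * (dx' * y l - y l * dx') - (dx' * y l - y l * dx') * x a
    + (dx' * (x a * y l - y l * x a) - (x a * y l - y l * x a) * dx'))
  + (x a * (x b * dy - dy * x b) - (x b * dy - dy * x b) * x a
    + (x b * (x a * dy - dy * x a) - (x a * dy - dy * x a) * x b)).
Proof. by move=> <- <- <-; rewrite /serre; nc. Qed.

Lemma dev_0 : dev0 0.
Proof.
move=> a b l; rewrite /dev !addr0 (ad_serre (h0x a) (h0x b) (h0y l)).
rewrite (_ : _ - _ = 0); first exact: (ideal2_0 hb_serre_ideal2).
by rewrite /serre; nc central (T, cc).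
Qed.

Lemma hb_serre_ideal_half z : hb_serre_ideal (z *+ 2) -> hb_serre_ideal z.
Proof.
move=> hz; have := ideal2Ml hb_serre_ideal2 half hz; congr hb_serre_ideal.
by rewrite mulrnAr -mulrnAl halfK mul1r.
Qed.

Lemma dev_1 : dev0 1.
Proof.
move=> a b l; apply: hb_serre_ideal_half.
(* The correction by hbar h_0^2 absorbs the anticommutator on the right of [hx] and [hy], so that
   this element acts on the letters exactly as a derivation raising the index by 1. It is taken
   twice to avoid a fraction; its quadratic part brackets [S] into hbar times the ideal. *)
have h1x j : (h 1 *+ 2 - hb * h 0 * h 0) * x j - x j * (h 1 *+ 2 - hb * h 0 * h 0)
    = - (c * x (j + 1) *+ 8).
  have := hx 0 j; rewrite add0r => E1; have E2 := h0x j; have E3 := h0x (j + 1).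
  apply: (nc_lin (u := 1) (v := 1) (l := 0) (r := 0)) => //; rewrite subrr !mulr0 mul0r.
  transitivity (((h 1 * x j - x j * h 1) - (h 0 * x (j + 1) - x (j + 1) * h 0)
      - (- (hb * c *+ 2) * (h 0 * x j + x j * h 0))) *+ 2
    + (h 0 * x (j + 1) - x (j + 1) * h 0 - - (c * x (j + 1) *+ 4)) *+ 2
    - hb * h 0 * (h 0 * x j - x j * h 0 - - (c * x j *+ 4))
    - hb * (h 0 * x j - x j * h 0 - - (c * x j *+ 4)) * h 0); last first.
    by rewrite E1 E2 E3 !subrr !(mul0rn, mulr0, mul0r) !(addr0, subr0).
  by nc central (T, chb, cc).
have h1y j : (h 1 *+ 2 - hb * h 0 * h 0) * y j - y j * (h 1 *+ 2 - hb * h 0 * h 0)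
    = c * y (j + 1) *+ 4.
  have := hy 0 j; rewrite add0r => E1; have E2 := h0y j; have E3 := h0y (j + 1).
  apply: (nc_lin (u := 1) (v := 1) (l := 0) (r := 0)) => //; rewrite subrr !mulr0 mul0r.
  transitivity (((h 1 * y j - y j * h 1) - (h 0 * y (j + 1) - y (j + 1) * h 0)
      - (hb * c * (h 0 * y j + y j * h 0))) *+ 2
    + (h 0 * y (j + 1) - y (j + 1) * h 0 - c * y (j + 1) *+ 2) *+ 2
    - hb * h 0 * (h 0 * y j - y j * h 0 - c * y j *+ 2)
    - hb * (h 0 * y j - y j * h 0 - c * y j *+ 2) * h 0); last first.
    by rewrite E1 E2 E3 !subrr !(mul0rn, mulr0, mul0r) !(addr0, subr0).
  by nc central (T, chb, cc).
have E := ad_serre (h1x a) (h1x b) (h1y l).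
have iL := serre_ideal2.
have LS := serre_ideal_serre a b l.
have := ideal2B hb_serre_ideal2 (hb_serre_idealM (h 0 * h 0) LS)
  (hb_serre_idealM 1 (ideal2Mr iL (h 0 * h 0) LS)).
congr hb_serre_ideal; apply/eqP; rewrite -subr_eq0; apply/eqP.
move/eqP: E; rewrite -subr_eq0 => /eqP E; rewrite -[RHS]oppr0 -[in RHS]E.
by rewrite /dev /serre; nc central (T, chb, cc).
Qed.

(** The modes of H^-(w) = 1 - hbar \sum_(k < 0) h_k w^(-k-1). As they vanish for nonnegative
    indices, the cubic relation at index -1 involves only [h (-1)], which provides the third initial
    value of the recurrence. *)
Definition hminus (m : int) : D := (m == -1)%:R - (hb * h m) *+ (m <= -1)%R.

Lemma exchange_minus (e : D) (z : int -> D) : exchange e h z -> central e ->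
  (forall l, hb * h 0 * z l - z l * (hb * h 0) = e * z l *+ 2) -> exchange e hminus z.
Proof.
move=> hz ce hz0 m l; rewrite /hminus; have Ez := hz m l.
have [m0|[m0|->]] : (m < -1)%R \/ (-1 < m)%R \/ m = -1 by lia.
- have -> : (m + 1 <= -1) = true by lia.
  have -> : (m <= -1) = true by lia.
  have -> : (m == -1) = false by lia.
  by apply: (nc_lin (u := - hb) (v := 1) Ez);
    case: eqP => _; rewrite ?(mulr1n, mulr0n); nc central (T, chb, ce).
- have -> : (m + 1 <= -1) = false by lia.
  have -> : (m <= -1) = false by lia.
  have -> : (m + 1 == -1) = false by lia.
  have -> : (m == -1) = false by lia.
  by rewrite ?(mulr1n, mulr0n); nc.
(* At the boundary hbar h_0 is missing from the left-hand index; its bracket with [z l] is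
   [2 e z l], exactly what the constant term 1 at index -1 produces. *)
- rewrite (_ : (-1 + 1 <= -1 :> int) = false) // (_ : (-1 + 1 == -1 :> int) = false) //.
  rewrite ?(mulr1n, mulr0n); move: (hz (-1) l) (hz0 l); rewrite addNr => E E0.
  apply: (nc_lin (u := 1) (v := 1) (l := 0) (r := 0)) => //; rewrite subrr !mulr0 mul0r.
  transitivity (- hb * (h 0 * z l - h (-1) * z (l + 1) - e * (h (-1) * z l)
      - (z l * h 0 - z (l + 1) * h (-1) + e * (z l * h (-1))))
    + (hb * h 0 * z l - z l * (hb * h 0) - e * z l *+ 2)).
    by nc central (T, chb, ce).
  by rewrite E E0 !subrr mulr0 addr0.
Qed.

Lemma dev_m1 : dev0 (-1).
Proof.
move=> a' b' l'.
suff H (a b l : int) : hb_serre_ideal (dev (-1) (a + 1) (b + 1) (l + 1)).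
  by have := H (a' - 1) (b' - 1) (l' - 1); rewrite !subrK.
have kx : exchange ex hminus x.
  apply: exchange_minus exchange_hx ce_x _ => j.
  transitivity (hb * (h 0 * x j - x j * h 0)); first by nc central (T, chb).
  by rewrite h0x; nc central (T, chb).
have ky : exchange ey hminus y.
  apply: exchange_minus exchange_hy ce_y _ => j.
  transitivity (hb * (h 0 * y j - y j * h 0)); first by nc central (T, chb).
  by rewrite h0y; nc central (T, chb).
have := congr1 (fun F => F (-1) a b l) (cubic_serre kx ky).
rewrite /cubic /d1 /d2 /d3.
have -> : hminus (-1) = 1 - hb * h (-1) by [].
have k0 (n : nat) : hminus n = 0 by rewrite /hminus /= subr0.
rewrite (k0 0) (k0 1) (k0 2).
move=> E.
rewrite /dev !addrK.
pose u := h (-1).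
(* Only index -1 survives, so the relation compares the product of the three shifts plus [ex], [ex],
   [ey], applied to [S], with the same product for opposite signs. The terms hbar V, hbar^2 W and
   hbar^3 Z are the parts of degree 1, 2, 3 of this product; [V *+ 2] is the expected value of the
   bracket with [u]. *)
pose V : D := - (c *+ 2) * (S a (b + 1) (l + 1) + S (a + 1) b (l + 1)) + c * S (a + 1) (b + 1) l.
pose W : D := c * c * (S a b (l + 1) *+ 4 - S a (b + 1) l *+ 2 - S (a + 1) b l *+ 2).
pose Z : D := c * c * c * S a b l *+ 4.
have E' : hb * (u * S (a + 1) (b + 1) (l + 1) - S (a + 1) (b + 1) (l + 1) * u - V *+ 2)
  = hb * (hb * (- (V * u) - u * V) + hb * hb * (W * u - u * W + Z *+ 2)
          - hb * hb * hb * (Z * u + u * Z)).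
  move/eqP: E; rewrite -subr_eq0 => /eqP E; apply/eqP; rewrite -subr_eq0; apply/eqP.
  rewrite -[RHS]E /V /W /Z /u.
  by nc central (T, chb, cc).
have {E'} : u * S (a + 1) (b + 1) (l + 1) - S (a + 1) (b + 1) (l + 1) * u - V *+ 2 =
   hb * (- (V * u) - u * V) + hb * hb * (W * u - u * W + Z *+ 2)
          - hb * hb * hb * (Z * u + u * Z).
  apply/eqP; rewrite -subr_eq0; apply/eqP/rhb; rewrite mulrBr E' subrr //.
have -> : u * S (a + 1) (b + 1) (l + 1) - S (a + 1) (b + 1) (l + 1) * u - V *+ 2
  = u * S (a + 1) (b + 1) (l + 1) - S (a + 1) (b + 1) (l + 1) * u -
   c * (S (a + 1) (b + 1) l - S a (b + 1) (l + 1) *+ 2 - S (a + 1) b (l + 1) *+ 2) *+ 2.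
  by rewrite /V; nc.
move->.
have iL := serre_ideal2; have LS := serre_ideal_serre; have lB := ideal2B iL; have lD := ideal2D iL.
have lM := ideal2Ml iL; have lMr := ideal2Mr iL.
have lN (z : D) (n : nat) : serre_ideal z -> serre_ideal (z *+ n) by move=> Lz; rewrite -mulr_natl; apply: (lM).
have LV : serre_ideal V by rewrite /V; apply: (lD); apply: (lM) => //; exact: (lD).
have LW : serre_ideal W by rewrite /W; apply: (lM); apply: (lB); [apply: (lB)|]; exact: (lN).
have LZ : serre_ideal Z by rewrite /Z; apply: (lN); exact: (lM).
exists (- (V * u) - u * V + hb * (W * u - u * W + Z *+ 2) - hb * hb * (Z * u + u * Z)).
  apply: (lB); first apply: (lD); first by apply: (lB); [apply: (ideal2N iL); apply: (lMr)|apply: (lM)].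
    apply: (lM); apply: (lD); last exact: (lN).
    by apply: (lB); [apply: (lMr)|apply: (lM)].
  by apply: (lM); apply: (lD); [apply: (lMr)|apply: (lM)].
by nc central (T, chb).
Qed.

Lemma dev_all m : dev0 m.
Proof.
have up (n : nat) : [/\ dev0 (n%:Z - 1), dev0 n & dev0 (n%:Z + 1)].
  elim: n => [|n [IH1 IH2 IH3]]; first by split; [exact: dev_m1|exact: dev_0|exact: dev_1].
  have e1 : n%:Z - 1 + 1 = n by lia.
  have := @dev_up (n%:Z - 1); rewrite e1 => /(_ IH1 IH2 IH3) IH4.
  have -> : n.+1%:Z = n%:Z + 1 by lia.
  by split; rewrite ?addrK.
have down (n : nat) : [/\ dev0 (- n%:Z - 1), dev0 (- n%:Z) & dev0 (- n%:Z + 1)].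
  elim: n => [|n [IH1 IH2 IH3]]; first by split; [exact: dev_m1|exact: dev_0|exact: dev_1].
  have -> : - n.+1%:Z = - n%:Z - 1 by lia.
  have e1 : - n%:Z - 1 - 1 + 1 = - n%:Z - 1 by lia.
  have e2 : - n%:Z - 1 + 1 = - n%:Z by lia.
  have := @dev_down (- n%:Z - 1 - 1); rewrite e1 e2 => /(_ IH1 IH2 IH3) IH4.
  by split; rewrite ?e2.
by case: m => n; [have [] := up n|rewrite NegzE; have [] := down n.+1].
Qed.

Lemma serre_eq0 a b l : S a b l = 0.
Proof.
move: a b l; apply: serre_eq0_of_ideal.
have ih := hb_serre_ideal2.
have cancel2c z : hb_serre_ideal (c * z *+ 2) -> hb_serre_ideal z.
  by move=> /hb_serre_ideal_half hz; have := ideal2Ml ih ci hz; congr hb_serre_ideal; rewrite mulrA cK mul1r.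
have S0 (m l : int) : hb_serre_ideal (S m 0 l).
  have := dev_all m 0 0 l; rewrite /dev !add0r !base mulr0 mul0r [S 0 m l]serreC => hz.
  apply/hb_serre_ideal_half/hb_serre_ideal_half/cancel2c; have := hz; congr hb_serre_ideal.
  by nc.
move=> m n l; have := dev_all m n 0 l; rewrite /dev add0r => hz.
apply/hb_serre_ideal_half/cancel2c.
have h1 : hb_serre_ideal (h m * S n 0 l) := ideal2Ml ih _ (S0 _ _).
have h2 : hb_serre_ideal (S n 0 l * h m) := ideal2Mr ih _ (S0 _ _).
have h3 : hb_serre_ideal (c * (S n 0 (l + m) - S (n + m) 0 l *+ 2) *+ 2).
  have := ideal2Ml ih (c *+ 2) (ideal2B ih (S0 n (l + m)) (ideal2D ih (S0 (n + m) l) (S0 (n + m) l))).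
  by congr hb_serre_ideal; nc.
have := ideal2D ih (ideal2B ih hz (ideal2B ih h1 h2)) h3; congr hb_serre_ideal.
by rewrite (serreC m n); nc.
Qed.
End Serre.

(** * Modes of series in one and two variables *)

Lemma centralM (R : pzRingType) (a b : R) : central a -> central b -> central (a * b).
Proof. by move=> ca cb x; rewrite -mulrA cb !mulrA ca. Qed.
Lemma centralB (R : pzRingType) (a b : R) : central a -> central b -> central (a - b).
Proof. by move=> ca cb x; rewrite mulrBl mulrBr ca cb. Qed.

Section FpsTheory.
Variable R : pzRingType.
Implicit Types f g : fps R.

Lemma fcoefD f g n : (f + g)``_n = f``_n + g``_n. Proof. by []. Qed.
Lemma fcoefB f g n : (f - g)``_n = f``_n - g``_n. Proof. by []. Qed.
Lemma fcoef0 n : (0 : fps R)``_n = 0. Proof. by case: n. Qed.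
Lemma fcoef1 n : (1 : fps R)``_n = (n == 0)%:R. Proof. by case: n. Qed.
Lemma fcoefM f g n : (f * g)``_n = \sum_(i < n.+1) f``_i * g``_(n - i).
Proof. by []. Qed.

Lemma fcoefCM (a : R) f n : (fpsC a * f)``_n = a * f``_n.
Proof.
rewrite fcoefM big_ord_recl subn0 big1 ?addr0 // => i _.
by rewrite mul0r.
Qed.
Lemma fcoefMC (a : R) f n : (f * fpsC a)``_n = f``_n * a.
Proof.
have -> : (f * fpsC a)``_n = (fps_mul f (fpsC a))``_n by [].
rewrite fps_mul_rev big_ord_recl subn0 big1 ?addr0 // => i _.
by rewrite mulr0.
Qed.

Lemma fcoefXM f n : (fpsX * f)``_n = if n is m.+1 then f``_m else 0.
Proof.
case: n => [|n]; first by rewrite fcoefM big_ord_recl big_ord0 mul0r addr0.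
rewrite fcoefM big_ord_recl big_ord_recl big1 ?addr0; last first.
  by move=> i _; rewrite mul0r.
by rewrite mul0r add0r mul1r /= subn1.
Qed.
Lemma fcoefMX f n : (f * fpsX)``_n = if n is m.+1 then f``_m else 0.
Proof.
have -> : (f * fpsX)``_n = (fps_mul f fpsX)``_n by [].
rewrite fps_mul_rev; case: n => [|n].
  by rewrite big_ord_recl big_ord0 mulr0 addr0.
rewrite big_ord_recl big_ord_recl big1 ?addr0; last first.
  by move=> i _; rewrite mulr0.
by rewrite mulr0 add0r mulr1 /= subn1.
Qed.
Lemma central_fpsX : central (fpsX : fps R).
Proof. by move=> f; apply: fpsP => n; rewrite fcoefXM fcoefMX. Qed.
Lemma central_fpsC (a : R) : central a -> central (fpsC a).
Proof. by move=> ca f; apply: fpsP => n; rewrite fcoefCM fcoefMC ca. Qed.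

Fact fpsC_zmod : zmod_morphism (@fpsC R).
Proof. by move=> a b; apply: fpsP => -[|n] /=; rewrite ?subrr ?subr0. Qed.
Fact fpsC_monoid : monoid_morphism (@fpsC R).
Proof.
by split=> // a b; apply: fpsP => n; rewrite fcoefCM; case: n => //= n; rewrite mulr0.
Qed.
HB.instance Definition _ := GRing.isZmodMorphism.Build R (fps R) (@fpsC R) fpsC_zmod.
HB.instance Definition _ := GRing.isMonoidMorphism.Build R (fps R) (@fpsC R) fpsC_monoid.
End FpsTheory.

Section FpsMap.
Variables (R S : pzRingType) (phi : {rmorphism R -> S}).
Fact fps_map_zmod : zmod_morphism (fps_map phi).
Proof. by move=> f g; apply: fpsP => n /=; rewrite raddfB. Qed.
Fact fps_map_monoid : monoid_morphism (fps_map phi).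
Proof.
split; first by apply: fpsP => -[|n] /=; rewrite ?rmorph1 ?rmorph0.
move=> f g; apply: fpsP => n /=; rewrite rmorph_sum.
by apply: eq_bigr => i _; rewrite rmorphM.
Qed.
HB.instance Definition _ := GRing.isZmodMorphism.Build (fps R) (fps S) (fps_map phi) fps_map_zmod.
HB.instance Definition _ := GRing.isMonoidMorphism.Build (fps R) (fps S) (fps_map phi) fps_map_monoid.

Lemma fps_mapC a : fps_map phi (fpsC a) = fpsC (phi a).
Proof. by apply: fpsP => -[|n] /=; rewrite ?rmorph0. Qed.
Lemma fps_mapX : fps_map phi fpsX = fpsX.
Proof. by apply: fpsP => n /=; rewrite rmorph_nat. Qed.
End FpsMap.

Section Modes.
Variable R : pzRingType.
Implicit Types (f g : fps R) (s : bool) (k : int).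

(** The function [fourier] over an arbitrary ring, so that it can be applied to the outer variable
    of a series in two variables. *)
Definition mode s f k : R :=
  if (if s then 0 <= k + 1 else k + 1 <= 0) then f``_(absz (k + 1)) else 0.

(* u = unum s / uden s, since the variable of a series of sign + is u^-1. *)
Definition unum s : fps R := if s then 1 else fpsX.
Definition uden s : fps R := if s then fpsX else 1.

Lemma modeP s f g : (forall k, mode s f k = mode s g k) -> f = g.
Proof.
move=> e; apply: fpsP => n; move: (e (if s then n%:Z - 1 else - n%:Z - 1)).
rewrite /mode; clear e; case: s.
  by rewrite (_ : n%:Z - 1 + 1 = n); [|lia].
rewrite (_ : - n%:Z - 1 + 1 = - n%:Z) ?abszN; last by lia.
by rewrite (_ : (- n%:Z <= 0) = true); last by lia.
Qed.

Lemma modeB s f g k : mode s (f - g) k = mode s f k - mode s g k.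
Proof. by rewrite /mode; case: ifP => // _; rewrite subr0. Qed.
Lemma modeD s f g k : mode s (f + g) k = mode s f k + mode s g k.
Proof. by rewrite /mode; case: ifP => // _; rewrite addr0. Qed.
Lemma modeN s f k : mode s (- f) k = - mode s f k.
Proof. by rewrite /mode; case: ifP => // _; rewrite oppr0. Qed.
Lemma mode0 s k : mode s (0 : fps R) k = 0.
Proof. by rewrite /mode; case: ifP => // _; rewrite fcoef0. Qed.
Lemma modeCM s a f k : mode s (fpsC a * f) k = a * mode s f k.
Proof. by rewrite /mode; case: ifP => // _; rewrite ?fcoefCM ?mulr0. Qed.
Lemma modeMC s a f k : mode s (f * fpsC a) k = mode s f k * a.
Proof. by rewrite /mode; case: ifP => // _; rewrite ?fcoefMC ?mul0r. Qed.
Lemma mode1 s k : mode s (1 : fps R) k = (k == -1)%:R.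
Proof.
rewrite /mode fcoef1 absz_eq0 addr_eq0.
by case: eqP => [->|kn]; case: s; rewrite ?addNr ?lexx //=; case: ifP.
Qed.

Lemma mode_lt f (k : int) : k < -1 -> mode true f k = 0.
Proof. by move=> k1; rewrite /mode; case: ifP => // k2; lia. Qed.
Lemma mode_ge0 f (k : int) : 0 <= k -> mode false f k = 0.
Proof. by move=> k1; rewrite /mode; case: ifP => // k2; lia. Qed.

Lemma mode_unum s f k : mode s (unum s * f) (k + s) = mode s f (k + 1).
Proof.
case: s; rewrite /unum; first by rewrite mul1r.
rewrite addr0 /mode fcoefXM; have [k0|k0] : (k + 1 < 0) \/ (0 <= k + 1) by lia.
  have -> : k + 1 <= 0 by lia.
  have -> : k + 1 + 1 <= 0 by lia.
  case E: absz => [|n]; first by lia.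
  by congr (fpscoef f _); lia.
have -> : (k + 1 + 1 <= 0) = false by lia.
by case: ifP => // k1; rewrite (_ : absz (k + 1) = 0%N) //; lia.
Qed.

Lemma mode_uden s f k : mode s (uden s * f) (k + s) = mode s f k.
Proof.
case: s; rewrite /uden; last by rewrite addr0 mul1r.
rewrite /mode fcoefXM; have [k0|k0] : (0 <= k + 1) \/ (k + 1 < 0) by lia.
  have -> : 0 <= k + true%:Z + 1 by lia.
  have -> : 0 <= k + 1 by lia.
  case E: absz => [|n]; first by lia.
  by congr (fpscoef f _); lia.
have -> : (0 <= k + 1) = false by lia.
by case: ifP => // k1; rewrite (_ : absz (k + true%:Z + 1) = 0%N) //; lia.
Qed.

Lemma central_unum s : central (unum s).
Proof. by case: s => [f|]; [rewrite mul1r mulr1|exact: central_fpsX]. Qed.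
Lemma central_uden s : central (uden s).
Proof. by case: s => [|f]; [exact: central_fpsX|rewrite mul1r mulr1]. Qed.
End Modes.

Section TwoVariables.
Variables (D : pzRingType).
Local Notation A := (fps (fps D)).
Implicit Types (s t : bool) (k l : int) (Z : A) (f g : fps D).

Definition fst_var : fps D -> A := fps_map (@fpsC D).
Definition snd_var : fps D -> A := @fpsC (fps D).
HB.instance Definition _ := GRing.RMorphism.on fst_var.
HB.instance Definition _ := GRing.RMorphism.on snd_var.

Definition mode2 s t Z (k l : int) : D := mode t (mode s Z k) l.

Lemma mode2P s t Z Z' : (forall k l, mode2 s t Z k l = mode2 s t Z' k l) -> Z = Z'.
Proof. by move=> e; apply: (modeP (s := s)) => k; apply: (modeP (s := t)) => l; exact: e. Qed.
Lemma mode2B s t Z Z' k l : mode2 s t (Z - Z') k l = mode2 s t Z k l - mode2 s t Z' k l.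
Proof. by rewrite /mode2 !modeB. Qed.
Lemma mode2D s t Z Z' k l : mode2 s t (Z + Z') k l = mode2 s t Z k l + mode2 s t Z' k l.
Proof. by rewrite /mode2 !modeD. Qed.
Lemma mode2C s t a Z k l : mode2 s t (fpsC (fpsC a) * Z) k l = a * mode2 s t Z k l.
Proof. by rewrite /mode2 !modeCM. Qed.

Lemma mode_fst_var s f k : mode s (fst_var f) k = fpsC (mode s f k).
Proof. by rewrite /mode; case: ifP => // _; rewrite rmorph0. Qed.
Lemma mode2_fs s t f g k l :
  mode2 s t (fst_var f * snd_var g) k l = mode s f k * mode t g l.
Proof. by rewrite /mode2 modeMC mode_fst_var modeCM. Qed.
Lemma mode2_sf s t f g k l :
  mode2 s t (snd_var g * fst_var f) k l = mode t g l * mode s f k.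
Proof. by rewrite /mode2 modeCM mode_fst_var modeMC. Qed.

(** Clearing denominators, u - v is [pdiff s t] divided by [wden s t]; thus [pdiff] and hbar [wden]
    are the homogenized u - v and hbar. *)
Definition pdiff s t : A := unum _ s * snd_var (uden _ t) - uden _ s * snd_var (unum _ t).
Definition wden s t : A := uden _ s * snd_var (uden _ t).

Lemma mode2_wden s t Z (k l : int) : mode2 s t (wden s t * Z) (k + s) (l + t) = mode2 s t Z k l.
Proof. by rewrite /mode2 /wden -mulrA mode_uden modeCM mode_uden. Qed.
Lemma mode2_pdiff s t Z (k l : int) :
  mode2 s t (pdiff s t * Z) (k + s) (l + t)
  = mode2 s t Z (k + 1) l - mode2 s t Z k (l + 1).
Proof.
rewrite /mode2 /pdiff mulrBl modeB -!mulrA mode_unum mode_uden.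
by rewrite !modeCM modeB mode_uden mode_unum.
Qed.

Lemma central_snd_var f : central f -> central (snd_var f).
Proof. exact: central_fpsC. Qed.
Lemma central_pdiff s t : central (pdiff s t).
Proof.
apply: centralB; apply: centralM;
  by [exact: central_unum|exact: central_uden|apply: central_snd_var; exact: central_uden
     |apply: central_snd_var; exact: central_unum].
Qed.
Lemma central_wden s t : central (wden s t).
Proof.
by apply: centralM; [exact: central_uden|apply: central_snd_var; exact: central_uden].
Qed.

(** Multiplication by [wden] translates the modes and [pdiff] takes their difference along the
    antidiagonal, by the same translation; this passes between identities of series and recurrences
    of modes. *)
Lemma pdiff_wdenP s t Z Z' (a : D) :
  pdiff s t * Z = fpsC (fpsC a) * wden s t * Z' <->
  forall k l : int, mode2 s t Z (k + 1) l - mode2 s t Z k (l + 1) = a * mode2 s t Z' k l.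
Proof.
split=> [e k l|e]; first by rewrite -mode2_pdiff e -mulrA mode2C mode2_wden.
apply: (mode2P (s := s) (t := t)) => k l.
rewrite -[k](subrK s%:Z) -[l](subrK t%:Z).
by rewrite -mulrA mode2_pdiff mode2C mode2_wden e.
Qed.

(** A series killed by u - v + a satisfies a recurrence on its modes. For sign + in the first
    variable, the modes vanish below -1 and the recurrence goes up. For sign - one goes down from 0,
    where it reduces to w_(l+1) = a w_l in the second variable; if that sign is + one goes up again,
    and if it is - one goes down, which requires cancelling [a], or [a = 0]. *)
Lemma nonzerodiv_pdiff s t (a : D) : a = 0 \/ nonzerodiv a ->
  nonzerodiv (pdiff s t + fpsC (fpsC a) * wden s t).
Proof.
move=> ha Z Z0; apply: (mode2P (s := s) (t := t)).
have rec (k l : int) : mode2 s t Z (k + 1) l - mode2 s t Z k (l + 1) + a * mode2 s t Z k l = 0.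
  rewrite -mode2_pdiff -[X in a * X]mode2_wden -mode2C mulrA -mode2D -mulrDl Z0.
  by rewrite /mode2 !mode0.
move=> k l; rewrite [RHS]/mode2 !mode0.
case: s Z0 rec => _ rec.
  have sup (n : nat) : forall j, mode2 true t Z (n%:Z - 2) j = 0.
    elim: n => [|n IH] j; first by rewrite /mode2 mode_lt ?mode0.
    have := rec (n%:Z - 2) j; rewrite !IH mulr0 addr0 subr0.
    by rewrite (_ : n%:Z - 2 + 1 = n.+1%:Z - 2) //; lia.
  have [k0|k0] : (k < -1) \/ (-1 <= k) by lia.
    by rewrite /mode2 mode_lt // mode0.
  by have := sup (absz (k + 2)) l; rewrite (_ : _ - 2 = k) //; lia.
suff down (n : nat) : forall j, mode2 false t Z (- n%:Z) j = 0.
  have [k0|k0] : (0 <= k) \/ (k <= 0) by lia.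
    by rewrite /mode2 mode_ge0 // mode0.
  by have := down (absz k) l; rewrite (_ : - _ = k) //; lia.
elim: n => [|n IH] j.
  by rewrite /mode2 mode_ge0 // mode0.
have {}IH j' : mode2 false t Z (- n.+1%:Z + 1) j' = 0.
  by rewrite (_ : - n.+1%:Z + 1 = - n%:Z) //; lia.
have {}rec (j' : int) : mode2 false t Z (- n.+1%:Z) (j' + 1) = a * mode2 false t Z (- n.+1%:Z) j'.
  by have := rec (- n.+1%:Z) j'; rewrite IH sub0r => /eqP; rewrite addrC subr_eq0 => /eqP <-.
move: (- n.+1%:Z) rec => {n IH}m rec.
move: rec; rewrite /mode2; move: (mode false Z m) => w rec; case: t rec => rec.
  have sup (n : nat) : mode true w (n%:Z - 2) = 0.
    elim: n => [|n IH] //; have := rec (n%:Z - 2); rewrite IH mulr0.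
    by rewrite (_ : n%:Z - 2 + 1 = n.+1%:Z - 2) //; lia.
  have [j0|j0] : (j < -1) \/ (-1 <= j) by lia.
    by rewrite mode_lt.
  by have := sup (absz (j + 2)); rewrite (_ : _ - 2 = j) //; lia.
case: ha => [a0|ra]; first by rewrite -(subrK 1 j) rec a0 mul0r.
have down (n : nat) : mode false w (- n%:Z) = 0.
  elim: n => [|n IH]; first by rewrite mode_ge0.
  apply: ra; rewrite -rec.
  by rewrite (_ : - n.+1%:Z + 1 = - n%:Z) //; lia.
have [j0|j0] : (0 <= j) \/ (j <= 0) by lia.
  by rewrite mode_ge0.
by have := down (absz j); rewrite (_ : - _ = j) //; lia.
Qed.

(* The coefficient of u^0 in (u - v) [f(u), g(v)], for f of sign +. *)
Lemma zero_mode t f g Z' (a : D) : f``_0 = 0 ->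
  pdiff true t * (fst_var f * snd_var g - snd_var g * fst_var f)
    = fpsC (fpsC a) * wden true t * Z' ->
  fpsC f``_1 * g - g * fpsC f``_1 = fpsC a * Z'``_0.
Proof.
move=> f0 /pdiff_wdenP e; apply: (modeP (s := t)) => l.
have := e (-1) l; rewrite !mode2B !mode2_fs !mode2_sf modeB modeCM modeMC modeCM.
have -> : mode true f (-1 + 1) = f``_1 by [].
have -> : mode true f (-1) = 0 by rewrite /mode /= f0.
by rewrite mul0r mulr0 subrr subr0.
Qed.
End TwoVariables.

(** * Currents *)

(* Typing families over this ring avoids reverse coercions. *)
Definition fpsR (D : pzRingType) : pzRingType := fps D.

Definition after N (i j : 'I_N.-1) := (i.+1 == j :> nat).

(* Currents X_i, X_j satisfy
   (u - v) [X_i(u), X_j(v)] = hbar (coefL X_i(u) X_j(v) + coefR X_j(v) X_i(u)). *)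
Definition coefL N (i j : 'I_N.-1) : int := if i == j then 1 else if after i j then -1 else 0.
Definition coefR N (i j : 'I_N.-1) : int := if i == j then 1 else if after j i then -1 else 0.

Variant node_spec N (i j : 'I_N.-1) : bool -> bool -> bool -> Prop :=
  | NodeEq of i = j : node_spec i j true false false
  | NodeAfter of hi i = lo j : node_spec i j false true false
  | NodeBefore of hi j = lo i : node_spec i j false false true
  | NodeFar of (i.+1 < j)%N || (j.+1 < i)%N : node_spec i j false false false.

Lemma nodeP N (i j : 'I_N.-1) : node_spec i j (i == j) (after i j) (after j i).
Proof.
rewrite /after -val_eqE /=.
have [e|ne] := eqVneq (i : nat) j.
  by rewrite e (gtn_eqF (ltnSn j)); constructor; exact: val_inj.
have [e|ne1] := eqVneq i.+1 (j : nat).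
  rewrite -e (gtn_eqF (leqnSn i.+1)); constructor; exact: val_inj.
have [e|ne2] := eqVneq j.+1 (i : nat); first by constructor; exact: val_inj.
by constructor; move/eqP: ne; move/eqP: ne1; move/eqP: ne2; lia.
Qed.

Lemma hi_lo N (i : 'I_N.-1) : hi i = (lo i).+1 :> nat. Proof. by []. Qed.

(** * Relations indexed by the nodes of the Dynkin diagram *)

Section Nodes.
Variables (A : pzRingType) (N : nat).
Implicit Types (g h : gaussfam A N) (i j : 'I_N.-1).

Definition nE g i := gE g (lo i) (hi i).
Definition nF g i := gF g (hi i) (lo i).
Definition nH g i := gK g (hi i) * gKi g (lo i).
(** The form that [nH] takes after transposition, which reverses products; the two agree by
    [nH'_nH]. *)
Definition nH' g i := gKi g (lo i) * gK g (hi i).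

Variables (p q : A) (g h : gaussfam A N).
Hypothesis P : rttpair p q g h.
Local Notation T := Logic.I.

Lemma node_H_E i j :
  p * (nH g i * nE h j - nE h j * nH g i)
  = q * ((nH g i * nE h j) *~ coefL i j + (nE h j * nH g i) *~ coefR i j
         - (gK g (hi i) * nE g j * gKi g (lo i)) *~ coefL i j
         - (gK g (hi i) * nE g j * gKi g (lo i)) *~ coefR i j).
Proof.
rewrite /nH /nE /coefL /coefR.
case: (nodeP i j) => [->|e|e|lt] ; rewrite ?(mulr1z, mulrN1z, mulr0z).
- by rewrite (H_E_same P (hi_lo j)) //; congr (_ * _); nc.
- by rewrite -e (H_E_after P (hi_lo i)) ?e //; congr (_ * _); nc.
- by rewrite -e (H_E_before P (hi_lo j)) ?e //; congr (_ * _); nc.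
- by rewrite (H_E_far P (hi_lo i) (hi_lo j) lt); nc.
Qed.

(** The part of the E-E relation depending on the first variable alone; [gammaE] is the part
    depending on the second alone. Their exact form is irrelevant for currents, where both
    cancel. *)
Definition alphaE g i j :=
  if i == j then - (nE g i * nE g j)
  else if after i j then gE g (lo i) (hi j)
  else if after j i then nE g j * nE g i - gE g (lo j) (hi i) else 0.
Definition gammaE g i j :=
  if i == j then - (nE g i * nE g j)
  else if after i j then nE g i * nE g j - gE g (lo i) (hi j)
  else if after j i then gE g (lo j) (hi i) else 0.

Lemma node_E_E i j :
  p * (nE g i * nE h j - nE h j * nE g i)
  = q * ((nE g i * nE h j) *~ coefL i j + (nE h j * nE g i) *~ coefR i j
         + alphaE g i j + gammaE h i j).
Proof.
rewrite /coefL /coefR /alphaE /gammaE /nE.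
case: (nodeP i j) => [->|e|e|lt] ; rewrite ?(mulr1z, mulrN1z, mulr0z).
- by rewrite (E_E_same P); congr (_ * _); nc.
- by rewrite -e (E_E_next P _ (hi_lo i)); congr (_ * _); nc.
- have := E_E_next (rttpair_swap P) (hi i) (hi_lo j).
  rewrite mulNr -mulrN opprB e => ->; congr (_ * _); nc.
- by rewrite (E_E_far P (hi_lo i) (hi_lo j) lt); nc.
Qed.

Lemma node_E_F i j :
  p * (nE g i * nF h j - nF h j * nE g i)
  = q * ((nH h i - nH' g i) *~ (i == j)).
Proof.
rewrite /nE /nF /nH /nH'; have [->|ne] := eqVneq i j.
  by rewrite (E_F_same P (hi_lo j)) mulr1z.
by rewrite (E_F_neq P (hi_lo i) (hi_lo j)) // subrr mulr0z !mulr0.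
Qed.
End Nodes.

Section NodesF.
Variables (A : pzRingType) (N : nat) (p q : A) (g h : gaussfam A N).
Hypothesis P : rttpair p q g h.
Implicit Types (i j : 'I_N.-1).

Let opp_comm (x y z : A) : p * (x - y) = z -> p * (y - x) = - z.
Proof. by move=> <-; rewrite -mulrN opprB. Qed.

Lemma node_H_F i j :
  p * (nH' g i * nF h j - nF h j * nH' g i)
  = - (q * ((nF h j * nH' g i) *~ coefL i j + (nH' g i * nF h j) *~ coefR i j
         - (gKi g (lo i) * nF g j * gK g (hi i)) *~ coefL i j
         - (gKi g (lo i) * nF g j * gK g (hi i)) *~ coefR i j)).
Proof.
have E : (nF h j * nH' g i - nH' g i * nF h j) * p
  = ((nF h j * nH' g i) *~ coefL i j + (nH' g i * nF h j) *~ coefR i j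
     - (gKi g (lo i) * (nF g j * gK g (hi i))) *~ coefL i j
     - (gKi g (lo i) * (nF g j * gK g (hi i))) *~ coefR i j) * q
  := node_H_E (rttpair_tr P) i j.
by rewrite -(rtt_cp P) -(rtt_cq P) mulrA in E; exact: opp_comm E.
Qed.

Definition alphaF g i j : A :=
  if i == j then - (nF g j * nF g i)
  else if after i j then gF g (hi j) (lo i)
  else if after j i then nF g i * nF g j - gF g (hi i) (lo j) else 0.
Definition gammaF g i j : A :=
  if i == j then - (nF g j * nF g i)
  else if after i j then nF g j * nF g i - gF g (hi j) (lo i)
  else if after j i then gF g (hi i) (lo j) else 0.

Lemma node_F_F i j :
  p * (nF g i * nF h j - nF h j * nF g i)
  = - (q * ((nF h j * nF g i) *~ coefL i j + (nF g i * nF h j) *~ coefR i j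
         + alphaF g i j + gammaF h i j)).
Proof.
have E : (nF h j * nF g i - nF g i * nF h j) * p
  = ((nF h j * nF g i) *~ coefL i j + (nF g i * nF h j) *~ coefR i j
         + alphaF g i j + gammaF h i j) * q
  := node_E_E (rttpair_tr P) i j.
by rewrite -(rtt_cp P) -(rtt_cq P) in E; exact: opp_comm E.
Qed.
End NodesF.

Section GaussMap.
Variables (A B : pzRingType) (phi : {rmorphism A -> B}) (N : nat).

Fact gaussdec_map (g : gaussfam A N) :
  gaussdec (fun i j => phi (gT g i j)) (fun i j => phi (gF g i j))
    (fun i => phi (gK g i)) (fun i => phi (gKi g i)) (fun i j => phi (gE g i j)).
Proof.
case: g => t F K Ki E [h hF hE h1 h2] /=; split.
- by move=> i j; rewrite h rmorph_sum; apply: eq_bigr => a _; rewrite !rmorphM.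
- by move=> i j ij; rewrite hF // rmorph_nat.
- by move=> i j ij; rewrite hE // rmorph_nat.
- by move=> a; rewrite -rmorphM h1 rmorph1.
- by move=> a; rewrite -rmorphM h2 rmorph1.
Qed.
Definition gaussfam_map (g : gaussfam A N) : gaussfam B N := GaussFam (gaussdec_map g).
End GaussMap.

(** * Currents as differences of series of opposite signs *)

Section Currents.
Variables (D : pzRingType) (hb : D) (N : nat) (G : bool -> gaussfam (fps D) N).
Hypotheses (chb : central hb) (rhb : nonzerodiv hb).
Local Notation q s t := (fpsC (fpsC hb) * wden D s t).
Local Notation Hb := (fpsC hb).
Hypothesis RTT : forall s t, rtt (pdiff D s t) (q s t)
  (fun i j => fst_var (gT (G s) i j)) (fun i j => snd_var (gT (G t) i j)).
Hypothesis G0 : forall i j, (gT (G true) i j)``_0 = (i == j)%:R.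
Implicit Types (s t : bool) (i j : 'I_N.-1) (k l : int).

Lemma rttpair_G s t : rttpair (pdiff D s t) (q s t)
  (gaussfam_map (@fst_var D) (G s)) (gaussfam_map (@snd_var D) (G t)).
Proof.
split.
- exact: central_pdiff.
- by apply: centralM; [do 2! apply: central_fpsC|exact: central_wden].
- have := @nonzerodiv_pdiff D s t 0 (or_introl erefl).
  by rewrite !rmorph0 mul0r addr0.
- exact: nonzerodiv_pdiff (or_intror rhb).
- have := @nonzerodiv_pdiff D s t (- hb) (or_intror (nonzerodivN rhb)).
  by rewrite !rmorphN mulNr.
- exact: RTT.
Qed.

(** Triangularity modulo the ideal of series in u^-1 without constant term, T^+ being the identity
    modulo this ideal. *)
Lemma G0_unit : [/\ forall m, (gK (G true) m)``_0 = 1,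
  forall a b, (gE (G true) a b)``_0 = (a == b)%:R &
  forall a b, (gF (G true) a b)``_0 = (a == b)%:R].
Proof.
have iJ : ideal2 (fun f : fps D => f``_0 = 0).
  have c0 (f g : fps D) : (f * g)``_0 = f``_0 * g``_0.
    by rewrite fcoefM big_ord_recl big_ord0 addr0.
  split=> // [u v|u v|u v]; rewrite ?fcoefB ?c0; first by move=> -> ->; rewrite subrr.
    by move=> ->; rewrite mulr0.
  by move=> ->; rewrite mul0r.
have e0 (f : fps D) (b : bool) : (f - b%:R)``_0 = 0 -> f``_0 = b%:R.
  by rewrite fcoefB => /eqP; rewrite subr_eq0 => /eqP ->; case: b; rewrite ?fcoef1 ?fcoef0.
have gd := gP (G true).
have [||hK hE hF] := gauss_triangular_mod iJ _ (gd_mul gd) (gd_F gd) (gd_E gd).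
- by move=> m _; exists (gKi (G true) m); rewrite (gd_inv gd) (gd_invl gd).
- by move=> i j; rewrite fcoefB G0; case: eqP; rewrite ?fcoef1 ?fcoef0 subrr.
split=> [m|i j|i j]; last exact: e0 (hF i j).
  exact: e0 true (hK m).
exact: e0 (hE i j).
Qed.

Definition current (z : bool -> fps D) k := mode true (z true) k - mode false (z false) k.

(** The modes of (u - v) [y(u), z(v)] = a y(u) z(v) + b z(v) y(u). Two coefficients are needed,
    since they become equal only after the shifts of u and v. *)
Definition exchange_rel (a b : D) (y z : int -> D) := forall k l,
  (y (k + 1) * z l - z l * y (k + 1)) - (y k * z (l + 1) - z (l + 1) * y k)
  = a * (y k * z l) + b * (z l * y k).

(** A series in one variable has modes only at index -1 of the other variable, which explains the
    two Kronecker symbols. *)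
Lemma mode_rel s t (y z alpha gamma : fps D) (a b : int) :
  pdiff D s t * (fst_var y * snd_var z - snd_var z * fst_var y)
  = q s t * ((fst_var y * snd_var z) *~ a + (snd_var z * fst_var y) *~ b
             + fst_var alpha + snd_var gamma) ->
  forall k l,
  (mode s y (k + 1) * mode t z l - mode t z l * mode s y (k + 1))
    - (mode s y k * mode t z (l + 1) - mode t z (l + 1) * mode s y k)
  = hb * (a%:~R * (mode s y k * mode t z l) + b%:~R * (mode t z l * mode s y k)
     + mode s alpha k * (l == -1)%:R + (k == -1)%:R * mode t gamma l).
Proof.
move=> /pdiff_wdenP e k l; have := e k l.
rewrite !mode2B !mode2_fs !mode2_sf => ->; congr (_ * _).
have mz (Z : fps (fps D)) (c : int) : mode2 s t (Z *~ c) k l = mode2 s t Z k l *~ c.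
  have m0 : mode2 s t (0 : fps (fps D)) k l = 0 :> D by rewrite /mode2 !mode0.
  have mn n : mode2 s t (Z *+ n) k l = mode2 s t Z k l *+ n.
    by elim: n => [|n IH]; rewrite ?mulr0n // !mulrS mode2D IH.
  case: c => n; first exact: mn.
  by rewrite !NegzE !mulrNz -sub0r mode2B m0 sub0r (mn n.+1).
rewrite !mode2D !mz !mulrzl mode2_fs mode2_sf; congr (_ + _ + _ + _).
  by rewrite -[fst_var alpha]mulr1 -(rmorph1 (@snd_var D)) mode2_fs mode1.
by rewrite -[snd_var gamma]mul1r -(rmorph1 (@fst_var D)) mode2_fs mode1.
Qed.

Lemma total_rel s (y alpha : fps D) (z : bool -> fps D) (a b : int) :
  (forall t, pdiff D s t * (fst_var y * snd_var (z t) - snd_var (z t) * fst_var y)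
    = q s t * ((fst_var y * snd_var (z t)) *~ a + (snd_var (z t) * fst_var y) *~ b
             + fst_var alpha)) ->
  exchange_rel (hb * a%:~R) (hb * b%:~R) (mode s y) (current z).
Proof.
move=> e k l.
have e' t : pdiff D s t * (fst_var y * snd_var (z t) - snd_var (z t) * fst_var y)
    = q s t * ((fst_var y * snd_var (z t)) *~ a + (snd_var (z t) * fst_var y) *~ b
             + fst_var alpha + snd_var 0).
  by rewrite e; congr (_ * _); rewrite [snd_var 0]rmorph0 [RHS]addr0.
move: (mode_rel (e' true) k l) (mode_rel (e' false) k l); rewrite /current !mode0 !mulr0 !addr0.
move: (mode s y k) (mode s y (k + 1)) (mode s alpha k) (mode true (z true) l)
  (mode false (z false) l) (mode true (z true) (l + 1)) (mode false (z false) (l + 1)).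
move: (l == -1)%:R a%:~R b%:~R => d a' b' y0 y1 al zt zf zt1 zf1 h1 h2.
apply/eqP; rewrite -subr_eq0; apply/eqP.
have comb (u1 v1 u2 v2 x : D) : u1 = v1 -> u2 = v2 -> x = (u1 - v1) - (u2 - v2) -> x = 0.
  by move=> -> ->; rewrite !subrr.
by apply: (comb _ _ _ _ _ h1 h2); nc.
Qed.

(** In the alternating sum over the four pairs of signs, the [alpha] term is the same for both signs
    of [t] and the [gamma] term for both signs of [s], so both cancel. *)
Lemma total2_rel (y z alpha gamma : bool -> fps D) (a b : int) :
  (forall s t, pdiff D s t * (fst_var (y s) * snd_var (z t) - snd_var (z t) * fst_var (y s))
    = q s t * ((fst_var (y s) * snd_var (z t)) *~ a + (snd_var (z t) * fst_var (y s)) *~ b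
             + fst_var (alpha s) + snd_var (gamma t))) ->
  exchange_rel (hb * a%:~R) (hb * b%:~R) (current y) (current z).
Proof.
move=> e k l.
move: (mode_rel (e true true) k l) (mode_rel (e true false) k l)
  (mode_rel (e false true) k l) (mode_rel (e false false) k l); rewrite /current.
move: (mode true (y true) k) (mode false (y false) k) (mode true (y true) (k + 1))
  (mode false (y false) (k + 1)) (mode true (z true) l)
  (mode false (z false) l) (mode true (z true) (l + 1)) (mode false (z false) (l + 1)).
move: (mode true (alpha true) k) (mode false (alpha false) k) (mode true (gamma true) l)
  (mode false (gamma false) l).
move: (l == -1)%:R (k == -1)%:R a%:~R b%:~R => d d' a' b'.
move=> al al' ga ga' yt yf yt1 yf1 zt zf zt1 zf1 h1 h2 h3 h4.
apply/eqP; rewrite -subr_eq0; apply/eqP.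
have comb (u1 v1 u2 v2 u3 v3 u4 v4 x : D) : u1 = v1 -> u2 = v2 -> u3 = v3 -> u4 = v4 ->
    x = (u1 - v1) - (u2 - v2) - (u3 - v3) + (u4 - v4) -> x = 0.
  by move=> -> -> -> ->; rewrite !(subrr, addr0).
by apply: (comb _ _ _ _ _ _ _ _ _ h1 h2 h3 h4); nc.
Qed.

Lemma var_comm (x y : fps D) : fst_var x * snd_var y = snd_var y * fst_var x ->
  forall m n, x``_m * y``_n = y``_n * x``_m.
Proof.
move=> e m n; have := congr1 (fun z : fps (fps D) => z``_m``_n) e.
have -> : (fst_var x * snd_var y)``_m``_n = x``_m * y``_n by rewrite fcoefMC; exact: fcoefCM.
by have -> : (snd_var y * fst_var x)``_m``_n = y``_n * x``_m by rewrite fcoefCM; exact: fcoefMC.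
Qed.

Lemma coef_comm (x y : fps D) : (forall m n, x``_m * y``_n = y``_n * x``_m) -> x * y = y * x.
Proof.
move=> e; apply: fpsP => n; have -> : (y * x)``_n = (fps_mul y x)``_n by [].
by rewrite fps_mul_rev fcoefM; apply: eq_bigr => i _; rewrite e.
Qed.

Lemma coef_comm_mode s t (x y : fps D) k l : (forall m n, x``_m * y``_n = y``_n * x``_m) ->
  mode s x k * mode t y l = mode t y l * mode s x k.
Proof. by move=> e; rewrite /mode; do 2! case: ifP => _; rewrite ?mul0r ?mulr0 ?e. Qed.

Lemma nH_comm s t i j m n :
  (nH (G s) i)``_m * (nH (G t) j)``_n = (nH (G t) j)``_n * (nH (G s) i)``_m.
Proof.
apply: var_comm; have P := rttpair_G s t; rewrite !rmorphM /=.
have KK a b : fst_var (gK (G s) a) * snd_var (gK (G t) b)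
    = snd_var (gK (G t) b) * fst_var (gK (G s) a) := K_K P a b.
have KKi a b := commute_inv (gd_inv (gP (gaussfam_map (@snd_var D) (G t))) b)
  (gd_invl (gP (gaussfam_map (@snd_var D) (G t))) b) (KK a b).
have KiK a b := commute_inv (gd_inv (gP (gaussfam_map (@fst_var D) (G s))) b)
  (gd_invl (gP (gaussfam_map (@fst_var D) (G s))) b) (esym (KK b a)).
have KiKi a b := commute_inv (gd_inv (gP (gaussfam_map (@fst_var D) (G s))) b)
  (gd_invl (gP (gaussfam_map (@fst_var D) (G s))) b) (esym (KKi b a)).
move: (KK (hi i) (hi j)) (KKi (hi i) (lo j)) (KiK (hi j) (lo i)) (KiKi (lo j) (lo i)) => /=.
move: (fst_var _) (fst_var _) (snd_var _) (snd_var _) => a b c d e1 e2 e3 e4.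
by nc rules (Logic.I, esym e1, esym e2, e3, e4).
Qed.

Lemma nH'_nH s i : nH' (G s) i = nH (G s) i.
Proof.
have KK a b : gK (G s) a * gK (G s) b = gK (G s) b * gK (G s) a.
  by apply/coef_comm/var_comm; exact: (K_K (rttpair_G s s)).
exact: esym (commute_inv (gd_inv (gP (G s)) _) (gd_invl (gP (G s)) _) (KK _ _)).
Qed.

Definition xE i := current (fun s => nE (G s) i).
Definition xF i := current (fun s => nF (G s) i).
Definition hm s i := mode s (nH (G s) i).

Lemma hm_xE s i j :
  exchange_rel (hb * (coefL i j)%:~R) (hb * (coefR i j)%:~R) (hm s i) (xE j).
Proof.
apply: (@total_rel s _ (- (gK (G s) (hi i) * nE (G s) j * gKi (G s) (lo i)) *~ coefL i j
         - (gK (G s) (hi i) * nE (G s) j * gKi (G s) (lo i)) *~ coefR i j)) => t.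
have := node_H_E (rttpair_G s t) i j.
rewrite rmorphB !rmorphMz rmorphN !rmorphM mulNrz /= addrA.
exact.
Qed.

Lemma hm_xF s i j :
  exchange_rel (hb * (- coefR i j)%:~R) (hb * (- coefL i j)%:~R) (hm s i) (xF j).
Proof.
rewrite /hm -nH'_nH.
apply: (@total_rel s _ ((gKi (G s) (lo i) * nF (G s) j * gK (G s) (hi i)) *~ coefL i j
         + (gKi (G s) (lo i) * nF (G s) j * gK (G s) (hi i)) *~ coefR i j)) => t.
have := node_H_F (rttpair_G s t) i j.
rewrite /nH' /nF rmorphD !rmorphMz !rmorphM !mulrNz /= => ->.
have gen (a b c d : fpsR (fpsR D)) : - (a + b - c - d) = - b - a + (c + d) by nc.
by rewrite -mulrN; congr (_ * _); exact: gen.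
Qed.

Lemma fst_alphaE s i j :
  fst_var (alphaE (G s) i j) = alphaE (gaussfam_map (@fst_var D) (G s)) i j.
Proof.
by rewrite /alphaE; do 3? case: ifP => _; rewrite ?(rmorphB, rmorphN, rmorphM, rmorph0).
Qed.
Lemma snd_gammaE s i j :
  snd_var (gammaE (G s) i j) = gammaE (gaussfam_map (@snd_var D) (G s)) i j.
Proof.
by rewrite /gammaE; do 3? case: ifP => _; rewrite ?(rmorphB, rmorphN, rmorphM, rmorph0).
Qed.
Lemma fst_alphaF s i j :
  fst_var (alphaF (G s) i j) = alphaF (gaussfam_map (@fst_var D) (G s)) i j.
Proof.
by rewrite /alphaF; do 3? case: ifP => _; rewrite ?(rmorphB, rmorphN, rmorphM, rmorph0).
Qed.
Lemma snd_gammaF s i j :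
  snd_var (gammaF (G s) i j) = gammaF (gaussfam_map (@snd_var D) (G s)) i j.
Proof.
by rewrite /gammaF; do 3? case: ifP => _; rewrite ?(rmorphB, rmorphN, rmorphM, rmorph0).
Qed.

Lemma xE_xE i j :
  exchange_rel (hb * (coefL i j)%:~R) (hb * (coefR i j)%:~R) (xE i) (xE j).
Proof.
apply: (@total2_rel _ _ (fun s => alphaE (G s) i j) (fun s => gammaE (G s) i j)) => s t.
by rewrite fst_alphaE snd_gammaE; exact: (node_E_E (rttpair_G s t)).
Qed.

Lemma xF_xF i j :
  exchange_rel (hb * (- coefR i j)%:~R) (hb * (- coefL i j)%:~R) (xF i) (xF j).
Proof.
apply: (@total2_rel _ _ (fun s => - alphaF (G s) i j) (fun s => - gammaF (G s) i j)) => s t.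
have := node_F_F (rttpair_G s t) i j.
rewrite !rmorphN /= fst_alphaF snd_gammaF !mulrNz => ->.
have gen (a b c d : fpsR (fpsR D)) : - (a + b + c + d) = - b - a - c - d by nc.
by rewrite -mulrN; congr (_ * _); exact: gen.
Qed.

(** The right-hand side of the E-F relation consists of one-variable terms, so nothing remains of it
    here; it comes back in [xE_xF0], where only one sign of f is used. *)
Lemma xE_xF i j : exchange_rel 0 0 (xE i) (xF j).
Proof.
have := @total2_rel (fun s => nE (G s) i) (fun s => nF (G s) j)
  (fun s => - nH' (G s) i *~ (i == j)) (fun s => nH (G s) j *~ (i == j)) 0 0.
rewrite !mulr0; apply=> s t.
have := node_E_F (rttpair_G s t) i j; rewrite !rmorphMz rmorphN !rmorphM /= => ->.
have [->|_] := eqVneq i j; last by rewrite !mulr0z !addr0.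
by rewrite !mulr1z !mulr0z add0r add0r addrC.
Qed.

Lemma offdiag i : hi i == lo i = false.
Proof. by rewrite -val_eqE /= (gtn_eqF (ltnSn i)). Qed.

Lemma hm_true_m1 i : hm true i (-1) = 1.
Proof.
have [K0 _ _] := G0_unit.
have c0 (f g : fps D) : (f * g)``_0 = f``_0 * g``_0.
  by rewrite fcoefM big_ord_recl big_ord0 addr0.
have Ki0 a : (gKi (G true) a)``_0 = 1.
  have := congr1 (fun z : fps D => z``_0) (gd_inv (gP (G true)) a).
  by rewrite c0 K0 mul1r.
have -> : hm true i (-1) = (nH (G true) i)``_0 by [].
by rewrite c0 K0 Ki0 mulr1.
Qed.

(** The relation is taken at index -1 for the + series of f. Its mode -1 is zero, so the left-hand
    side is the opposite of the bracket with mode 0, to which f^- does not contribute. The Kronecker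
    symbol is 1 there, which lets the [nH] terms appear. *)
Lemma xE_xF0 i j k : xE i k * xF j 0 - xF j 0 * xE i k
  = if i == j then hb * (hm true i k - hm false i k) else 0.
Proof.
have [_ _ F0] := G0_unit.
have h s : mode s (nE (G s) i) k * xF j 0 - xF j 0 * mode s (nE (G s) i) k
    = if i == j then hb * (hm s i k - (k == -1)%:R) else 0.
  have := @mode_rel s true (nE (G s) i) (nF (G true) j)
    (- nH' (G s) i *~ (i == j)) (nH (G true) j *~ (i == j)) 0 0 _ k (-1).
  have -> : mode true (nF (G true) j) (-1) = 0 by rewrite /mode /= F0 offdiag.
  rewrite /xF /current mode_ge0 // addNr subr0 !(mul0r, mulr0) subr0 sub0r add0r eqxx.
  rewrite add0r mulr1 => E; apply: oppr_inj; rewrite E => {E}.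
    have [->|_] := eqVneq i j; last by rewrite !mulr0z !(mode0, mulr0, addr0, oppr0).
    rewrite !mulr1z nH'_nH -[mode true _ _]/(hm true j (-1)) hm_true_m1 mulr1 modeN.
    by rewrite -[RHS]mulrN opprB addrC !add0r.
  have := node_E_F (rttpair_G s true) i j.
  rewrite !rmorphMz rmorphN !rmorphM /= => ->; congr (_ * _).
  have [->|_] := eqVneq i j; last by rewrite ?mulr0z !addr0.
  by rewrite !mulr1z addrC.
rewrite /xE /current; have := congr2 (fun x y => x - y) (h true) (h false).
case: eqP => [_|_] => [|]; rewrite ?subr0 => {}h.
  transitivity (hb * (hm true i k - (k == -1)%:R) - hb * (hm false i k - (k == -1)%:R)).
    by rewrite -h; nc.
  by nc.
by rewrite -[RHS]h; nc.
Qed.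

Lemma fcoefM0 (R : pzRingType) (f g : fps R) : (f * g)``_0 = f``_0 * g``_0.
Proof. by rewrite fcoefM big_ord_recl big_ord0 addr0. Qed.
Lemma fcoefM1 (R : pzRingType) (f g : fps R) : (f * g)``_1 = f``_0 * g``_1 + f``_1 * g``_0.
Proof. by rewrite fcoefM !big_ord_recl big_ord0 addr0. Qed.
Lemma fst_var0 (f : fps D) : f``_0 = 0 -> (fst_var f)``_0 = 0.
Proof. by move=> f0; rewrite -[LHS]/(fpsC f``_0) f0 rmorph0. Qed.

Lemma snd_var0 (f : fps D) : (snd_var f)``_0 = f. Proof. by []. Qed.

(** * Brackets of zero modes with Gauss coordinates *)

Section ZeroModes.
Variable t : bool.
Let P := rttpair_G true t.
Let gd := gP (G t).
Local Notation e := (gE (G true)).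
Local Notation k_ := (gK (G true)).
Local Notation f := (gF (G true)).
Local Notation e' := (gE (G t)).
Local Notation k' := (gK (G t)).
Local Notation ki' := (gKi (G t)).
Local Notation f' := (gF (G t)).
Local Notation p := (pdiff D true t).
Local Notation T := Logic.I.
Local Notation fv := (@fst_var D).
Local Notation sv := (@snd_var D).
Let cHb : central Hb := central_fpsC chb.

Let zero_modeN (x y : fps D) (Z : fps (fps D)) : x``_0 = 0 ->
  (snd_var y * fst_var x - fst_var x * snd_var y) * p = Z * q true t ->
  fpsC x``_1 * y - y * fpsC x``_1 = - (Hb * Z``_0).
Proof.
move=> x0 E; rewrite -[RHS]mulrN; apply: (@zero_mode D t x y (- Z) hb x0).
have -> : p * (fst_var x * snd_var y - snd_var y * fst_var x)
    = - ((snd_var y * fst_var x - fst_var x * snd_var y) * p).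
  by rewrite -(central_pdiff true t) -[RHS]mulrN opprB.
by rewrite E -(rtt_cq P) [RHS]mulrN.
Qed.

(** At u^0 only constant terms survive on the right: 0 for [e] and 1 for [k]. Hence the zero mode
    commutes with the row entry [k' o * e' o l] and brackets [k' o] into hbar times [k' o * e' o j];
    dividing by [k' o] gives the claim. *)
Lemma ad_e_row (o j l : 'I_N) : (o < j)%N -> (o < l)%N ->
  fpsC (e o j)``_1 * e' o l - e' o l * fpsC (e o j)``_1 = - (Hb * (e' o j * e' o l)).
Proof.
move=> oj ol; have [K0 E0 F0] := G0_unit.
have el0 : (e o l)``_0 = 0 by rewrite E0 -val_eqE /= (ltn_eqF ol).
have e0 : (e o j)``_0 = 0 by rewrite E0 -val_eqE /= (ltn_eqF oj).
have x0 : (k_ o * e o j)``_0 = 0 by rewrite fcoefM0 e0 mulr0.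
have x1 : (k_ o * e o j)``_1 = (e o j)``_1 by rewrite fcoefM1 e0 K0 mul1r mulr0 addr0.
have P' := P; case: P' => cp cq rp rpq _ H.
have Z1 := @zero_mode D t (k_ o * e o j) (k' o * e' o l)
  (sv (k' o) * sv (e' o j) * (fv (k_ o) * fv (e o l)) - fv (k_ o) * fv (e o j) * (sv (k' o) * sv (e' o l))) hb x0.
have Z2 := @zero_mode D t (k_ o * e o j) (k' o)
  (sv (k' o) * sv (e' o j) * fv (k_ o) - fv (k_ o) * fv (e o j) * sv (k' o)) hb x0.
rewrite x1 in Z1 Z2; rewrite [fst_var (_ * _)]rmorphM in Z1 Z2.
rewrite [snd_var (_ * _)]rmorphM in Z1.
have {}Z1 := Z1 (E_row_row cp cq rp rpq (gP _) (gP _) H o j l).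
have {}Z2 := Z2 (E_row_K cp cq rp rpq (gP _) (gP _) H o j).
move: Z1 Z2; rewrite !fcoefB !fcoefM0 (fst_var0 e0) (fst_var0 el0).
rewrite !(mulr0, mul0r) subrr mulr0 subr0.
have k0 : (fst_var (k_ o))``_0 = 1 by rewrite -[LHS]/(fpsC (k_ o)``_0) K0.
rewrite k0 mulr1 !snd_var0.
move: (fpsC _) => c Z1 Z2; have i2 := gd_invl gd o.
transitivity (ki' o * ((c * (k' o * e' o l) - k' o * e' o l * c)
   - (c * k' o - k' o * c) * e' o l)); first by nc rules (T, i2).
by rewrite Z1 Z2; nc central (T, cHb) rules (T, i2).
Qed.

Lemma ad_f_row (o j l : 'I_N) : (o < j)%N -> (o < l)%N ->
  fpsC (f j o)``_1 * f' l o - f' l o * fpsC (f j o)``_1 = Hb * (f' l o * f' j o).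
Proof.
move=> oj ol; have [K0 E0 F0] := G0_unit.
have el0 : (f l o)``_0 = 0 by rewrite F0 -val_eqE /= (gtn_eqF ol).
have e0 : (f j o)``_0 = 0 by rewrite F0 -val_eqE /= (gtn_eqF oj).
have x0 : (f j o * k_ o)``_0 = 0 by rewrite fcoefM0 e0 mul0r.
have x1 : (f j o * k_ o)``_1 = (f j o)``_1 by rewrite fcoefM1 e0 K0 mulr1 mul0r add0r.
have P' := rttpair_tr P; case: P' => cp cq rp rpq _ H.
have Z1 := @zero_modeN (f j o * k_ o) (f' l o * k' o)
  ((fv (f l o) * fv (k_ o)) * (sv (f' j o) * sv (k' o)) - (sv (f' l o) * sv (k' o)) * (fv (f j o) * fv (k_ o))) x0.
have Z2 := @zero_modeN (f j o * k_ o) (k' o)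
  (fv (k_ o) * (sv (f' j o) * sv (k' o)) - sv (k' o) * (fv (f j o) * fv (k_ o))) x0.
rewrite x1 in Z1 Z2; rewrite [fv (_ * _)]rmorphM in Z1 Z2.
rewrite [sv (_ * _)]rmorphM in Z1.
have {}Z1 := Z1 (E_row_row cp cq rp rpq (gP _) (gP _) H o j l).
have {}Z2 := Z2 (E_row_K cp cq rp rpq (gP _) (gP _) H o j).
move: Z1 Z2; rewrite !fcoefB !fcoefM0 (fst_var0 e0) (fst_var0 el0).
rewrite !(mulr0, mul0r) subrr mulr0 oppr0 addr0.
have k0 : (fv (k_ o))``_0 = 1 by rewrite -[LHS]/(fpsC (k_ o)``_0) K0.
rewrite k0 mul1r !snd_var0.
move: (fpsC _) => c Z1 Z2; have i1 := gd_inv gd o.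
transitivity (((c * (f' l o * k' o) - f' l o * k' o * c)
   - f' l o * (c * k' o - k' o * c)) * ki' o); first by nc rules (T, i1).
by rewrite Z1 Z2; nc central (T, cHb) rules (T, i1).
Qed.

Lemma ad_e_next (o j l : 'I_N) : j = o.+1 :> nat -> l = j.+1 :> nat ->
  fpsC (e o j)``_1 * e' j l - e' j l * fpsC (e o j)``_1
  = Hb * (e' o j * e' j l - e' o l).
Proof.
move=> jo lj; have [K0 E0 F0] := G0_unit.
have e0 : (e o j)``_0 = 0 by rewrite E0 -val_eqE /= jo (ltn_eqF (ltnSn o)).
have el0 : (e o l)``_0 = 0 by rewrite E0 -val_eqE /= lj jo (ltn_eqF (leqnSn o.+1)).
have -> := @zero_mode D t (e o j) (e' j l)
  (fv (e o l) - sv (e' o l) - (fv (e o j) - sv (e' o j)) * sv (e' j l)) hb e0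
  (E_E_next P l jo).
congr (_ * _); rewrite !fcoefB !fcoefM0 !fcoefB (fst_var0 e0) (fst_var0 el0).
by rewrite !snd_var0; nc.
Qed.

Lemma ad_f_next (o j l : 'I_N) : j = o.+1 :> nat -> l = j.+1 :> nat ->
  fpsC (f j o)``_1 * f' l j - f' l j * fpsC (f j o)``_1
  = Hb * (f' l o - f' l j * f' j o).
Proof.
move=> jo lj; have [K0 E0 F0] := G0_unit.
have e0 : (f j o)``_0 = 0 by rewrite F0 -val_eqE /= jo (gtn_eqF (ltnSn o)).
have el0 : (f l o)``_0 = 0 by rewrite F0 -val_eqE /= lj jo (gtn_eqF (leqnSn o.+1)).
have -> := @zero_modeN (f j o) (f' l j)
  (fv (f l o) - sv (f' l o) - sv (f' l j) * (fv (f j o) - sv (f' j o))) e0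
  (E_E_next (rttpair_tr P) l jo).
rewrite -[LHS]mulrN; congr (_ * _); rewrite !fcoefB !fcoefM0 !fcoefB (fst_var0 e0) (fst_var0 el0).
by rewrite !snd_var0; nc.
Qed.

Lemma ad_e_prev (o j l : 'I_N) : j = o.+1 :> nat -> l = j.+1 :> nat ->
  let c := fpsC (e j l)``_1 in
  c * e' o j - e' o j * c = Hb * e' o l /\ c * e' o l - e' o l * c = 0.
Proof.
move=> jo lj c; have [K0 E0 F0] := G0_unit.
have e0 : (e j l)``_0 = 0 by rewrite E0 -val_eqE /= lj (ltn_eqF (ltnSn j)).
have e1 : (e o j)``_0 = 0 by rewrite E0 -val_eqE /= jo (ltn_eqF (ltnSn o)).
have el0 : (e o l)``_0 = 0 by rewrite E0 -val_eqE /= lj jo (ltn_eqF (leqnSn o.+1)).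
have x0 : (k_ j * e j l)``_0 = 0 by rewrite fcoefM0 e0 mulr0.
have x1 : (k_ j * e j l)``_1 = (e j l)``_1 by rewrite fcoefM1 e0 K0 mul1r mulr0 addr0.
have opp (x y z : fps (fps D)) : (- p) * (x - y) = z -> p * (y - x) = z.
  by rewrite mulNr -mulrN opprB.
split.
  rewrite /c (@zero_mode D t (e j l) (e' o j)
    (sv (e' o l) - fv (e o l) - (sv (e' o j) - fv (e o j)) * fv (e j l)) hb e0
    (opp _ _ _ (E_E_next (rttpair_swap P) l jo))).
  congr (_ * _); rewrite !fcoefB !fcoefM0 !fcoefB (fst_var0 e0) (fst_var0 el0) (fst_var0 e1).
  by rewrite mulr0 !subr0.
have Z := @zero_mode D t (k_ j * e j l) (e' o l)
  (fv (k_ j) * fv (e j l) * (sv (e' o l) - fv (e o l))) hb x0.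
rewrite x1 [fv (_ * _)]rmorphM in Z.
rewrite /c (Z (opp _ _ _ (E_row_tower (rttpair_swap P) l jo))).
by rewrite !fcoefM0 (fst_var0 e0) mulr0 mul0r mulr0.
Qed.

Lemma ad_f_prev (o j l : 'I_N) : j = o.+1 :> nat -> l = j.+1 :> nat ->
  let c := fpsC (f l j)``_1 in
  c * f' j o - f' j o * c = - (Hb * f' l o) /\ c * f' l o - f' l o * c = 0.
Proof.
move=> jo lj c; have [K0 E0 F0] := G0_unit.
have e0 : (f l j)``_0 = 0 by rewrite F0 -val_eqE /= lj (gtn_eqF (ltnSn j)).
have e1 : (f j o)``_0 = 0 by rewrite F0 -val_eqE /= jo (gtn_eqF (ltnSn o)).
have el0 : (f l o)``_0 = 0 by rewrite F0 -val_eqE /= lj jo (gtn_eqF (leqnSn o.+1)).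
have x0 : (f l j * k_ j)``_0 = 0 by rewrite fcoefM0 e0 mul0r.
have x1 : (f l j * k_ j)``_1 = (f l j)``_1 by rewrite fcoefM1 e0 K0 mulr1 mul0r add0r.
have opp (x y z : fps (fps D)) : (x - y) * (- p) = z -> (y - x) * p = z.
  by rewrite mulrN -mulNr opprB.
have P' := rttpair_tr (rttpair_swap P).
split.
  rewrite /c (@zero_modeN (f l j) (f' j o)
    (sv (f' l o) - fv (f l o) - fv (f l j) * (sv (f' j o) - fv (f j o))) e0
    (opp _ _ _ (E_E_next P' l jo))).
  congr (- (_ * _)); rewrite !fcoefB !fcoefM0 !fcoefB (fst_var0 e0) (fst_var0 el0) (fst_var0 e1).
  by rewrite mul0r !subr0.
have Z := @zero_modeN (f l j * k_ j) (f' l o)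
  ((sv (f' l o) - fv (f l o)) * (fv (f l j) * fv (k_ j))) x0.
rewrite x1 [fv (_ * _)]rmorphM in Z.
rewrite /c (Z (opp _ _ _ (E_row_tower P' l jo))).
by rewrite !fcoefM0 (fst_var0 e0) mul0r !mulr0 oppr0.
Qed.
End ZeroModes.

Lemma serre_total (x : D) (z : bool -> fps D) l :
  (forall t, fpsC x * (fpsC x * z t - z t * fpsC x) - (fpsC x * z t - z t * fpsC x) * fpsC x = 0) ->
  x * (x * current z l - current z l * x) - (x * current z l - current z l * x) * x = 0.
Proof.
move=> h.
have {}h t : x * (x * mode t (z t) l - mode t (z t) l * x)
    - (x * mode t (z t) l - mode t (z t) l * x) * x = 0.
  by rewrite -[RHS](mode0 D t l) -(h t) modeB modeCM modeMC modeB modeCM modeMC.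
rewrite /current; have := congr2 (fun u v => u - v) (h true) (h false).
by rewrite subrr => {1}<-; nc.
Qed.

(** If [j] follows [i], the first bracket is hbar (b z - a), and bracketing again produces terms in
    b b z and b a that cancel in pairs. If [j] precedes [i], the first bracket is hbar times a
    coordinate that already commutes with the zero mode. *)
Lemma serre_base_E i j l : after i j || after j i ->
  xE i 0 * (xE i 0 * xE j l - xE j l * xE i 0) - (xE i 0 * xE j l - xE j l * xE i 0) * xE i 0 = 0.
Proof.
have -> : xE i 0 = (nE (G true) i)``_1 by rewrite /xE /current mode_ge0 // subr0.
have cHb := central_fpsC chb.
move=> ij; apply: serre_total => t; move: ij; rewrite /nE.
case: (nodeP i j) => [| e _ | e _ |] //.
  have lt1 : (lo i < hi i)%N by [].
  have lj : hi j = (hi i).+1 :> nat by rewrite e.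
  have lt2 : (lo i < hi j)%N by rewrite lj ltnW.
  rewrite -e; move: (ad_e_row t lt1 lt1) (ad_e_row t lt1 lt2) (ad_e_next t (hi_lo i) lj).
  move: (fpsC (gE (G true) (lo i) (hi i))``_1) (gE (G t) (lo i) (hi i)) (gE (G t) (lo i) (hi j))
    (gE (G t) (hi i) (hi j)) => c b a z h1 h2 h3.
  rewrite h3; transitivity (Hb * ((c * b - b * c) * z + b * (c * z - z * c) - (c * a - a * c))).
    by nc central (Logic.I, cHb).
  by rewrite h1 h2 h3; nc central (Logic.I, cHb).
have lj : hi i = (hi j).+1 :> nat by rewrite e.
rewrite -e; have [h1 h2] := ad_e_prev t (hi_lo j) lj; rewrite h1.
transitivity (Hb * (fpsC (gE (G true) (hi j) (hi i))``_1 * gE (G t) (lo j) (hi i)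
   - gE (G t) (lo j) (hi i) * fpsC (gE (G true) (hi j) (hi i))``_1)).
  by nc central (Logic.I, cHb).
by rewrite h2 mulr0.
Qed.

Lemma serre_base_F i j l : after i j || after j i ->
  xF i 0 * (xF i 0 * xF j l - xF j l * xF i 0) - (xF i 0 * xF j l - xF j l * xF i 0) * xF i 0 = 0.
Proof.
have -> : xF i 0 = (nF (G true) i)``_1 by rewrite /xF /current mode_ge0 // subr0.
have cHb := central_fpsC chb.
move=> ij; apply: serre_total => t; move: ij; rewrite /nF.
case: (nodeP i j) => [| e _ | e _ |] //.
  have lt1 : (lo i < hi i)%N by [].
  have lj : hi j = (hi i).+1 :> nat by rewrite e.
  have lt2 : (lo i < hi j)%N by rewrite lj ltnW.
  rewrite -e; move: (ad_f_row t lt1 lt1) (ad_f_row t lt1 lt2) (ad_f_next t (hi_lo i) lj).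
  move: (fpsC (gF (G true) (hi i) (lo i))``_1) (gF (G t) (hi i) (lo i)) (gF (G t) (hi j) (lo i))
    (gF (G t) (hi j) (hi i)) => c b a z h1 h2 h3.
  rewrite h3; transitivity (Hb * ((c * a - a * c) - z * (c * b - b * c) - (c * z - z * c) * b)).
    by nc central (Logic.I, cHb).
  by rewrite h1 h2 h3; nc central (Logic.I, cHb).
have lj : hi i = (hi j).+1 :> nat by rewrite e.
rewrite -e; have [h1 h2] := ad_f_prev t (hi_lo j) lj; rewrite h1.
transitivity (- Hb * (fpsC (gF (G true) (hi i) (hi j))``_1 * gF (G t) (hi i) (lo j)
   - gF (G t) (hi i) (lo j) * fpsC (gF (G true) (hi i) (hi j))``_1)).
  by nc central (Logic.I, cHb).
by rewrite h2 mulr0.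
Qed.

Lemma total_commr (x : D) (z : bool -> fps D) l :
  (forall t, x * mode t (z t) l = mode t (z t) l * x) -> x * current z l = current z l * x.
Proof. by move=> e; rewrite /current mulrBl mulrBr !e. Qed.

Section Far.
Variables i j : 'I_N.-1.
Hypothesis far : (i.+1 < j)%N || (j.+1 < i)%N.

Lemma hm_xE_far s k l : hm s i k * xE j l = xE j l * hm s i k.
Proof.
apply: total_commr => t; apply: coef_comm_mode; apply: var_comm.
have := H_E_far (rttpair_G s t) (hi_lo i) (hi_lo j) far.
by rewrite rmorphM.
Qed.

Lemma hm_xF_far s k l : hm s i k * xF j l = xF j l * hm s i k.
Proof.
apply: total_commr => t; rewrite /hm -nH'_nH; apply: coef_comm_mode; apply: var_comm.
have E : snd_var (nF (G t) j) * (fst_var (gKi (G s) (lo i)) * fst_var (gK (G s) (hi i)))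
   = fst_var (gKi (G s) (lo i)) * fst_var (gK (G s) (hi i)) * snd_var (nF (G t) j)
   := H_E_far (rttpair_tr (rttpair_G s t)) (hi_lo i) (hi_lo j) far.
by rewrite rmorphM /= E.
Qed.

Lemma xE_xE_far k l : xE i k * xE j l = xE j l * xE i k.
Proof.
apply: total_commr => t; apply/esym; apply: total_commr => s; apply/esym.
apply: coef_comm_mode; apply: var_comm.
exact: (E_E_far (rttpair_G s t) (hi_lo i) (hi_lo j) far).
Qed.

Lemma xF_xF_far k l : xF i k * xF j l = xF j l * xF i k.
Proof.
apply: total_commr => t; apply/esym; apply: total_commr => s; apply/esym.
apply: coef_comm_mode; apply: var_comm.
exact: esym (E_E_far (rttpair_tr (rttpair_G s t)) (hi_lo i) (hi_lo j) far).
Qed.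
End Far.
End Currents.

(** * Shifts of the spectral parameter *)

(* The binomial coefficient k (k - 1) ... (k - j + 1) / j! of any integer k. *)
Definition binz (k : int) (j : nat) : int :=
  match k with
  | Posz n => 'C(n, j)%:Z
  | Negz n => (-1) ^+ j * 'C(n + j, j)%:Z
  end.

Lemma binz0 k : binz k 0 = 1.
Proof. by case: k => n; rewrite /= ?bin0 // addn0 bin0 mulr1. Qed.

Lemma binzS k j : binz (k + 1) j.+1 = binz k j.+1 + binz k j.
Proof.
case: k => [n|[|n]].
- by rewrite (_ : Posz n + 1 = Posz n.+1) ?/binz ?binS ?PoszD //; lia.
- rewrite (_ : Negz 0 + 1 = Posz 0) // /binz bin0n !add0n !binn !mulr1.
  by rewrite exprS mulN1r addNr.
- rewrite (_ : Negz n.+1 + 1 = Negz n) ?/binz; last by lia.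
  rewrite exprS !mulN1r !mulNr -mulrN -mulrN -mulrDr; congr (_ * _).
  by rewrite addSn binS addSnnS PoszD; lia.
Qed.

Section Shift.
Variables (D : pzRingType) (hb : D).
Hypotheses (chb : central hb) (sep : separated hb).
Implicit Types (x y z : int -> D) (a b d u v w : D).

Lemma central_exp a n : central a -> central (a ^+ n).
Proof.
move=> ca; elim: n => [|n IH] z; rewrite ?expr0 ?mul1r ?mulr1 //.
by rewrite exprS -mulrA IH !mulrA ca.
Qed.

Definition congh n u v := exists w, u - v = hb ^+ n * w.

Lemma congh_refl n u : congh n u u.
Proof. by exists 0; rewrite subrr mulr0. Qed.
Lemma congh_sym n u v : congh n u v -> congh n v u.
Proof. by case=> y e; exists (- y); rewrite mulrN -e opprB. Qed.
Lemma congh_trans n u v w : congh n u v -> congh n v w -> congh n u w.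
Proof. by case=> y e [z e']; exists (y + z); rewrite mulrDr -e -e' addrA subrK. Qed.
Lemma conghB n u v u' v' : congh n u v -> congh n u' v' -> congh n (u - u') (v - v').
Proof.
by case=> y e [z e']; exists (y - z); rewrite mulrBr -e -e'; nc.
Qed.
Lemma conghD n u v u' v' : congh n u v -> congh n u' v' -> congh n (u + u') (v + v').
Proof. by case=> y e [z e']; exists (y + z); rewrite mulrDr -e -e' opprD addrACA. Qed.
Lemma conghMl n d u v : congh n u v -> congh n (d * u) (d * v).
Proof. by case=> y e; exists (d * y); rewrite -mulrBr e !mulrA (central_exp _ chb). Qed.
Lemma conghMr n d u v : congh n u v -> congh n (u * d) (v * d).
Proof. by case=> y e; exists (y * d); rewrite -mulrBl e !mulrA. Qed.
Lemma congh_eq u v : (forall n, congh n u v) -> u = v.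
Proof. by move=> h; apply/eqP; rewrite -subr_eq0; apply/eqP/sep. Qed.
Lemma congh_leq m n u v : (m <= n)%N -> congh n u v -> congh m u v.
Proof. by move=> mn [y e]; exists (hb ^+ (n - m) * y); rewrite e mulrA -exprD subnKC. Qed.

(** When [a] is a multiple of [hb], the omitted terms are divisible by [hb ^+ n]. Working with these
    truncations treats the finite sums of sign + and the limits of sign - alike. *)
Definition shift_sum a x (k : int) n := \sum_(j < n) ((- a) ^+ j * x (k - j%:Z)) *~ binz k j.

(* x' is given by the modes of x(u + a), that is x'_k = \sum_j 'C(k, j) (-a)^j x_(k-j). *)
Definition shifted a x x' := forall (k : int) n, congh n (x' k) (shift_sum a x k n).

Lemma shifted_uniq a x x' x'' : shifted a x x' -> shifted a x x'' -> x' =1 x''.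
Proof.
move=> h h' k; apply: congh_eq => n.
exact: congh_trans (h k n) (congh_sym (h' k n)).
Qed.

Lemma shifted_ext a x y x' : x =1 y -> shifted a x x' -> shifted a y x'.
Proof.
move=> e h k n; have := h k n; congr (congh _ _ _).
by apply: eq_bigr => j _; rewrite e.
Qed.

Lemma shiftedMl a d x x' : central a -> shifted a x x' ->
  shifted a (fun k => d * x k) (fun k => d * x' k).
Proof.
move=> ca h k n; have := conghMl d (h k n); congr (congh _ _ _).
rewrite /shift_sum mulr_sumr; apply: eq_bigr => j _.
by rewrite mulrzAr !mulrA (central_exp _ (centralN ca)).
Qed.

Lemma shiftedMr a d x x' : shifted a x x' ->
  shifted a (fun k => x k * d) (fun k => x' k * d).
Proof.
move=> h k n; have := conghMr d (h k n); congr (congh _ _ _).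
by rewrite /shift_sum mulr_suml; apply: eq_bigr => j _; rewrite mulrzAl !mulrA.
Qed.

Lemma shiftedB a x x' y y' : shifted a x x' -> shifted a y y' ->
  shifted a (fun k => x k - y k) (fun k => x' k - y' k).
Proof.
move=> h1 h2 k n; have := conghB (h1 k n) (h2 k n); congr (congh _ _ _).
rewrite /shift_sum -sumrB; apply: eq_bigr => j _.
by rewrite -mulrzBl mulrBr.
Qed.

Lemma congh_mul0 n a u : (exists b, a = hb * b) -> congh n (a ^+ n * u) 0.
Proof.
case=> b ->; exists (b ^+ n * u); rewrite subr0 mulrA; congr (_ * _).
elim: n => [|n IH]; first by rewrite !expr0 mulr1.
by rewrite !exprS IH !mulrA; congr (_ * _); rewrite -!mulrA (central_exp n chb).
Qed.

(** Raising the index is multiplication by u, and after the substitution u x(u) becomes (u + a) x(u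
    + a). On coefficients this is Pascal's rule [binzS]. *)
Lemma shiftedS a x x' : (exists b, a = hb * b) -> shifted a x x' ->
  shifted a (fun k => x (k + 1)) (fun k => x' (k + 1) + a * x' k).
Proof.
move=> [b ab] h k n; pose y (k : int) := x (k + 1).
have e : shift_sum a x (k + 1) n.+1 = shift_sum a y k n.+1 - a * shift_sum a x k n.
  rewrite /shift_sum !big_ord_recl !binz0 /y !subr0 -addrA; congr (_ + _).
  rewrite mulr_sumr -sumrB; apply: eq_bigr => j _; rewrite /= /bump /=.
  have -> : k + 1 - (1 + j)%:Z = k - j%:Z by lia.
  have -> : k - (1 + j)%:Z + 1 = k - j%:Z by lia.
  by rewrite add1n binzS mulrzDr; congr (_ + _); rewrite exprS -mulrA mulNr mulNrz -mulrzAr.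
have h1 := congh_leq (leqnSn n) (h (k + 1) n.+1); rewrite e in h1.
have h2 := conghD h1 (conghMl a (h k n)); rewrite subrK in h2.
apply: congh_trans h2 _; rewrite /shift_sum big_ord_recr /=.
have := conghD (congh_refl n (shift_sum a y k n)) (conghMr (binz k n)%:~R (congh_mul0 n (y (k - n%:Z)) (ex_intro _ (- b) _))).
move=> /(_ (- a)); rewrite mul0r addr0 mulrzr; apply.
by rewrite ab mulrN.
Qed.

(** The binomials of 0 vanish beyond the first. That zero modes ignore the shift is used for the
    base of the Serre relation and for the value of [e, f]. *)
Lemma shifted0 a x x' : shifted a x x' -> x' 0 = x 0.
Proof.
move=> h; apply: congh_eq => n; apply: congh_leq (leqnSn n) _.
have := h 0 n.+1; congr congh; rewrite /shift_sum big_ord_recl big1 => [|j _].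
  by rewrite binz0 expr0 mul1r subr0 addr0.
by rewrite (_ : binz 0 _ = 0) ?mulr0z //= bin0n.
Qed.

Lemma shifted_id x x' : shifted 0 x x' -> x' =1 x.
Proof.
move=> h k; apply: congh_eq => n; apply: congh_leq (leqnSn n) _.
have := h k n.+1; congr congh; rewrite /shift_sum big_ord_recl big1 => [|j _].
  by rewrite binz0 expr0 mul1r subr0 addr0.
by rewrite oppr0 expr0n mul0r mul0rz.
Qed.

Lemma exchange_rel_sym a b x y : exchange_rel a b x y -> exchange_rel b a y x.
Proof.
by move=> h k l; apply: (nc_lin (u := 1) (v := 1) (h l k)); nc.
Qed.

Lemma shifted_zero a x x' : shifted a x x' -> (forall k, x k = 0) -> forall k, x' k = 0.
Proof.
move=> h x0 k; apply: congh_eq => n; have := h k n; congr congh.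
by rewrite /shift_sum big1 // => j _; rewrite x0 mulr0 mul0rz.
Qed.

(** Substituting u + a turns u - v into u - v + a; the additional bracket a [x', y] goes to the
    right-hand side. The proof shifts, in u only, the difference of the two sides, which is
    identically zero. *)
Lemma shifted_exchange_l a b c x x' y : central a -> (exists d, a = hb * d) ->
  shifted a x x' -> exchange_rel b c x y -> exchange_rel (b - a) (c + a) x' y.
Proof.
move=> ca da h e k l.
have h1 := shiftedS da h.
have hs := shiftedB (shiftedB (shiftedB (shiftedMr (y l) h1) (shiftedMl (y l) ca h1))
    (shiftedB (shiftedMr (y (l + 1)) h) (shiftedMl (y (l + 1)) ca h)))
  (shiftedB (shiftedMl b ca (shiftedMr (y l) h)) (shiftedMl (- c) ca (shiftedMl (y l) ca h))).
have E := shifted_zero hs _ k; apply: (nc_lin (u := 1) (v := 1) (E _)) => [j|].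
  have /eqP := e j l; rewrite -subr_eq0 => /eqP <-; nc.
by nc central (Logic.I, ca).
Qed.

Lemma shifted_exchange a b c d x x' y y' :
  central a -> central b -> (exists u, a = hb * u) -> (exists u, b = hb * u) ->
  shifted a x x' -> shifted b y y' -> exchange_rel c d x y ->
  exchange_rel (c - (a - b)) (d + (a - b)) x' y'.
Proof.
move=> ca cb da db hx hy e.
have e1 := exchange_rel_sym (shifted_exchange_l ca da hx e).
have := exchange_rel_sym (shifted_exchange_l cb db hy e1).
by congr (exchange_rel _ _ _ _); nc.
Qed.

Lemma shifted_comm_l a x x' u : central a -> shifted a x x' ->
  (forall k, x k * u = u * x k) -> forall k, x' k * u = u * x' k.
Proof.
move=> ca h e; apply: (shifted_uniq (a := a) (x := fun k => u * x k)).
  by apply: shifted_ext (shiftedMr u h).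
exact: shiftedMl.
Qed.

Lemma shifted_series_plus a (g g' : fps D) : (exists b, a = hb * b) ->
  (forall m, g'``_m = \sum_(k < m.+1) ((- a) ^+ (m - k) * g``_k) *+ 'C(m.-1, m - k)) ->
  shifted a (mode true g) (mode true g').
Proof.
move=> [b ab] e k n.
pose F (j : nat) := ((- a) ^+ j * mode true g (k - j%:Z)) *~ binz k j.
have F0 j : (k + 1 < j%:Z) -> F j = 0.
  by move=> kj; rewrite /F mode_lt ?mulr0 ?mul0rz //; lia.
have Fn j (m : nat) : (m <= j)%N -> congh m (F j) 0.
  move=> mj; apply: congh_leq mj _; rewrite /F -[X in congh _ X]mulrzr.
  have := conghMr (binz k j)%:~R (congh_mul0 j (mode true g (k - j%:Z)) (ex_intro (fun u => - a = hb * u) (- b) _)).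
  by rewrite mul0r; apply; rewrite ab mulrN.
have Fsum (m M : nat) : (m <= M)%N -> congh m (\sum_(j < M) F j) (\sum_(j < m) F j).
  move=> mM; rewrite -(subnKC mM); elim: (M - m)%N => [|r IH]; first by rewrite addn0; exact: congh_refl.
  rewrite addnS big_ord_recr /= -[X in congh _ _ X]addr0; apply: conghD => //.
  by apply: Fn; exact: leq_addr.
have [k1|k1] : (k < -1) \/ (-1 <= k) by lia.
  rewrite mode_lt // /shift_sum big1 => [|j _]; first exact: congh_refl.
  by apply: F0; lia.
have [m km] : exists m : nat, k = m%:Z - 1 by exists (absz (k + 1)); lia.
have -> : mode true g' k = \sum_(j < m.+1) F j.
  have -> : mode true g' k = g'``_m by rewrite /mode km subrK.
  rewrite e (reindex_inj rev_ord_inj) /=; apply: eq_bigr => j _.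
  rewrite subSS /F; have jm : (j <= m)%N by rewrite -ltnS.
  rewrite subKn // /mode.
  have -> : (0 <= k - j%:Z + 1) by lia.
  have -> : absz (k - j%:Z + 1) = (m - j)%N by lia.
  (* Here [k = m - 1]. For [m = 0] this is -1 while the predecessor [m.-1] is 0, but then only
     [i = 0] occurs and both binomials are 1. *)
  suff H (i : nat) : (i <= m)%N -> binz k i = 'C(m.-1, i)%:Z by rewrite H.
  rewrite km; case: (m) => [|m' _]; first by rewrite leqn0 => /eqP ->.
  by rewrite (_ : m'.+1%:Z - 1 = m') //; lia.
have [nm|mn] := leqP n m.+1; first exact: Fsum.
have -> : \sum_(j < m.+1) F j = \sum_(j < n) F j; last exact: congh_refl.
rewrite -(subnKC (ltnW mn)); elim: (n - m.+1)%N => [|r IH]; first by rewrite addn0.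
by rewrite addnS [RHS]big_ord_recr /= F0 ?addr0 //; lia.
Qed.

Lemma shifted_series_minus a (g g' : fps D) :
  (forall m n, congh n g'``_m (\sum_(j < n) (a ^+ j * g``_(m + j)) *+ 'C(m + j, m))) ->
  shifted a (mode false g) (mode false g').
Proof.
move=> e k n.
have [k0|k0] : (0 <= k) \/ (k <= -1) by lia.
  rewrite mode_ge0 // /shift_sum big1 => [|j _]; first exact: congh_refl.
  (* For [k >= 0] every term is zero: either the mode has a nonnegative index, or [j > k] and the
     binomial vanishes. *)
  have [kj|kj] : (0 <= k - j%:Z) \/ (k < j%:Z) by lia.
    by rewrite mode_ge0 // mulr0 mul0rz.
  case: k k0 kj => // k _ kj; rewrite /binz bin_small ?mulr0z //; lia.
have [m km] : exists m : nat, k = - m%:Z - 1 by exists (absz (k + 1)); lia.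
have -> : mode false g' k = g'``_m.
  rewrite /mode; have -> : (k + 1 <= 0) by lia.
  by have -> : absz (k + 1) = m by lia.
have := e m n; congr congh; apply: eq_bigr => j _.
rewrite /mode; have -> : (k - j%:Z + 1 <= 0) by lia.
have -> : absz (k - j%:Z + 1) = (m + j)%N by lia.
have -> : binz k j = (-1) ^+ j * 'C(m + j, j)%:Z.
  by have -> : k = Negz m by lia.
have -> : 'C(m + j, j) = 'C(m + j, m) by rewrite -[LHS]bin_sub ?leq_addl // addnK.
rewrite exprNn -(signr_odd D) -(signr_odd int); move: (odd j) => b.
move: (a ^+ j) (g``_(m + j)) 'C(m + j, m) => u v c.
case: b; rewrite /= ?expr1 ?expr0; last by rewrite ?mul1r.
by rewrite ?mulN1r mulNr ?mulrNz ?mulNrz ?opprK.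
Qed.
End Shift.

(** * Completeness and existence of Gauss decompositions *)

Definition complete (D : pzRingType) (hb : D) := forall d : nat -> D,
  exists l, forall n, congh hb n l (\sum_(j < n) hb ^+ j * d j).

Section Topquot.
Variables (R : pzRingType) (hb : R) (S : set R).
Local Notation pr := (topproj hb S).

Fact topproj_zmod : zmod_morphism pr.
Proof. by move=> x y; rewrite -tq_addE -tq_oppE. Qed.
Fact topproj_monoid : monoid_morphism pr.
Proof. by split=> // x y; rewrite -tq_mulE. Qed.
HB.instance Definition _ := GRing.isZmodMorphism.Build R (topquot hb S) pr topproj_zmod.
HB.instance Definition _ := GRing.isMonoidMorphism.Build R (topquot hb S) pr topproj_monoid.

Lemma topproj0P x : pr x = 0 <-> topspan hb S x.
Proof. by rewrite -(rmorph0 pr) topprojP subr0. Qed.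

Lemma topproj_rel x : S x -> pr x = 0.
Proof. by move=> Sx; apply/topproj0P => I _; apply. Qed.

(** This and the next lemma are the torsion and closedness clauses of [topideal], read in the
    quotient. *)
Lemma topquot_regular : nonzerodiv (pr hb).
Proof.
elim/tq_ind=> x; rewrite -rmorphM => /topproj0P h; apply/topproj0P.
exact: (topideal_torsion (topspan_ideal hb S)).
Qed.

Lemma topquot_separated : separated (pr hb).
Proof.
elim/tq_ind=> x h; apply/topproj0P.
apply: (topideal_closed (topspan_ideal hb S)) => n.
have [y] := h n; elim/tq_ind: y => y; rewrite -rmorphXn -rmorphM => /topprojP e.
by exists y.
Qed.

Lemma topquot_central z : central z -> central (pr z).
Proof. by move=> cz; elim/tq_ind=> x; rewrite -!rmorphM cz. Qed.

Lemma topquot_complete : complete hb -> complete (pr hb).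
Proof.
move=> cR d; have [l hl] := cR (fun j => repr (d j)); exists (pr l) => n.
have [y e] := hl n; exists (pr y); rewrite -rmorphXn -rmorphM -e rmorphB rmorph_sum.
congr (_ - _); apply: eq_bigr => j _.
by rewrite rmorphM rmorphXn /= topprojK.
Qed.
End Topquot.

Lemma fcoefXnM (R : pzRingType) (f : fps R) j n :
  (fpsX ^+ j * f)``_n = if (j <= n)%N then f``_(n - j) else 0.
Proof.
elim: j n => [|j IH] n; first by rewrite mul1r subn0.
by rewrite exprS -mulrA fcoefXM; case: n => // n; rewrite IH subSS.
Qed.

Lemma fcoef_sum (R : pzRingType) I (r : seq I) P (F : I -> fps R) n :
  (\sum_(i <- r | P i) F i)``_n = \sum_(i <- r | P i) (F i)``_n.
Proof.
by apply: (big_morph (fun f : fps R => f``_n)) => //; exact: fcoef0.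
Qed.

Lemma fps_complete (R : pzRingType) : complete (fpsX : fps R).
Proof.
move=> d; exists (Fps (fun n => \sum_(j < n.+1) (d j)``_(n - j))) => n.
exists (Fps (fun m => \sum_(n <= j < (m + n).+1) (d j)``_(m + n - j))).
apply: fpsP => m; rewrite fcoefB fcoef_sum fcoefXnM.
have E : \sum_(j < n) (fpsX ^+ j * d j)``_m
    = \sum_(0 <= j < n | (j <= m)%N) (d j)``_(m - j).
  rewrite big_mkord [RHS]big_mkcond; apply: eq_bigr => j _.
  by rewrite fcoefXnM; case: ifP.
rewrite E /= -(big_mkord xpredT (fun j => (d j)``_(m - j))) /=.
have [nm|mn] := leqP n m.
  rewrite subnK // (big_cat_nat (n := n)) //=; last exact: leqW.
  have -> : \sum_(0 <= j < n | (j <= m)%N) (d j)``_(m - j) = \sum_(0 <= j < n) (d j)``_(m - j).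
    rewrite big_nat_cond [RHS]big_nat_cond; apply: eq_bigl => j.
    by case: (ltnP j n) => //= jn; rewrite ?andbF // (ltnW (leq_trans jn nm)).
  by rewrite addrAC subrr add0r.
rewrite (big_nat_widen 0 m.+1 n) //=; apply/eqP; rewrite subr_eq0; apply/eqP.
by apply: eq_bigl => j; rewrite ltnS.
Qed.

Section Complete.
Variables (D : pzRingType) (hb : D).
Hypotheses (chb : central hb) (sep : separated hb) (comp : complete hb).

Lemma fpsC_expE n : fpsC hb ^+ n = fpsC (hb ^+ n).
Proof. by rewrite rmorphXn. Qed.

Lemma fps_congh n (f g : fps D) :
  (forall m, congh hb n f``_m g``_m) -> congh (fpsC hb) n f g.
Proof.
move=> h; have [y hy] := choice h; exists (Fps y); apply: fpsP => m.
by rewrite fpsC_expE fcoefCM fcoefB hy.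
Qed.

Lemma fps_separated : separated (fpsC hb).
Proof.
move=> f h; apply: fpsP => m; rewrite fcoef0; apply: sep => n.
by have [y ->] := h n; exists y``_m; rewrite fpsC_expE fcoefCM.
Qed.

Lemma fps_hb_complete : complete (fpsC hb).
Proof.
move=> d; have h m := comp (fun j => (d j)``_m); have [l hl] := choice h.
exists (Fps l) => n; apply: fps_congh => m; have := hl m n.
congr congh; rewrite fcoef_sum; apply: eq_bigr => j _.
by rewrite fpsC_expE fcoefCM.
Qed.

Lemma one_plus_unit (y : D) : exists z, (1 + hb * y) * z = 1 /\ z * (1 + hb * y) = 1.
Proof.
have [l hl] := comp (fun j => (- y) ^+ j); exists l.
pose x := hb * - y; have -> : 1 + hb * y = 1 - x by rewrite /x mulrN opprK.
have xn n : x ^+ n = hb ^+ n * (- y) ^+ n.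
  by rewrite exprMn_comm //; exact: chb.
have cs n : congh hb n l (\sum_(j < n) x ^+ j).
  by have := hl n; congr congh; apply: eq_bigr => j _; rewrite xn.
have x0 n : congh hb n (1 - x ^+ n) 1.
  by exists (- (- y) ^+ n); rewrite mulrN -xn addrAC subrr add0r.
have geo n : \sum_(j < n) x ^+ j * (1 - x) = 1 - x ^+ n.
  rewrite -mulr_suml; elim: n => [|n IH]; first by rewrite big_ord0 mul0r expr0 subrr.
  by rewrite big_ord_recr mulrDl IH mulrBr mulr1 -exprSr addrA subrK.
have geo' n : (1 - x) * \sum_(j < n) x ^+ j = 1 - x ^+ n.
  elim: n => [|n IH]; first by rewrite big_ord0 mulr0 expr0 subrr.
  by rewrite big_ord_recr mulrDr IH mulrBl mul1r -exprS addrA subrK.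
split; apply: (congh_eq sep) => n; apply: congh_trans (x0 n).
  by rewrite -geo'; exact: (conghMl chb).
rewrite -geo -mulr_suml; exact: conghMr.
Qed.
End Complete.

(** * Gaussian elimination with pivots congruent to 1 *)

Section GaussExistence.
Variables (A : pzRingType) (J : A -> Prop) (N : nat).
Hypothesis iJ : ideal2 J.
Hypothesis uJ : forall x, J (x - 1) -> exists z, x * z = 1 /\ z * x = 1.
Implicit Types (t : 'I_N -> 'I_N -> A).

Definition inverse (x : A) : A := xget 0 [set z | x * z = 1 /\ z * x = 1].
Lemma inverseP x : J (x - 1) -> x * inverse x = 1 /\ inverse x * x = 1.
Proof.
by move=> /uJ [z hz]; exact: (@xgetPex _ 0 [set z | x * z = 1 /\ z * x = 1] (ex_intro _ z hz)).
Qed.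

(** The recursion is on a natural number, so the pivot index is recovered by [insub]; beyond [N]
    nothing is left to eliminate. *)
Fixpoint eliminate t (m : nat) : 'I_N -> 'I_N -> A :=
  if m is m'.+1 then
    if insub m' is Some o then schur (eliminate t m') o (inverse (eliminate t m' o o))
    else eliminate t m'
  else t.

Lemma eliminateS t (m : 'I_N) :
  eliminate t m.+1 = schur (eliminate t m) m (inverse (eliminate t m m m)).
Proof. by rewrite /= (valK m). Qed.
Arguments eliminate : simpl never.

(** Elimination keeps the remaining block congruent to the identity modulo [J], so every pivot is a
    unit. The factors are the eliminated rows and columns divided by the pivots; the sum of the
    removed terms telescopes, and after [N] steps the remainder is zero. *)
Lemma gauss_exists t : (forall i j, J (t i j - (i == j)%:R)) -> exists F K E,
  [/\ forall i j, t i j = \sum_a F i a * K a * E a j,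
      forall i j : 'I_N, (i <= j)%N -> F i j = (i == j)%:R
    & forall i j : 'I_N, (j <= i)%N -> E i j = (i == j)%:R].
Proof.
move=> Jt.
have elS := eliminateS t.
have Jel (m : nat) : (m <= N)%N -> forall i j : 'I_N, (m <= i)%N -> (m <= j)%N ->
    J (eliminate t m i j - (i == j)%:R).
  elim: m => [|m IH] mN i j mi mj; first exact: Jt.
  rewrite (elS (Ordinal mN)) /schur addrAC; apply: (ideal2B iJ).
    by apply: IH; exact: ltnW.
  apply: (ideal2Mr iJ); apply: (ideal2Mr iJ).
  have := IH (ltnW mN) i (Ordinal mN) (ltnW mi) (leqnn _).
  by rewrite -val_eqE /= (gtn_eqF mi) subr0.
pose ki (m : 'I_N) := inverse (eliminate t m m m).
have [inv1 inv2] : (forall m : 'I_N, eliminate t m m m * ki m = 1) /\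
    (forall m : 'I_N, ki m * eliminate t m m m = 1).
  have inv (m : 'I_N) : eliminate t m m m * ki m = 1 /\ ki m * eliminate t m m m = 1.
    apply: inverseP; have := Jel m (ltnW (ltn_ord m)) m m (leqnn _) (leqnn _).
    by rewrite eqxx.
  by split=> m; have [] := inv m.
have el0 (m : nat) : (m <= N)%N -> forall i j : 'I_N, (i < m)%N || (j < m)%N ->
    eliminate t m i j = 0.
  elim: m => [|m IH] mN i j; first by rewrite !ltn0.
  have {}IH := IH (ltnW mN); rewrite !ltnS (elS (Ordinal mN)).
  rewrite (leq_eqVlt i) (leq_eqVlt j) => /orP[|] /orP[/eqP e|lt].
  - by have -> : i = Ordinal mN by [apply: val_inj]; exact: schur0l (inv1 (Ordinal mN)) j.
  - by rewrite /schur /= !(IH i) ?lt // !mul0r subrr.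
  - by have -> : j = Ordinal mN by [apply: val_inj]; exact: schur0r (inv2 (Ordinal mN)) i.
  - by rewrite /schur /= !(IH _ j) ?lt ?orbT // mulr0 subrr.
exists (fun i a : 'I_N => eliminate t a i a * ki a), (fun a : 'I_N => eliminate t a a a),
  (fun a j : 'I_N => ki a * eliminate t a a j).
split=> [i j|i j|i j].
- have step (m : nat) : (m <= N)%N -> t i j = \sum_(a : 'I_N | (a < m)%N)
      eliminate t a i a * ki a * eliminate t a a a * (ki a * eliminate t a a j)
      + eliminate t m i j.
    elim: m => [|m IH] mN; first by rewrite big_pred0 ?add0r // => a; rewrite ltn0.
    rewrite (bigD1 (Ordinal mN)) //= (IH (ltnW mN)) (elS (Ordinal mN)) /schur /=.
    set x := \sum_(i0 | _) _; set y := \sum_(i0 | _) _.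
    have -> : x = y by apply: eq_bigl => a; rewrite ltnS [RHS]andbC -ltn_neqAle.
    have := inv2 (Ordinal mN); rewrite /ki /= => vu.
    by nc rules (Logic.I, vu).
  rewrite (step N (leqnn N)) el0 ?ltn_ord // addr0.
  by apply: eq_bigl => a; rewrite ltn_ord.
- rewrite leq_eqVlt => /orP[/eqP/val_inj-> |ij]; first by rewrite inv1 eqxx.
  by rewrite el0 ?ij ?(ltnW (ltn_ord j)) // mul0r -val_eqE /= (ltn_eqF ij).
rewrite leq_eqVlt => /orP[/eqP/val_inj-> |ij]; first by rewrite inv2 eqxx.
by rewrite el0 ?ij ?orbT ?(ltnW (ltn_ord i)) // mulr0 -val_eqE /= (gtn_eqF ij).
Qed.
End GaussExistence.

(** * From the defining relations to RTT relations for entries *)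

Section PmxProducts.
Variables (S : pzRingType) (N : nat).
Implicit Types (M : 'M[S]_(N * N)) (r w : S).
Local Notation idx i k := (mxtens_index (i, k)).

Lemma mulmx_single (M M' : 'M[S]_(N * N)) x y a b :
  (forall c d, c != a \/ d != b -> M x (idx c d) * M' (idx c d) y = 0) ->
  (M *m M') x y = M x (idx a b) * M' (idx a b) y.
Proof.
move=> F0; rewrite mxE (bigD1 (idx a b)) //= big1 ?addr0 // => z.
rewrite -[z]mxtens_unindexK; case: (mxtens_unindex z) => c d ne; apply: F0.
have [ca|] := eqVneq c a; last by left.
by right; apply/eqP => db; case/eqP: ne; rewrite ca db.
Qed.

Lemma Pmx_mull M i k b : (Pmx N S *m M) (idx i k) b = M (idx k i) b.
Proof.
rewrite !mxE (bigD1 (idx k i)) //= big1 => [|z zN]; rewrite mxE !mxtens_indexK.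
  by rewrite eqxx mul1r addr0.
case: eqP => [e|_]; last by rewrite mul0r.
case/negP: zN; rewrite -[z]mxtens_unindexK; case: (mxtens_unindex z) e => a b' [-> ->].
exact: eqxx.
Qed.

Lemma Rmx_mull M r w i k b :
  ((r%:M + w *: Pmx N S) *m M) (idx i k) b = r * M (idx i k) b + w * M (idx k i) b.
Proof. by rewrite mulmxDl mul_scalar_mx -scalemxAl mxE [X in X + _]mxE [X in _ + X]mxE Pmx_mull. Qed.

Lemma Rmx_mulr M r w a j l :
  (M *m (r%:M + w *: Pmx N S)) a (idx j l) = M a (idx j l) * r + M a (idx l j) * w.
Proof.
rewrite mulmxDr mxE; congr (_ + _); rewrite mxE.
  rewrite (bigD1 (idx j l)) //= big1 => [|z zN]; rewrite mxE.
    by rewrite eqxx addr0.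
  by rewrite (negPf zN) mulr0.
rewrite (bigD1 (idx l j)) //= big1 => [|z zN]; rewrite !mxE !mxtens_indexK.
  by rewrite eqxx mulr1 addr0.
case: eqP => [e|_]; last by rewrite !mulr0.
by case/negP: zN; rewrite -[z]mxtens_unindexK e.
Qed.

Lemma defectE (A B R0 R1 : 'M[S]_(N * N)) r w r' w' (f g : 'I_N -> 'I_N -> S) i j k l :
  R0 = r%:M + w *: Pmx N S -> R1 = r'%:M + w' *: Pmx N S ->
  (forall i j k l, (A *m B) (idx i k) (idx j l) = f i j * g k l) ->
  (forall i j k l, (B *m A) (idx i k) (idx j l) = g k l * f i j) ->
  (R0 *m A *m B - B *m A *m R1) (idx i k) (idx j l)
  = r * (f i j * g k l) + w * (f k j * g i l) - (g k l * f i j * r' + g k j * f i l * w').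
Proof.
move=> -> -> AB BA; rewrite -mulmxA mxE [X in _ + X]mxE Rmx_mull Rmx_mulr.
by rewrite !AB !BA.
Qed.
End PmxProducts.

Section RttEntries.
Variables (N : nat) (D : pzRingType) (hb : D) (t : 'I_N -> 'I_N -> int -> D) (c4 : D).
Hypothesis chb : central hb.
Local Notation idx i k := (mxtens_index (i, k)).
Local Notation T s := (Tmx hb t s).
Local Notation q s s' := (fpsC (fpsC hb) * wden D s s').

Lemma T1E s i k j l : T1 hb t s (idx i k) (idx j l) = fst_var (T s i j) * (k == l)%:R.
Proof. by rewrite [LHS]mxE [X in X * _]mxE [X in _ * X]mxE !mxtens_indexK. Qed.
Lemma T2E s i k j l : T2 hb t s (idx i k) (idx j l) = (i == j)%:R * snd_var (T s k l).
Proof. by rewrite [LHS]mxE [X in X * _]mxE [X in _ * X]mxE !mxtens_indexK. Qed.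

Lemma T12E s s' i j k l : (T1 hb t s *m T2 hb t s') (idx i k) (idx j l)
  = fst_var (T s i j) * snd_var (T s' k l).
Proof.
rewrite (mulmx_single _ (a := j) (b := k)) => [|c d cd].
  by rewrite (congr2 *%R (T1E s i k j k) (T2E s' j k j l)) !eqxx mulr1 mul1r.
rewrite (congr2 *%R (T1E s i k c d) (T2E s' c d j l)).
case: cd => /negPf ne; last by rewrite eq_sym ne mulr0 mul0r.
by rewrite ne mul0r mulr0.
Qed.

Lemma T21E s s' i j k l : (T2 hb t s' *m T1 hb t s) (idx i k) (idx j l)
  = snd_var (T s' k l) * fst_var (T s i j).
Proof.
rewrite (mulmx_single _ (a := i) (b := l)) => [|c d cd].
  by rewrite (congr2 *%R (T2E s' i k i l) (T1E s i l j l)) !eqxx mulr1 mul1r.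
rewrite (congr2 *%R (T2E s' i k c d) (T1E s c d j l)).
case: cd => /negPf ne; first by rewrite eq_sym ne !mul0r.
by rewrite ne !mulr0.
Qed.

Definition rtt_entry (r w r' w' : fps (fps D)) s s' i j k l :=
  r * (fst_var (T s i j) * snd_var (T s' k l)) + w * (fst_var (T s k j) * snd_var (T s' i l))
  - (snd_var (T s' k l) * fst_var (T s i j) * r' + snd_var (T s' k j) * fst_var (T s i l) * w').

Lemma RTTnumE (s : bool) : RTnum N hb s = (pdiff D s s)%:M + q s s *: Pmx N (fps (fps D)).
Proof.
rewrite /RTnum /pdiff /wden /unum /uden; case: s.
  by rewrite mul1r [snd_var 1]rmorph1 mulr1 mulrA.
by rewrite [snd_var 1]rmorph1 mulr1 !mul1r mulr1.
Qed.

Lemma central_q s s' : central (q s s').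
Proof. by apply: centralM; [do 2! apply: central_fpsC|exact: central_wden]. Qed.

Lemma RTTdefect_sameE s i j k l : RTTdefect_same hb t s (idx i k) (idx j l)
  = rtt_entry (pdiff D s s) (q s s) (pdiff D s s) (q s s) s s i j k l.
Proof.
exact: (defectE i j k l (RTTnumE s) (RTTnumE s)
  (fun i j k l => T12E s s i j k l) (fun i j k l => T21E s s i j k l)).
Qed.

Lemma central_invdiff (a : D) : central a -> central (invdiff a).
Proof.
move=> ca z; apply: fpsP => m.
have ci n : central ((invdiff a)``_n).
  case: n => [|n] /=; first by move=> x; rewrite mul0r mulr0.
  by apply: central_exp; apply: centralB; [exact: central_fpsX|exact: central_fpsC].
have -> : (z * invdiff a)``_m = (fps_mul z (invdiff a))``_m by [].
rewrite fps_mul_rev fcoefM; apply: eq_bigr => n _; exact: ci.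
Qed.

Lemma RTTdefect_mixedE i j k l :
  let g a : fps (fps D) := fpsC (fpsC hb) * invdiff (a + hb) in
  RTTdefect_mixed hb t c4 (idx i k) (idx j l)
  = rtt_entry (1 - g (- (c4 + c4))) (g (- (c4 + c4))) (1 - g (c4 + c4)) (g (c4 + c4))
      true false i j k l.
Proof.
move=> g; exact: (defectE i j k l erefl erefl
  (fun i j k l => T12E true false i j k l) (fun i j k l => T21E true false i j k l)).
Qed.
End RttEntries.

Lemma map_unum (D D' : pzRingType) (phi : {rmorphism D -> D'}) s :
  fps_map phi (unum D s) = unum D' s.
Proof. by case: s; rewrite ?rmorph1 ?fps_mapX. Qed.
Lemma map_uden (D D' : pzRingType) (phi : {rmorphism D -> D'}) s :
  fps_map phi (uden D s) = uden D' s.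
Proof. by case: s; rewrite ?rmorph1 ?fps_mapX. Qed.

Section RttTransfer.
Variables (N : nat) (D D' : pzRingType) (rho : {rmorphism D -> D'}).
Variables (hb : D) (t : 'I_N -> 'I_N -> int -> D) (c4 : D).
Local Notation Phi := (fps_map (fps_map rho)).

Lemma Tmx_map s i j : fps_map rho (Tmx hb t s i j) = Tmx (rho hb) (fun i j k => rho (t i j k)) s i j.
Proof.
apply: fpsP => m; rewrite !mxE /=; case: s => /=.
  by case: m => [|m]; rewrite ?rmorph_nat // rmorphN rmorphM.
by rewrite rmorphD rmorphM rmorph_nat.
Qed.

Lemma Phi_fst f : Phi (fst_var f) = fst_var (fps_map rho f).
Proof. by apply: fpsP => m; apply: fpsP => -[|n] //=; rewrite rmorph0. Qed.
Lemma Phi_snd f : Phi (snd_var f) = snd_var (fps_map rho f).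
Proof. exact: fps_mapC. Qed.
Lemma Phi_C a : Phi (fpsC (fpsC a)) = fpsC (fpsC (rho a)).
Proof. by rewrite [LHS]fps_mapC; congr fpsC; exact: fps_mapC. Qed.
Lemma Phi_unum s : Phi (unum (fps D) s) = unum (fps D') s. Proof. exact: map_unum. Qed.
Lemma Phi_uden s : Phi (uden (fps D) s) = uden (fps D') s. Proof. exact: map_uden. Qed.
Lemma Phi_pdiff s s' : Phi (pdiff D s s') = pdiff D' s s'.
Proof.
by rewrite /pdiff rmorphB !rmorphM /= !Phi_snd Phi_unum Phi_uden map_unum map_uden.
Qed.
Lemma Phi_wden s s' : Phi (wden D s s') = wden D' s s'.
Proof. by rewrite /wden rmorphM /= Phi_snd Phi_uden map_uden. Qed.
Lemma Phi_invdiff a : Phi (invdiff a) = invdiff (rho a).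
Proof.
apply: fpsP => -[|m] /=; first exact: rmorph0.
by rewrite rmorphXn rmorphB; congr ((_ - _) ^+ _); [exact: fps_mapX|exact: fps_mapC].
Qed.

Lemma Phi_eq0 Z : (forall m n, rho Z``_m``_n = 0) -> Phi Z = 0.
Proof.
by move=> h; apply: fpsP => m; apply: fpsP => n; rewrite fcoef0 fcoef0 /= h.
Qed.

Lemma Phi_rtt_entry r w r' w' s s' i j k l :
  Phi (rtt_entry hb t r w r' w' s s' i j k l)
  = rtt_entry (rho hb) (fun i j k => rho (t i j k)) (Phi r) (Phi w) (Phi r') (Phi w') s s' i j k l.
Proof.
by rewrite /rtt_entry rmorphB !rmorphD !rmorphM /= !Phi_fst !Phi_snd !Tmx_map.
Qed.
End RttTransfer.

(** The identity (u - v + hbar) (u - v + hbar)^-1 = 1, multiplied by u^-1. *)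
Lemma pdiff_invdiff (D : pzRingType) (hb : D) :
  (pdiff D true false + fpsC (fpsC hb) * wden D true false) * invdiff hb = uden _ true.
Proof.
rewrite /pdiff /wden /unum /uden [snd_var 1]rmorph1 !mulr1.
apply: fpsP => m.
rewrite mulrDl mulrBl mul1r -!mulrA fcoefD fcoefB fcoefCM !fcoefXM.
case: m => [|m]; first by rewrite mulr0 subrr addr0.
rewrite fcoefCM; case: m => [|m] /=; first by rewrite !mulr0 expr0 subr0 addr0.
by rewrite exprS mulrBl addrAC subrK subrr.
Qed.

Section RttDefect.
Variables (N : nat) (D D' : pzRingType) (rho : {rmorphism D -> D'}).
Variables (hb c c4 : D) (t : 'I_N -> 'I_N -> int -> D).
Hypothesis chb' : central (rho hb).
Hypothesis rel0 : forall x, RTTrels hb t c c4 x -> rho x = 0.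
Hypothesis c40 : rho c4 = 0.
Local Notation T := (Tmx (rho hb) (fun i j k => rho (t i j k))).
Local Notation q s s' := (fpsC (fpsC (rho hb)) * wden D' s s').

Lemma rtt_entry0 r w s s' i j k l : central r -> central w ->
  rtt_entry (rho hb) (fun i j k => rho (t i j k)) r w r w s s' i j k l = 0 ->
  r * (fst_var (T s i j) * snd_var (T s' k l) - snd_var (T s' k l) * fst_var (T s i j))
  = w * (snd_var (T s' k j) * fst_var (T s i l) - fst_var (T s k j) * snd_var (T s' i l)).
Proof.
move=> cr cw e; apply/eqP; rewrite -subr_eq0; apply/eqP; rewrite -[RHS]e /rtt_entry.
by nc central (Logic.I, cr, cw).
Qed.

Lemma rtt_same s i j k l :
  pdiff D' s s * (fst_var (T s i j) * snd_var (T s k l) - snd_var (T s k l) * fst_var (T s i j))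
  = q s s * (snd_var (T s k j) * fst_var (T s i l) - fst_var (T s k j) * snd_var (T s i l)).
Proof.
apply: rtt_entry0; [exact: central_pdiff|exact: central_q|].
have := @Phi_rtt_entry _ _ _ rho hb t (pdiff D s s) (fpsC (fpsC hb) * wden D s s)
  (pdiff D s s) (fpsC (fpsC hb) * wden D s s) s s i j k l.
rewrite -RTTdefect_sameE // rmorphM /= Phi_pdiff Phi_wden Phi_C => <-.
apply: Phi_eq0 => m n; apply: rel0; left; right; exists s.
by exists (mxtens_index (i, k)), (mxtens_index (j, l)), m, n.
Qed.

(** With c = 0 both sides carry the same R = (1 - g) + g P, where g = hbar / (u - v + hbar).
    Multiplying by the homogenized u - v + hbar turns 1 - g into the homogenized u - v and g into
    hbar, as in the relations of equal signs. *)
Lemma rtt_mixed i j k l :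
  pdiff D' true false * (fst_var (T true i j) * snd_var (T false k l)
                         - snd_var (T false k l) * fst_var (T true i j))
  = q true false * (snd_var (T false k j) * fst_var (T true i l)
                    - fst_var (T true k j) * snd_var (T false i l)).
Proof.
pose g := fpsC (fpsC (rho hb)) * invdiff (rho hb).
have cg : central g.
  by apply: centralM; [do 2! apply: central_fpsC|exact: central_invdiff].
have cg1 : central (1 - g) by apply: centralB => // x; rewrite mul1r mulr1.
have gE : (pdiff D' true false + q true false) * g = q true false.
  have cC : central (fpsC (fpsC (rho hb))) by do 2! apply: central_fpsC.
  rewrite /g mulrA -[_ * fpsC (fpsC _)]cC -mulrA pdiff_invdiff.
  by rewrite /wden [snd_var (uden _ false)]rmorph1 mulr1.
have pE : (pdiff D' true false + q true false) * (1 - g) = pdiff D' true false.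
  by rewrite mulrBr gE mulr1 addrK.
rewrite -{1}pE -{2}gE -[LHS]mulrA -[RHS]mulrA; congr (_ * _).
apply: rtt_entry0 => //.
have := @Phi_rtt_entry _ _ _ rho hb t (1 - fpsC (fpsC hb) * invdiff (- (c4 + c4) + hb))
  (fpsC (fpsC hb) * invdiff (- (c4 + c4) + hb))
  (1 - fpsC (fpsC hb) * invdiff (c4 + c4 + hb))
  (fpsC (fpsC hb) * invdiff (c4 + c4 + hb)) true false i j k l.
rewrite -RTTdefect_mixedE // !rmorphB !rmorphM !rmorph1 /= !Phi_invdiff !Phi_C.
rewrite !rmorphD !rmorphN !rmorphD c40 !addr0 oppr0 !add0r => <-.
apply: Phi_eq0 => m n; apply: rel0; right.
by exists (mxtens_index (i, k)), (mxtens_index (j, l)), m, n.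
Qed.
End RttDefect.

(* The two right-hand sides differ by [q] times [S' = S i l k j], where
   [S i j k l] is the sum of the commutators of [t i j, s k l] and [t k l, s i j]:
   [p * S = - q * S'] and [p * S' = - q * S] give [S = 0]. *)
Lemma rtt_of_form1 (A : pzRingType) I (p q : A) (t s : I -> I -> A) :
  central p -> central q -> nonzerodiv (p + q) -> nonzerodiv (p - q) ->
  (forall i j k l, p * (t i j * s k l - s k l * t i j)
                   = q * (s k j * t i l - t k j * s i l)) -> rtt p q t s.
Proof.
move=> cp cq rpq rpq' h; split=> // i j k l.
pose S i j k l := t i j * s k l - s k l * t i j + (t k l * s i j - s i j * t k l).
have e j' l' : p * S i j' k l' = - (q * S i l' k j').
  by rewrite /S mulrDr !h; nc central (Logic.I, cq).
have z1 : S i j k l + S i l k j = 0.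
  by apply: rpq; rewrite mulrDr !mulrDl !e; nc.
have z2 : S i l k j = 0.
  apply: rpq'; rewrite mulrBl e; transitivity (- (q * (S i j k l + S i l k j))); first by nc.
  by rewrite z1 mulr0 oppr0.
rewrite h; apply/eqP; rewrite -subr_eq0 -mulrBr; apply/eqP.
rewrite -[RHS](mulr0 (- q)) -z2 /S; nc.
Qed.

Section RttAll.
Variables (N : nat) (D D' : pzRingType) (rho : {rmorphism D -> D'}).
Variables (hb c c4 : D) (t : 'I_N -> 'I_N -> int -> D).
Hypotheses (chb' : central (rho hb)) (rhb' : nonzerodiv (rho hb)).
Hypothesis rel0 : forall x, RTTrels hb t c c4 x -> rho x = 0.
Hypothesis c40 : rho c4 = 0.
Local Notation T := (Tmx (rho hb) (fun i j k => rho (t i j k))).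
Local Notation q s s' := (fpsC (fpsC (rho hb)) * wden D' s s').

Definition form1 s s' := forall i j k l,
  pdiff D' s s' * (fst_var (T s i j) * snd_var (T s' k l) - snd_var (T s' k l) * fst_var (T s i j))
  = q s s' * (snd_var (T s' k j) * fst_var (T s i l) - fst_var (T s k j) * snd_var (T s' i l)).

Lemma form1_rtt s s' : form1 s s' ->
  rtt (pdiff D' s s') (q s s') (fun i j => fst_var (T s i j)) (fun i j => snd_var (T s' i j)).
Proof.
apply: rtt_of_form1.
- exact: central_pdiff.
- exact: central_q.
- exact: nonzerodiv_pdiff (or_intror rhb').
- have := @nonzerodiv_pdiff D' s s' (- rho hb) (or_intror (nonzerodivN rhb')).
  by rewrite !rmorphN mulNr.
Qed.

Lemma RTT_signs s s' :
  rtt (pdiff D' s s') (q s s') (fun i j => fst_var (T s i j)) (fun i j => snd_var (T s' i j)).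
Proof.
apply: form1_rtt; have TF : form1 true false by move=> *; exact: (rtt_mixed chb' rel0 c40).
case: s s' => -[] //; try by move=> *; exact: (rtt_same chb' rel0).
(* The signs (-, +) remain: this is the mixed relation with the variables exchanged, obtained by
   comparing modes with its second form. *)
move=> k l i j; apply/pdiff_wdenP => m n.
have /pdiff_wdenP := (form1_rtt TF).2 i j k l; move/(_ n m).
rewrite !mode2B !mode2_fs !mode2_sf => E.
by rewrite -E; nc.
Qed.
End RttAll.

(** * The double Yangian at c = 0 *)

Lemma malgC_central (K : monomType) (R : comNzRingType) (c : R) :
  central (c%:MP : {malg R[K]}).
Proof.
move=> g; rewrite !malgM_def fgmulUg fgmulgU; apply: eq_bigr => k _.
by rewrite mul1m mulm1 mulrC.
Qed.

Section Constants.
Variables (R : realType) (N : nat).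

Fact FA_scal_zmod : zmod_morphism (@FA_scal R N).
Proof. by move=> x y; rewrite /FA_scal !raddfB. Qed.
Fact FA_scal_monoid : monoid_morphism (@FA_scal R N).
Proof.
split=> [|x y]; rewrite /FA_scal; first by rewrite mpolyC1E.
by rewrite mpolyCM [LHS](rmorphM (@fpsC _)).
Qed.
HB.instance Definition _ := GRing.isZmodMorphism.Build _ _ (@FA_scal R N) FA_scal_zmod.
HB.instance Definition _ := GRing.isMonoidMorphism.Build _ _ (@FA_scal R N) FA_scal_monoid.
Fact FA_to_DYgl_zmod : zmod_morphism (@FA_to_DYgl R N).
Proof. exact: topproj_zmod. Qed.
Fact FA_to_DYgl_monoid : monoid_morphism (@FA_to_DYgl R N).
Proof. exact: topproj_monoid. Qed.
HB.instance Definition _ := GRing.isZmodMorphism.Build _ _ (@FA_to_DYgl R N) FA_to_DYgl_zmod.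
HB.instance Definition _ := GRing.isMonoidMorphism.Build _ _ (@FA_to_DYgl R N) FA_to_DYgl_monoid.
Fact to_DY0_zmod : zmod_morphism (@to_DY0 R N).
Proof. exact: topproj_zmod. Qed.
Fact to_DY0_monoid : monoid_morphism (@to_DY0 R N).
Proof. exact: topproj_monoid. Qed.
HB.instance Definition _ := GRing.isZmodMorphism.Build _ _ (@to_DY0 R N) to_DY0_zmod.
HB.instance Definition _ := GRing.isMonoidMorphism.Build _ _ (@to_DY0 R N) to_DY0_monoid.
HB.instance Definition _ := GRing.RMorphism.copy (@scal R N) (@FA_to_DYgl R N \o @FA_scal R N).
HB.instance Definition _ := GRing.RMorphism.copy (@scal0 R N) (@to_DY0 R N \o @scal R N).

Lemma central_FA_hb : central (FA_hb R N). Proof. exact: central_fpsX. Qed.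
Lemma central_FA_scal z : central (@FA_scal R N z).
Proof. by apply: central_fpsC; exact: malgC_central. Qed.
Lemma central_hb : central (hb R N). Proof. exact: topquot_central central_FA_hb. Qed.
Lemma central_scal z : central (@scal R N z).
Proof. apply: topquot_central; exact: central_FA_scal. Qed.
Lemma central_hb0 : central (hb0 R N). Proof. exact: topquot_central central_hb. Qed.
Lemma central_scal0 z : central (@scal0 R N z).
Proof. apply: topquot_central; exact: central_scal. Qed.

Lemma regular_hb0 : nonzerodiv (hb0 R N). Proof. exact: topquot_regular. Qed.
Lemma separated_hb : separated (hb R N). Proof. exact: topquot_separated. Qed.
Lemma separated_hb0 : separated (hb0 R N). Proof. exact: topquot_separated. Qed.
Lemma complete_hb : complete (hb R N). Proof. apply: topquot_complete; exact: fps_complete. Qed.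

Lemma to_DY0_cc : to_DY0 (cc R N) = 0. Proof. exact: topproj_rel. Qed.
Lemma to_DY0_c4 : to_DY0 (c4 R N) = 0.
Proof. by rewrite /c4 rmorphM /= to_DY0_cc mulr0. Qed.

Local Notation rho := (@to_DY0 R N \o @FA_to_DYgl R N).

Lemma RTT_DY0 s s' :
  rtt (pdiff (DY0 R N) s s') (fpsC (fpsC (hb0 R N)) * wden _ s s')
   (fun i j => fst_var (fps_map (@to_DY0 R N) (Tgl R N s i j)))
   (fun i j => snd_var (fps_map (@to_DY0 R N) (Tgl R N s' i j))).
Proof.
have rel0 x : RTTrels (FA_hb R N) (@FA_t R N) (FA_c R N) (FA_scal N (4%:R^-1) * FA_hb R N * FA_c R N) x -> rho x = 0.
  by move=> Sx; rewrite /= /FA_to_DYgl (topproj_rel _ Sx) rmorph0.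
have c40 : rho (FA_scal N (4%:R^-1) * FA_hb R N * FA_c R N) = 0.
  have e x : rho (x * FA_c R N) = to_DY0 (FA_to_DYgl x) * to_DY0 (cc R N).
    by rewrite [LHS](rmorphM rho).
  by rewrite e to_DY0_cc mulr0.
have h := @RTT_signs N _ _ rho (FA_hb R N) _ _ _ central_hb0 regular_hb0 rel0 c40 s s'.
pose T := Tmx (hb0 R N) (fun i j k => rho (FA_t R i j k)).
have e b i j : fps_map (@to_DY0 R N) (Tgl R N b i j) = T b i j.
  exact: (Tmx_map (@to_DY0 R N) (hb R N) (@tgl R N) b i j).
by split=> i j k l; rewrite !e; [exact: h.1|exact: h.2].
Qed.
End Constants.

Lemma mul_mx_diagE (A : pzRingType) N (F E : 'M[A]_N) (K : 'rV[A]_N) i j :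
  (F *m diag_mx K *m E) i j = \sum_a F i a * K 0 a * E a j.
Proof. by rewrite mxE; apply: eq_bigr => a _; rewrite mul_mx_diag mxE. Qed.

(** * The Gauss decomposition in the double Yangian *)

Section GaussDYgl.
Variables (R : realType) (N : nat).
Local Notation D := (DYgl R N).
Local Notation hb := (hb R N).
Local Notation Hb := (fpsC hb : fps D).

Definition hb_multiple (f : fps D) := exists g, f = Hb * g.

Lemma central_Hb : central Hb. Proof. exact: central_fpsC (@central_hb R N). Qed.

Lemma hb_multiple_ideal : ideal2 hb_multiple.
Proof.
split=> [|u v [a ->] [b ->]|u v [a ->]|u v [a ->]].
- by exists 0; rewrite mulr0.
- by exists (a - b); rewrite mulrBr.
- by exists (u * a); rewrite mulrA -central_Hb mulrA.
- by exists (a * v); rewrite mulrA.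
Qed.

Lemma hb_multiple_unit (x : fps D) : hb_multiple (x - 1) -> exists z, x * z = 1 /\ z * x = 1.
Proof.
case=> g e; have -> : x = 1 + Hb * g by rewrite -e addrC subrK.
apply: one_plus_unit; first exact: central_Hb.
  by apply: fps_separated; exact: separated_hb.
by apply: fps_hb_complete; exact: complete_hb.
Qed.

Lemma fcoef_nat (A : pzRingType) (b : bool) m : (b%:R : fps A)``_m = ((m == 0%N) && b)%:R.
Proof. by case: b; rewrite ?fcoef1 ?fcoef0 ?andbT ?andbF. Qed.

Lemma Tgl_unipotent s i j : hb_multiple (Tgl R N s i j - (i == j)%:R).
Proof.
exists (Fps (fun m => if s then (if m is p.+1 then - tgl R i j (Posz p) else 0)
  else tgl R i j (Negz m))).
apply: fpsP => m; rewrite fcoefB fcoefCM fcoef_nat mxE /=.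
case: s; last by rewrite addrAC subrr add0r.
by case: m => [|m] /=; rewrite ?subrr ?mulr0 // subr0 mulrN.
Qed.

Lemma gaussP s : is_gauss (Tgl R N s) (gauss R N s).
Proof.
apply: xgetPex.
have [F [K [E [h hF hE]]]] := gauss_exists hb_multiple_ideal hb_multiple_unit (Tgl_unipotent s).
exists (\matrix_(i, j) F i j, \row_j K j, \matrix_(i, j) E i j); split.
- apply/matrixP => i j; rewrite mul_mx_diagE h.
  by apply: eq_bigr => a _; rewrite !mxE.
- by move=> i j ij; rewrite mxE hF.
- by move=> i j ij; rewrite mxE hE.
Qed.

Lemma gauss_spec s : [/\ Tgl R N s = Fgl R N s *m diag_mx (Kgl R N s) *m Egl R N s,
  forall i j : 'I_N, (i <= j)%N -> Fgl R N s i j = (i == j)%:R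
  & forall i j : 'I_N, (j <= i)%N -> Egl R N s i j = (i == j)%:R].
Proof. by have := gaussP s; rewrite /Fgl /Kgl /Egl; case: (gauss R N s) => -[F K] E. Qed.

Lemma Tgl_sum s i j : Tgl R N s i j = \sum_a Fgl R N s i a * Kgl R N s 0 a * Egl R N s a j.
Proof. by have [-> _ _] := gauss_spec s; exact: mul_mx_diagE. Qed.

Lemma gauss_unipotent s :
  [/\ forall m, hb_multiple (Kgl R N s 0 m - 1),
      forall i j, hb_multiple (Egl R N s i j - (i == j)%:R)
    & forall i j, hb_multiple (Fgl R N s i j - (i == j)%:R)].
Proof.
have [_ hF hE] := gauss_spec s.
apply: gauss_triangular_mod hb_multiple_ideal _ (Tgl_sum s) hF hE (Tgl_unipotent s).
move=> m; exact: hb_multiple_unit.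
Qed.

Lemma series_invP (x : fps D) : hb_multiple (x - 1) ->
  x * series_inv x = 1 /\ series_inv x * x = 1.
Proof.
move=> /hb_multiple_unit [z hz].
exact: (@xgetPex _ 0 [set g | x * g = 1 /\ g * x = 1]%classic (ex_intro _ z hz)).
Qed.

Lemma gauss_dec s : gaussdec (Tgl R N s) (Fgl R N s) (Kgl R N s 0)
  (fun a => series_inv (Kgl R N s 0 a)) (Egl R N s).
Proof.
have [_ hF hE] := gauss_spec s; have [hK _ _] := gauss_unipotent s.
split=> //; first exact: Tgl_sum.
  by move=> a; exact: (series_invP (hK a)).1.
by move=> a; exact: (series_invP (hK a)).2.
Qed.

(** The factors are chosen before setting c to 0, as in the definition of the currents, and then
    mapped to the quotient, where the map preserves the decomposition. *)
Definition fam s := gaussfam_map (fps_map (@to_DY0 R N)) (GaussFam (gauss_dec s)).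

Lemma fam0 i j : (gT (fam true) i j)``_0 = (i == j)%:R.
Proof. by rewrite /= mxE rmorph_nat. Qed.
End GaussDYgl.

Lemma mode_map (D D' : pzRingType) (rho : {rmorphism D -> D'}) s f k :
  mode s (fps_map rho f) k = rho (mode s f k).
Proof. by rewrite /mode; case: ifP => // _; rewrite rmorph0. Qed.

Lemma shifted_map (D D' : pzRingType) (rho : {rmorphism D -> D'}) hb a x x' :
  shifted hb a x x' -> shifted (rho hb) (rho a) (rho \o x) (rho \o x').
Proof.
move=> h k n; have [y e] := h k n; exists (rho y).
rewrite -rmorphXn -rmorphM -e rmorphB; congr (_ - _).
rewrite rmorph_sum; apply: eq_bigr => j _.
by rewrite rmorphMz rmorphM rmorphXn rmorphN.
Qed.

Lemma centralCA (D : pzRingType) (h x y : D) : central h -> x * h * y = h * (x * y).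
Proof. by move=> ch; rewrite -ch mulrA. Qed.

Lemma mode_shifted_map (D D' : pzRingType) (rho : {rmorphism D -> D'}) hb a s (g g' : fps D) :
  shifted hb a (mode s g) (mode s g') ->
  shifted (rho hb) (rho a) (mode s (fps_map rho g)) (mode s (fps_map rho g')).
Proof.
move=> h k n; have := shifted_map rho h k n; rewrite mode_map; congr congh.
by apply: eq_bigr => j _; rewrite mode_map.
Qed.

Lemma shifted_congh1 (D : pzRingType) (hb : D) a x x' k :
  shifted hb a x x' -> congh hb 1 (x' k) (x k).
Proof.
move/(_ k 1%N); congr congh.
by rewrite /shift_sum big_ord_recl big_ord0 addr0 binz0 expr0 mul1r subr0.
Qed.

Section Shifts.
Variables (R : realType) (N : nat).
Local Notation D := (DYgl R N).
Local Notation hb := (hb R N).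
Local Notation hb0 := (hb0 R N).
Local Notation pi := (@to_DY0 R N).

Lemma hlimP (w d : nat -> D) : (forall n, w n = \sum_(j < n) hb ^+ j * d j) ->
  forall n, congh hb n (hlim w) (w n).
Proof.
move=> wE; have [l hl] := complete_hb d.
have {}hl n : congh hb n l (w n) by rewrite wE.
pose S := [set l | forall n, exists m0, forall m, (m0 <= m)%N ->
    exists y, l - w m = hb ^+ n * y]%classic.
have Sl : S l by move=> n; exists n => m nm; exact: congh_leq nm (hl m).
have S' : S (hlim w) := @xgetPex _ 0 S (ex_intro _ l Sl).
suff -> : hlim w = l by [].
(* The limit picked by [hlim] is the one given by completeness, since two limits agree modulo every
   power of hbar. *)
apply: (congh_eq (@separated_hb R N)) => n; have [m0 h] := S' n.
apply: congh_trans (h _ (leq_maxl m0 n)) _.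
exact: congh_sym (congh_leq (leq_maxr m0 n) (hl _)).
Qed.

Lemma shift_shifted s (a : D) (g : fps D) : (exists b, a = hb * b) ->
  shifted hb a (mode s g) (mode s (shift s a g)).
Proof.
move=> [b ab]; case: s.
  by apply: shifted_series_plus (ex_intro _ b ab) _; first exact: central_hb.
apply: shifted_series_minus => m n /=.
apply: (@hlimP _ (fun j => (b ^+ j * g``_(m + j)) *+ 'C(m + j, m))) => {}n.
apply: eq_bigr => j _; rewrite ab exprMn_comm; last exact: central_hb.
by rewrite mulrnAr mulrA.
Qed.

Lemma shift_DY0 s (a : D) (g : fps D) : (exists b, a = hb * b) ->
  shifted hb0 (pi a) (mode s (fps_map pi g)) (mode s (fps_map pi (shift s a g))).
Proof.
move=> ha; exact: (mode_shifted_map pi (shift_shifted s g ha)).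
Qed.

Lemma shift_congh1 s (a : D) (g : fps D) k : (exists b, a = hb * b) ->
  congh hb 1 (mode s (shift s a g) k) (mode s g k).
Proof. by move=> ha; exact: shifted_congh1 (shift_shifted s g ha). Qed.

Lemma hdivP (x : D) : (exists y, x = hb * y) -> hb * hdiv x = x.
Proof. by case=> y e; exact: (@xgetPex _ 0 [set y | hb * y = x]%classic (ex_intro _ y (esym e))). Qed.

Lemma mode_hb_multiple s (f : fps D) k : hb_multiple f -> exists y, mode s f k = hb * y.
Proof. by case=> g ->; exists (mode s g k); rewrite modeCM. Qed.

Lemma congh1_0 (x y : D) : congh hb 1 x y -> (exists z, y = hb * z) -> exists z, x = hb * z.
Proof.
by case=> u e [z yz]; exists (u + z); rewrite mulrDr -yz -[u]mul1r; move: e; rewrite expr1 mul1r => <-; rewrite subrK.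
Qed.

Lemma c4_multiple s : exists b, (if s then c4 R N else - c4 R N) = hb * b.
Proof.
have e : c4 R N = hb * (scal N (4%:R^-1) * cc R N) := centralCA _ _ (@central_hb R N).
by case: s; [exists (scal N (4%:R^-1) * cc R N)|exists (- (scal N (4%:R^-1) * cc R N)); rewrite e mulrN].
Qed.

Lemma hshift_multiple (i : 'I_N.-1) : exists b, hshift R i = hb * b.
Proof. by exists (scal N ((i.+1)%:R / 2%:R)); exact: esym (central_hb _). Qed.

Definition sh (i : 'I_N.-1) : DY0 R N := scal0 N ((i.+1)%:R / 2%:R) * hb0.

Lemma sh_hshift i : pi (hshift R i) = sh i.
Proof. exact: rmorphM. Qed.

(** The inner shift by a multiple of c becomes a shift by 0 at c = 0, so only the shift by hbar (i +
    1) / 2 is left, [i] being counted from 0. *)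
Lemma double_shift_DY0 s (a : D) (g : fps D) (i : 'I_N.-1) :
  pi a = 0 -> (exists b, a = hb * b) ->
  shifted hb0 (sh i) (mode s (fps_map pi g)) (mode s (fps_map pi (shift s (hshift R i) (shift s a g)))).
Proof.
move=> a0 ha; rewrite -sh_hshift.
have h := shift_DY0 s (shift s a g) (hshift_multiple i); apply: shifted_ext h.
by apply: (shifted_id (@separated_hb0 R N)); rewrite -a0; exact: shift_DY0.
Qed.

(** A shift by a multiple of hbar changes nothing modulo hbar. Hence the [hdiv] in the definition of
    the currents acts on elements that are divisible, not on its default value. *)
Lemma double_shift_multiple s (a : D) (g : fps D) (i : 'I_N.-1) k :
  (exists b, a = hb * b) -> hb_multiple g ->
  exists y, mode s (shift s (hshift R i) (shift s a g)) k = hb * y.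
Proof.
move=> ha hg; apply: congh1_0 (shift_congh1 s _ k (hshift_multiple i)) _.
by apply: congh1_0 (shift_congh1 s _ k ha) _; exact: mode_hb_multiple.
Qed.
End Shifts.

(** * Relations between the normalized components *)

Definition farn N (i j : 'I_N.-1) := (i.+1 < j)%N || (j.+1 < i)%N.

Lemma cartan_spec N (i j : 'I_N.-1) :
  cartan i j = if i == j then 2 else if after i j || after j i then -1 else 0.
Proof. by []. Qed.

Lemma far_cartan0 N (i j : 'I_N.-1) : farn i j -> cartan i j = 0.
Proof. by rewrite /farn cartan_spec; case: (nodeP i j) => [-> | /(congr1 val) /= | /(congr1 val) /= |] //; lia. Qed.

Lemma nonfar_cases N (i j : 'I_N.-1) : farn i j \/ [|| i == j, after i j | after j i].
Proof. by rewrite /farn; case: (nodeP i j) => [_|_|_|->]; rewrite ?orbT; [right|right|right|left]. Qed.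

Section ShiftMore.
Variables (D : pzRingType) (hb : D).
Hypotheses (chb : central hb) (sep : separated hb) (rhb : nonzerodiv hb).

Lemma hb_cancel (x y : D) : hb * x = hb * y -> x = y.
Proof. by move=> e; apply/eqP; rewrite -subr_eq0; apply/eqP/rhb; rewrite mulrBr e subrr. Qed.

Lemma shifted_comm a b (x x' y y' : int -> D) : central a -> central b ->
  shifted hb a x x' -> shifted hb b y y' ->
  (forall k l, x k * y l = y l * x k) -> forall k l, x' k * y' l = y' l * x' k.
Proof.
move=> ca cb hx hy e k l; apply: (shifted_comm_l chb sep ca hx) => {}k.
by apply/esym; apply: (shifted_comm_l chb sep cb hy) => {}l; rewrite e.
Qed.

Lemma exchange_scale_r c d (y z : int -> D) :
  exchange_rel c d y (fun l => hb * z l) -> exchange_rel c d y z.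
Proof.
move=> e k l; apply: hb_cancel; have := e k l => {}e.
by apply: (nc_lin (u := 1) (v := 1) e); nc central (Logic.I, chb).
Qed.
Lemma exchange_scale_l c d (y z : int -> D) :
  exchange_rel c d (fun l => hb * y l) z -> exchange_rel c d y z.
Proof.
move=> e k l; apply: hb_cancel; have := e k l => {}e.
by apply: (nc_lin (u := 1) (v := 1) e); nc central (Logic.I, chb).
Qed.

Lemma comm_exchange0 (y z : int -> D) : (forall k l, y k * z l = z l * y k) ->
  exchange_rel 0 0 y z.
Proof. by move=> e k l; rewrite !e !subrr !mul0r addr0. Qed.

Lemma exchange0_sum (y z : int -> D) : exchange_rel 0 0 y z ->
  forall k l, y k * z l - z l * y k = y (k + l) * z 0 - z 0 * y (k + l).
Proof.
move=> e k l; pose C k l := y k * z l - z l * y k.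
have step k' l' : C (k' + 1) l' = C k' (l' + 1).
  by apply/eqP; rewrite -subr_eq0; apply/eqP; have := e k' l'; rewrite !mul0r addr0.
have pos (n : nat) : forall k', C k' n%:Z = C (k' + n%:Z) 0.
  elim: n => [|n IH] k'; first by rewrite addr0.
  rewrite (_ : n.+1%:Z = n%:Z + 1); last by lia.
  by rewrite -step IH; congr C; lia.
have neg (n : nat) : forall k', C k' (- n%:Z) = C (k' - n%:Z) 0.
  elim: n => [|n IH] k'; first by rewrite subr0.
  rewrite -[k'](subrK 1) step (_ : - n.+1%:Z + 1 = - n%:Z); last by lia.
  by rewrite IH; congr C; lia.
by case: l => n; rewrite ?NegzE; [exact: pos|exact: neg].
Qed.
End ShiftMore.

(** * One family of root components, uniformly in the sign *)

Section Half.
Variables (D : pzRingType) (hb half : D) (N : nat).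
Variables (hm hs : bool -> 'I_N.-1 -> int -> D) (h X x : 'I_N.-1 -> int -> D).
Variables (sh : 'I_N.-1 -> D) (cl cr : 'I_N.-1 -> 'I_N.-1 -> int) (eps : int).
Hypotheses (chb : central hb) (chalf : central half) (sep : separated hb) (rhb : nonzerodiv hb).
Hypotheses (halfK : half *+ 2 = 1) (epsK : eps * eps = 1).
Hypothesis csh : forall i, central (sh i).
Hypothesis sh_mult : forall i, exists u, sh i = hb * u.
Hypothesis hm_hs : forall s i, shifted hb (sh i) (hm s i) (hs s i).
Hypothesis hs_h : forall i k, hs true i k - hs false i k = hb * h i k.
Hypothesis hs_m1 : forall i, hs true i (-1) = 1.
Hypothesis hs_ge0 : forall i k, 0 <= k -> hs false i k = 0.
Hypothesis X_x : forall i, shifted hb (sh i) (X i) (fun k => hb * x i k).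
Local Notation bf i j := (half * (eps * @cartan N i j)%:~R).
Implicit Types i j : 'I_N.-1.
Hypothesis clE : forall i j : 'I_N.-1, [|| i == j, after i j | after j i] ->
  hb * (cl i j)%:~R - (sh i - sh j) = hb * bf i j.
Hypothesis crE : forall i j : 'I_N.-1, [|| i == j, after i j | after j i] ->
  hb * (cr i j)%:~R + (sh i - sh j) = hb * bf i j.
Hypothesis hmX : forall s i j,
  exchange_rel (hb * (cl i j)%:~R) (hb * (cr i j)%:~R) (hm s i) (X j).
Hypothesis XX : forall i j,
  exchange_rel (hb * (cl i j)%:~R) (hb * (cr i j)%:~R) (X i) (X j).
Hypothesis hmX_far : forall i j, farn i j -> forall s k l, hm s i k * X j l = X j l * hm s i k.
Hypothesis XX_far : forall i j, farn i j -> forall k l, X i k * X j l = X j l * X i k.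
Hypothesis base : forall i j l, after i j || after j i ->
  X i 0 * (X i 0 * X j l - X j l * X i 0) - (X i 0 * X j l - X j l * X i 0) * X i 0 = 0.

Lemma bf_far i j : farn i j -> bf i j = 0.
Proof. by move/far_cartan0 ->; rewrite mulr0 mulr0. Qed.

(** Far nodes are treated apart: their coefficients are 0, but the difference of shifts
    [sh i - sh j] is not, so shifting the exchange relation would not give coefficient 0.
    Commutation, in contrast, survives any shifts. *)
Lemma shift_node Y Y' i j : shifted hb (sh i) Y Y' ->
  exchange_rel (hb * (cl i j)%:~R) (hb * (cr i j)%:~R) Y (X j) ->
  (farn i j -> forall k l, Y k * X j l = X j l * Y k) ->
  exchange_rel (hb * bf i j) (hb * bf i j) Y' (x j).
Proof.
move=> hY e eF; apply: (exchange_scale_r chb rhb).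
have [far|near] := nonfar_cases i j.
  rewrite bf_far // mulr0; apply: comm_exchange0.
  exact: (shifted_comm chb sep (csh i) (csh j) hY (X_x j) (eF far)).
have := shifted_exchange chb sep (csh i) (csh j) (sh_mult i) (sh_mult j) hY (X_x j) e.
by rewrite clE // crE.
Qed.

Lemma hs_x s i j : exchange_rel (hb * bf i j) (hb * bf i j) (hs s i) (x j).
Proof. by apply: shift_node (hm_hs s i) (hmX s i j) _ => far k l; exact: hmX_far. Qed.

Lemma x_x i j : exchange_rel (hb * bf i j) (hb * bf i j) (x i) (x j).
Proof.
apply: (exchange_scale_l chb rhb).
by apply: shift_node (X_x i) (XX i j) _ => far k l; exact: XX_far.
Qed.

Lemma x_x_far i j : farn i j -> forall k l, x i k * x j l = x j l * x i k.
Proof.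
move=> far k l; apply: (hb_cancel rhb); apply: (hb_cancel rhb).
have := shifted_comm chb sep (csh i) (csh j) (X_x i) (X_x j) (XX_far far) k l.
move=> e; apply: (nc_lin (u := 1) (v := 1) e); nc central (Logic.I, chb).
Qed.

Lemma h_x i j : exchange_rel (hb * bf i j) (hb * bf i j) (h i) (x j).
Proof.
apply: (exchange_scale_l chb rhb) => k l; rewrite -!hs_h.
move: (hs_x true i j k l) (hs_x false i j k l); move: (hb * bf i j) => B.
move: (hs true i k) (hs true i (k + 1)) (hs false i k) (hs false i (k + 1)) => a a' b b' e1 e2.
have comb (u1 v1 u2 v2 z : D) : u1 = v1 -> u2 = v2 -> z = (u1 - v1) - (u2 - v2) -> z = 0.
  by move=> -> ->; rewrite !subrr.
by apply/eqP; rewrite -subr_eq0; apply/eqP; apply: (comb _ _ _ _ _ e1 e2); nc.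
Qed.

Lemma h0_x i j l : h i 0 * x j l - x j l * h i 0 = (eps * cartan i j)%:~R * x j l.
Proof.
apply: (hb_cancel rhb).
have e0 : hb * h i 0 = hs true i 0 by rewrite -hs_h hs_ge0 // subr0.
(* At index -1 the + series has the constant term 1, so the relation reads [hbar h_0, x_l] = 2 hbar
   B x_l, with hbar h_0 as its next mode. *)
have := hs_x true i j (-1) l; rewrite hs_m1 (_ : -1 + 1 = 0 :> int) // -e0 => e.
move: e; rewrite !mul1r !mulr1 subrr subr0 => e.
transitivity (hb * h i 0 * x j l - x j l * (hb * h i 0)); first by nc central (Logic.I, chb).
rewrite e; have : bf i j *+ 2 = (eps * cartan i j)%:~R by rewrite -mulrnAl halfK mul1r.
move: (bf i j) => B <-; nc.
Qed.

Lemma x_serre i j a b l : after i j || after j i -> serre (x i) (x j) a b l = 0.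
Proof.
move=> ij.
have ne : i == j = false by move: ij; case: (nodeP i j).
have cii : cartan i i = 2 by rewrite cartan_spec eqxx.
have cij : cartan i j = -1 by rewrite cartan_spec ne ij.
(* The choice of [c] makes B_ii = -2c and B_ij = c for neighbours; since eps^2 = 1, its inverse is
   -2 eps. *)
pose c := - (half * eps%:~R); pose ci := - (eps%:~R *+ 2 : D).
have ceps (m : int) : central (m%:~R : D) by move=> z; rewrite mulrzr mulrzl.
have cc : central c by apply/centralN/centralM.
have eps1 : eps%:~R * eps%:~R = 1 :> D by rewrite -intrM epsK.
have cK : ci * c = 1.
  rewrite /ci /c mulrNN mulrnAl mulrA -(chalf eps%:~R) -mulrA eps1 mulr1.
  by rewrite halfK.
have bii : bf i i = - (c *+ 2).
  by rewrite cii /c intrM mulNrn opprK mulrA mulrzr pmulrn.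
have bij : bf i j = c by rewrite cij /c mulrN1 rmorphN mulrN.
apply: (@serre_eq0 D hb c ci half (h i) (x i) (x j) chb cc rhb sep cK halfK).
- move=> m n; have := h_x i i m n; rewrite bii => ->.
  by rewrite -mulrDr mulrN mulrnAr.
- by move=> m n; have := h_x i j m n; rewrite bij => ->; rewrite -mulrDr.
- move=> n; rewrite h0_x; have -> : (eps * cartan i i)%:~R = bf i i *+ 2.
    by rewrite -mulrnAl halfK mul1r.
  rewrite bii; nc.
- move=> n; rewrite h0_x; have -> : (eps * cartan i j)%:~R = bf i j *+ 2.
    by rewrite -mulrnAl halfK mul1r.
  rewrite bij; nc.
move=> n; rewrite /serre.
(* The zero mode of node [i] ignores the shift, so in [base] only the current of node [j] has to be
   shifted. *)
have x0 : hb * x i 0 = X i 0 := shifted0 sep (X_x i).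
set z := X i 0 in x0.
have hY := shiftedB (shiftedB (shiftedMl chb z (csh j) (shiftedMl chb z (csh j) (X_x j)))
                              (shiftedMl chb z (csh j) (shiftedMr z (X_x j))))
  (shiftedB (shiftedMr z (shiftedMl chb z (csh j) (X_x j))) (shiftedMr z (shiftedMr z (X_x j)))).
have := shifted_zero sep hY _ n; rewrite -x0 => Z.
suff w0 : x i 0 * (x i 0 * x j n - x j n * x i 0) - (x i 0 * x j n - x j n * x i 0) * x i 0 = 0.
  by rewrite w0 addr0.
(* One factor hbar for each of the three letters of the bracket. *)
do 3! apply: rhb.
rewrite -[RHS]Z => [|k]; first by nc central (Logic.I, chb).
by rewrite x0 -[RHS](base k ij) -/z; nc.
Qed.

Lemma half_relations :
  [/\ forall i j l, h i 0 * x j l - x j l * h i 0 = (eps * cartan i j)%:~R * x j l,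
      forall i j, exchange_rel (hb * bf i j) (hb * bf i j) (h i) (x j),
      forall i j, exchange_rel (hb * bf i j) (hb * bf i j) (x i) (x j),
      forall i j, farn i j -> forall k l, x i k * x j l = x j l * x i k
    & forall i j a b l, after i j || after j i -> serre (x i) (x j) a b l = 0].
Proof.
by split; [exact: h0_x|exact: h_x|exact: x_x|exact: x_x_far|exact: x_serre].
Qed.
End Half.

Section RaisingLowering.
Variables (D : pzRingType) (hb : D) (N : nat).
Variables (hm hs : bool -> 'I_N.-1 -> int -> D) (h X Y x y : 'I_N.-1 -> int -> D).
Variables (sh : 'I_N.-1 -> D).
Hypotheses (chb : central hb) (sep : separated hb) (rhb : nonzerodiv hb).
Hypothesis csh : forall i, central (sh i).
Hypothesis hm_hs : forall s i, shifted hb (sh i) (hm s i) (hs s i).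
Hypothesis hs_h : forall i k, hs true i k - hs false i k = hb * h i k.
Hypothesis X_x : forall i, shifted hb (sh i) (X i) (fun k => hb * x i k).
Hypothesis Y_y : forall i, shifted hb (sh i) (Y i) (fun k => hb * y i k).
Hypothesis sh_mult : forall i, exists u, sh i = hb * u.
Hypothesis XY : forall i j, exchange_rel 0 0 (X i) (Y j).
Hypothesis XY0 : forall (i j : 'I_N.-1) k, X i k * Y j 0 - Y j 0 * X i k
  = if i == j then hb * (hm true i k - hm false i k) else 0.
Hypothesis hm_comm : forall s t i j k l, hm s i k * hm t j l = hm t j l * hm s i k.

Lemma h_h i j k l : h i k * h j l = h j l * h i k.
Proof.
apply: (hb_cancel rhb); apply: (hb_cancel rhb).
have e s t : hs s i k * hs t j l = hs t j l * hs s i k.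
  apply: (shifted_comm chb sep (csh i) (csh j) (hm_hs s i) (hm_hs t j)) => {}k {}l.
  exact: hm_comm.
transitivity ((hb * h i k) * (hb * h j l)); first by nc central (Logic.I, chb).
transitivity ((hb * h j l) * (hb * h i k)); last by nc central (Logic.I, chb).
by rewrite -!hs_h; nc rules (Logic.I, e true true, e true false, e false true, e false false).
Qed.

Lemma x_y_neq (i j : 'I_N.-1) k l : i != j -> x i k * y j l = y j l * x i k.
Proof.
move=> ne; apply: (hb_cancel rhb); apply: (hb_cancel rhb).
have e k' l' : X i k' * Y j l' = Y j l' * X i k'.
  by apply/eqP; rewrite -subr_eq0 (exchange0_sum (XY i j)) XY0 (negPf ne).
have {}e := shifted_comm chb sep (csh i) (csh j) (X_x i) (Y_y j) e k l.
by apply: (nc_lin (u := 1) (v := 1) e); nc central (Logic.I, chb).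
Qed.

(** Both currents have the same shift, so the bracket still depends on the sum of the indices only
    and may be taken with [y i 0]. This mode is unshifted, so the bracket with it is shifted like
    [X i]; uniqueness identifies it with the shift of hbar times the Cartan series. *)
Lemma x_y (i : 'I_N.-1) k l : x i k * y i l - y i l * x i k = h i (k + l).
Proof.
have E : exchange_rel 0 0 (x i) (y i).
  apply: (exchange_scale_l chb rhb); apply: (exchange_scale_r chb rhb).
  have := shifted_exchange chb sep (csh i) (csh i) (sh_mult i) (sh_mult i) (X_x i) (Y_y i) (XY i i).
  by rewrite subrr subr0 addr0.
rewrite (exchange0_sum E); move: (k + l) => {k l} m.
apply: (hb_cancel rhb); apply: (hb_cancel rhb).
have y0 : hb * y i 0 = Y i 0 := shifted0 sep (Y_y i).
transitivity (hb * x i m * (hb * y i 0) - hb * y i 0 * (hb * x i m)).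
  by nc central (Logic.I, chb).
rewrite y0 -hs_h.
have hX := shiftedB (shiftedMr (Y i 0) (X_x i)) (shiftedMl chb (Y i 0) (csh i) (X_x i)).
have hH := shiftedMl chb hb (csh i) (shiftedB (hm_hs true i) (hm_hs false i)).
have e k : X i k * Y i 0 - Y i 0 * X i k = hb * (hm true i k - hm false i k).
  by rewrite XY0 eqxx.
exact: (shifted_uniq sep (shifted_ext e hX) hH m).
Qed.

Lemma x_y_node (i j : 'I_N.-1) k l :
  x i k * y j l - y j l * x i k = if i == j then h i (k + l) else 0.
Proof.
have [<-|ne] := eqVneq i j; first exact: x_y.
by rewrite x_y_neq // subrr.
Qed.
End RaisingLowering.

Lemma S1_sum (D : pzRingType) (F : ('I_1 -> 'I_1) -> D) :
  \sum_(s : 'S_1) F s = F id.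
Proof.
rewrite (bigD1 (1%g : 'S_1)) //= big1 ?addr0 => [|s /eqP ne].
  by congr F; apply: funext => p; rewrite perm1.
by case: ne; apply/permP => p; rewrite !ord1.
Qed.

Lemma S2_sum (D : pzRingType) (F : ('I_2 -> 'I_2) -> D) :
  \sum_(s : 'S_2) F s = F id + F (tperm ord0 ord_max).
Proof.
have I2 (p : 'I_2) : p = ord0 \/ p = ord_max.
  by case: p => -[|[|//]] lt; [left|right]; apply: val_inj.
have ne0 : (ord0 : 'I_2) != ord_max by [].
rewrite (bigD1 (1%g : 'S_2)) //= (bigD1 (tperm ord0 ord_max)) /=; last first.
  by apply/eqP => /permP /(_ ord0); rewrite tpermL perm1.
rewrite big1 ?addr0 => [|s /andP[n1 n2]].
  by congr (F _ + _); apply: funext => p; rewrite perm1.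
have inj := @perm_inj _ s.
case: (I2 (s ord0)) => s0; case: (I2 (s ord_max)) => s1.
- by move: (inj _ _ (etrans s0 (esym s1))).
- by case/eqP: n1; apply/permP => p; rewrite perm1; case: (I2 p) => ->.
- by case/eqP: n2; apply/permP => p; case: (I2 p) => ->; rewrite ?tpermL ?tpermR.
- by move: (inj _ _ (etrans s0 (esym s1))).
Qed.

Lemma ideal2_ratio (A : pzRingType) (J : A -> Prop) (x y v : A) :
  ideal2 J -> y * v = 1 -> J (x - 1) -> J (y - 1) -> J (x * v - 1).
Proof.
move=> iJ yv Jx Jy.
have -> : x * v - 1 = (x - 1) * v - (y - 1) * v.
  by rewrite -[X in _ - X]yv !mulrBl opprB addrA subrK.
by apply: (ideal2B iJ); apply: (ideal2Mr iJ).
Qed.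

(** * The actual currents at c = 0 *)

Section CurrentsDY0.
Variables (R : realType) (N : nat).
Local Notation D := (DY0 R N).
Local Notation hb := (hb R N).
Local Notation hb0 := (hb0 R N).
Local Notation pi := (@to_DY0 R N).
Local Notation G := (@fam R N).
Implicit Types i j : 'I_N.-1.

Lemma Egl_multiple s i : hb_multiple (Egl R N s (lo i) (hi i)).
Proof.
have [_ h _] := gauss_unipotent R N s; have := h (lo i) (hi i).
by rewrite eq_sym offdiag subr0.
Qed.
Lemma Fgl_multiple s i : hb_multiple (Fgl R N s (hi i) (lo i)).
Proof.
have [_ _ h] := gauss_unipotent R N s; have := h (hi i) (lo i).
by rewrite offdiag subr0.
Qed.

Lemma Kgl_ratio s i :
  hb_multiple (Kgl R N s 0 (hi i) * series_inv (Kgl R N s 0 (lo i)) - 1).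
Proof.
have [hK _ _] := gauss_unipotent R N s.
exact: (ideal2_ratio (hb_multiple_ideal R N) (series_invP (hK (lo i))).1 (hK (hi i)) (hK (lo i))).
Qed.

Lemma shifted_total i (a : bool -> DYgl R N) (g : bool -> fps (DYgl R N)) :
  (forall s, pi (a s) = 0) -> (forall s, exists b, a s = hb * b) ->
  (forall s, hb_multiple (g s)) ->
  let z s := shift s (hshift R i) (shift s (a s) (g s)) in
  shifted hb0 (@sh R N i) (current (fun s => fps_map pi (g s)))
    (fun k => hb0 * pi (hdiv (fourier true (z true) k - fourier false (z false) k))).
Proof.
move=> a0 am gm z.
have e k : hb0 * pi (hdiv (fourier true (z true) k - fourier false (z false) k))
    = mode true (fps_map pi (z true)) k - mode false (fps_map pi (z false)) k.
  rewrite -[hb0]/(pi hb) -rmorphM hdivP ?mode_map; first exact: rmorphB.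
  have [y1 e1] := double_shift_multiple true i k (am true) (gm true).
  have [y2 e2] := double_shift_multiple false i k (am false) (gm false).
  exists (y1 - y2); rewrite mulrBr -e1 -e2; reflexivity.
have h s := double_shift_DY0 s (g s) i (a0 s) (am s).
move=> k n; rewrite e; exact: (shiftedB (h true) (h false) k n).
Qed.

Lemma c4_signs0 (b s : bool) : pi (if s == b then c4 R N else - c4 R N) = 0.
Proof. by case: eqP => _; rewrite ?rmorphN /= to_DY0_c4 ?oppr0. Qed.

Lemma xE_e i : shifted hb0 (@sh R N i) (xE G i) (fun k => hb0 * xcomp R true i k).
Proof.
apply: (@shifted_total i (fun s => if s then - c4 R N else c4 R N)
  (fun s => Egl R N s (lo i) (hi i))) => [s|s|s]; last exact: Egl_multiple.
  by have := c4_signs0 false s; case: s.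
by have := c4_multiple R N (~~ s); case: s.
Qed.

Lemma xF_f i : shifted hb0 (@sh R N i) (xF G i) (fun k => hb0 * xcomp R false i k).
Proof.
apply: (@shifted_total i (fun s => if s then c4 R N else - c4 R N)
  (fun s => Fgl R N s (hi i) (lo i))) => [s|s|s]; last exact: Fgl_multiple.
  by have := c4_signs0 true s; case: s.
exact: c4_multiple.
Qed.

Definition hs s i := mode s (fps_map pi (Hser R s i)).

Lemma hm_hs s i : shifted hb0 (@sh R N i) (hm G s i) (hs s i).
Proof.
rewrite -sh_hshift.
have := shift_DY0 s (Kgl R N s 0 (hi i) * series_inv (Kgl R N s 0 (lo i))) (hshift_multiple R i).
rewrite [fps_map pi (_ * series_inv _)](rmorphM (fps_map pi)); exact.
Qed.

Lemma hs_ge0 i (k : int) : 0 <= k -> hs false i k = 0.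
Proof. exact: mode_ge0. Qed.
Lemma hs_lt i (k : int) : k < -1 -> hs true i k = 0.
Proof. exact: mode_lt. Qed.

Lemma central_sh i : central (@sh R N i).
Proof. by apply: centralM; [exact: central_scal0|exact: central_hb0]. Qed.
Lemma sh_multiple i : exists u, @sh R N i = hb0 * u.
Proof. by exists (scal0 N ((i.+1)%:R / 2%:R)); rewrite [RHS]central_hb0. Qed.

Lemma hs_m1 i : hs true i (-1) = 1.
Proof.
rewrite -(@hm_true_m1 _ _ G (@fam0 R N) i).
apply: (congh_eq (@separated_hb0 R N)) => n; apply: congh_leq (leqnSn n) _.
have := hm_hs true i (-1) n.+1; congr congh.
rewrite /shift_sum big_ord_recl big1 => [|j _]; first by rewrite binz0 expr0 mul1r subr0 addr0.
by rewrite /hm mode_lt ?mulr0 ?mul0rz //= /bump; lia.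
Qed.

(** For [k >= 0] only H^+ contributes and for [k < -1] only H^-. At [k = -1] the constant term of
    H^+ supplies the 1 from which H^- is subtracted in the definition of the components. *)
Lemma hs_h i k : hs true i k - hs false i k = hb0 * hcomp R i k.
Proof.
have dv s : exists y, mode s (Hser R s i - 1) k = hb * y.
  rewrite modeB; have [y e] := shift_congh1 s (Kgl R N s 0 (hi i) * series_inv (Kgl R N s 0 (lo i))) k (hshift_multiple R i).
  have [z ez] := mode_hb_multiple s k (Kgl_ratio s i).
  exists (y + z); rewrite mulrDr -ez modeB; move: e; rewrite expr1 => <-.
  by rewrite addrA subrK.
rewrite /hcomp /hgl; have [k0|k0] := boolP (0 <= k).
  rewrite hs_ge0 // subr0 -[hb0]/(pi hb) -rmorphM hdivP; last exact: dv.
  rewrite -[fourier _ _ _]/(mode true (Hser R true i - 1) k) modeB mode1.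
  by rewrite (_ : (k == -1) = false) ?subr0 /hs ?mode_map //; lia.
rewrite -[hb0]/(pi hb) -rmorphM hdivP -?[fourier _ _ _]/(mode false (1 - Hser R false i) k).
  have -> : hs false i k = pi (mode false (Hser R false i) k) by exact: mode_map.
  rewrite modeB mode1 rmorphB rmorph_nat; congr (_ - _).
  have [->|k1] := eqVneq k (-1); first by rewrite hs_m1.
  by rewrite hs_lt //; lia.
by have [y e] := dv false; exists (- y); rewrite mulrN -e -modeN opprB.
Qed.
End CurrentsDY0.

Section CoefShift.
Variables (D : pzRingType) (hb half : D) (N : nat) (sh : 'I_N.-1 -> D).
Hypotheses (ch : central half) (h2 : half *+ 2 = 1).
Hypothesis shE : forall i, sh i = half * (i.+1)%:R * hb.
Implicit Types i j : 'I_N.-1.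

(** Neighbours have coefficients -1 and 0, whose mean is B_ij = -1/2; the difference of shifts is
    hbar/2 up to sign and balances them. For [i = j] both are already 1 and the shifts cancel. *)
Lemma coef_shift i j : [|| i == j, after i j | after j i] ->
  hb * (coefL i j)%:~R - (sh i - sh j) = hb * (half * (cartan i j)%:~R) /\
  hb * (coefR i j)%:~R + (sh i - sh j) = hb * (half * (cartan i j)%:~R).
Proof.
rewrite !shE cartan_spec /coefL /coefR.
case: (nodeP i j) => [->|/(congr1 val) /= e|/(congr1 val) /= e|//] _ /=;
  rewrite ?(mulr0z, mulrN1z).
- rewrite subrr subr0 addr0 mulr1 -[half * 2%:~R]/(half * 2%:R) mulr_natr h2.
  by rewrite mulr1.
- have -> : (j.+1)%:R = (i.+1)%:R + 1 :> D by rewrite -e -natr1.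
  split; last by nc central (Logic.I, ch).
  by apply: (nc_lin (u := hb) (v := 1) h2); nc central (Logic.I, ch).
- have -> : (i.+1)%:R = (j.+1)%:R + 1 :> D by rewrite -e -natr1.
  split; first by nc central (Logic.I, ch).
  by apply: (nc_lin (u := hb) (v := 1) h2); nc central (Logic.I, ch).
Qed.

Lemma coef_shift_E i j : [|| i == j, after i j | after j i] ->
  hb * (coefL i j)%:~R - (sh i - sh j) = hb * (half * (1 * cartan i j)%:~R) /\
  hb * (coefR i j)%:~R + (sh i - sh j) = hb * (half * (1 * cartan i j)%:~R).
Proof. by rewrite mul1r; exact: coef_shift. Qed.

Lemma coef_shift_F i j : [|| i == j, after i j | after j i] ->
  hb * (- coefR i j)%:~R - (sh i - sh j) = hb * (half * (-1 * cartan i j)%:~R) /\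
  hb * (- coefL i j)%:~R + (sh i - sh j) = hb * (half * (-1 * cartan i j)%:~R).
Proof.
move=> /coef_shift[eL eR]; rewrite mulN1r !mulrNz !mulrN.
by split; [rewrite -eR|rewrite -eL]; nc.
Qed.
End CoefShift.

Section Relations.
Variables (R : realType) (N : nat).
Local Notation D := (DY0 R N).
Local Notation hb0 := (hb0 R N).
Local Notation pi := (@to_DY0 R N).
Local Notation G := (@fam R N).
Local Notation half := (scal0 N (2%:R^-1) : D).
Implicit Types i j : 'I_N.-1.

Lemma halfK : half *+ 2 = 1.
Proof.
by rewrite -rmorphMn -mulr_natr mulVf ?rmorph1 // Num.Theory.pnatr_eq0.
Qed.

Lemma scal0_half (m : int) : scal0 N (m%:~R / 2%:R) = half * m%:~R.
Proof. by rewrite mulrC rmorphM rmorph_int. Qed.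

Lemma shE i : @sh R N i = half * (i.+1)%:R * hb0.
Proof. by rewrite /sh (scal0_half i.+1). Qed.

Let chb := @central_hb0 R N.
Let rhb := @regular_hb0 R N.
Let sep := @separated_hb0 R N.
Let chalf : central half := central_scal0 (2%:R^-1).
Let csh := @central_sh R N.
Let shm := @sh_multiple R N.
Let RTT s t := RTT_DY0 R N s t.

Local Notation bf eps i j := (half * (eps * cartan i j)%:~R).

Lemma E_relations :
  [/\ forall i j l, hcomp R i 0 * xcomp R true j l - xcomp R true j l * hcomp R i 0
       = (1 * cartan i j)%:~R * xcomp R true j l,
      forall i j, exchange_rel (hb0 * bf 1 i j) (hb0 * bf 1 i j) (hcomp R i) (xcomp R true j),
      forall i j, exchange_rel (hb0 * bf 1 i j) (hb0 * bf 1 i j) (xcomp R true i) (xcomp R true j),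
      forall i j, farn i j -> forall k l,
        xcomp R true i k * xcomp R true j l = xcomp R true j l * xcomp R true i k
    & forall i j a b l, after i j || after j i ->
        serre (xcomp R true i) (xcomp R true j) a b l = 0].
Proof.
apply: (@half_relations D hb0 half N (hm G) (@hs R N) (@hcomp R N) (xE G) (@xcomp R N true)
  (@sh R N) (@coefL N) (@coefR N) 1 chb chalf sep rhb halfK (mulr1 1) csh shm
  (@hm_hs R N) (@hs_h R N) (@hs_m1 R N) (@hs_ge0 R N) (@xE_e R N)).
- by move=> i j near; have [] := coef_shift_E chalf halfK shE near.
- by move=> i j near; have [] := coef_shift_E chalf halfK shE near.
- exact (fun s i j => hm_xE (G := G) chb rhb RTT s i j).
- exact (fun i j => xE_xE (G := G) chb rhb RTT i j).
- exact (fun i j far s k l => hm_xE_far (G := G) chb rhb RTT far s k l).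
- exact (fun i j far k l => xE_xE_far (G := G) chb rhb RTT far k l).
- exact (fun i j l => serre_base_E (G := G) chb rhb RTT (@fam0 R N) (i := i) (j := j) l).
Qed.

Lemma F_relations :
  [/\ forall i j l, hcomp R i 0 * xcomp R false j l - xcomp R false j l * hcomp R i 0
       = (-1 * cartan i j)%:~R * xcomp R false j l,
      forall i j, exchange_rel (hb0 * bf (-1) i j) (hb0 * bf (-1) i j) (hcomp R i) (xcomp R false j),
      forall i j, exchange_rel (hb0 * bf (-1) i j) (hb0 * bf (-1) i j) (xcomp R false i) (xcomp R false j),
      forall i j, farn i j -> forall k l,
        xcomp R false i k * xcomp R false j l = xcomp R false j l * xcomp R false i k
    & forall i j a b l, after i j || after j i ->
        serre (xcomp R false i) (xcomp R false j) a b l = 0].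
Proof.
apply: (@half_relations D hb0 half N (hm G) (@hs R N) (@hcomp R N) (xF G) (@xcomp R N false)
  (@sh R N) (fun i j => - coefR i j) (fun i j => - coefL i j) (-1) chb chalf sep rhb halfK
  (mulrNN 1 1) csh shm
  (@hm_hs R N) (@hs_h R N) (@hs_m1 R N) (@hs_ge0 R N) (@xF_f R N)).
- by move=> i j near; have [] := coef_shift_F chalf halfK shE near.
- by move=> i j near; have [] := coef_shift_F chalf halfK shE near.
- exact (fun s i j => hm_xF (G := G) chb rhb RTT s i j).
- exact (fun i j => xF_xF (G := G) chb rhb RTT i j).
- exact (fun i j far s k l => hm_xF_far (G := G) chb rhb RTT far s k l).
- exact (fun i j far k l => xF_xF_far (G := G) chb rhb RTT far k l).
- exact (fun i j l => serre_base_F (G := G) chb rhb RTT (@fam0 R N) (i := i) (j := j) l).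
Qed.

Let hm_comm s t i j k l : hm G s i k * hm G t j l = hm G t j l * hm G s i k.
Proof. by apply: coef_comm_mode; move=> m n; exact: (nH_comm (G := G) chb rhb RTT). Qed.

Lemma H_H i j k l : hcomp R i k * hcomp R j l = hcomp R j l * hcomp R i k.
Proof.
exact: (h_h chb sep rhb csh (@hm_hs R N) (@hs_h R N) hm_comm).
Qed.

Lemma E_F i j k l :
  xcomp R true i k * xcomp R false j l - xcomp R false j l * xcomp R true i k
  = if i == j then hcomp R i (k + l) else 0.
Proof.
have XY := xE_xF (G := G) chb rhb RTT.
have XY0 := xE_xF0 (G := G) chb rhb RTT (@fam0 R N).
exact (x_y_node chb sep rhb csh (@hm_hs R N) (@hs_h R N) (@xE_e R N) (@xF_f R N) shm XY XY0 i j k l).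
Qed.
End Relations.

(** * Serre sums over permutations for m = 1 and m = 2 *)

Section SerreSums.
Variables (D : pzRingType) (x y : int -> D).

Lemma serre_sum1 (k : 'I_1 -> int) l : (forall a, x a * y l = y l * x a) ->
  \sum_(s : 'S_1) iter_comm [seq x (k (s p)) | p <- enum 'I_1] (y l) = 0.
Proof.
move=> e; rewrite (S1_sum (fun s => iter_comm [seq x (k (s p)) | p <- enum 'I_1] (y l))).
have -> : enum 'I_1 = [:: ord0] by apply: (inj_map val_inj); rewrite val_enum_ord.
by rewrite /= /comm e subrr.
Qed.

Lemma serre_sum2 (k : 'I_2 -> int) l : (forall a b, serre x y a b l = 0) ->
  \sum_(s : 'S_2) iter_comm [seq x (k (s p)) | p <- enum 'I_2] (y l) = 0.
Proof.
move=> e; rewrite (S2_sum (fun s => iter_comm [seq x (k (s p)) | p <- enum 'I_2] (y l))).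
have -> : enum 'I_2 = [:: ord0; ord_max].
  by apply: (inj_map val_inj); rewrite val_enum_ord.
by rewrite /= tpermL tpermR -[RHS](e (k ord0) (k ord_max)).
Qed.
End SerreSums.

Lemma exchange_comm (D : pzRingType) (s : bool) (a b : D) (y z : int -> D) k l :
  a = sgn s b -> exchange_rel a a y z ->
  comm (y (k + 1)) (z l) - comm (y k) (z (l + 1)) = sgn s (b * acomm (y k) (z l)).
Proof.
move=> -> /(_ k l); rewrite /comm => ->; rewrite /acomm -mulrDr.
by case: s; rewrite //= mulNr.
Qed.

Lemma sgn_mul (D : pzRingType) (s : bool) (a b : D) (c : int) :
  a * (b * ((if s then 1 else -1) * c)%:~R) = sgn s (a * (b * c%:~R)).
Proof. by case: s; rewrite ?mul1r // mulN1r mulrNz !mulrN. Qed.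

Section Final.
Variables (R : realType) (N : nat).
Local Notation D := (DY0 R N).
Local Notation hb0 := (hb0 R N).
Local Notation half := (scal0 N (2%:R^-1) : D).
Implicit Types i j : 'I_N.-1.

Lemma comm_h0_x s i j l : comm (hcomp R i 0) (xcomp R s j l)
  = sgn s (scal0 N (2%:R * Bform R i j) * xcomp R s j l).
Proof.
have -> : scal0 N (2%:R * Bform R i j) = (cartan i j)%:~R.
  by rewrite /Bform mulrC divfK ?Num.Theory.pnatr_eq0 // rmorph_int.
rewrite /comm; case: s.
  by have [-> _ _ _ _] := E_relations R N; rewrite mul1r.
by have [-> _ _ _ _] := F_relations R N; rewrite mulN1r mulrNz mulNr.
Qed.

Lemma bform_sgn (s : bool) i j :
  hb0 * (half * ((if s then 1 else -1) * cartan i j)%:~R) = sgn s (hb0 * scal0 N (Bform R i j)).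
Proof.
rewrite (scal0_half R N (cartan i j)); exact: sgn_mul.
Qed.

Lemma comm_h_x s i j k l :
  comm (hcomp R i (k + 1)) (xcomp R s j l) - comm (hcomp R i k) (xcomp R s j (l + 1))
  = sgn s (hb0 * scal0 N (Bform R i j) * acomm (hcomp R i k) (xcomp R s j l)).
Proof.
apply: exchange_comm (bform_sgn s i j) _.
by case: s; [have [_ h _ _ _] := E_relations R N|have [_ h _ _ _] := F_relations R N]; exact: h.
Qed.

Lemma comm_x_x s i j k l :
  comm (xcomp R s i (k + 1)) (xcomp R s j l) - comm (xcomp R s i k) (xcomp R s j (l + 1))
  = sgn s (hb0 * scal0 N (Bform R i j) * acomm (xcomp R s i k) (xcomp R s j l)).
Proof.
apply: exchange_comm (bform_sgn s i j) _.
by case: s; [have [_ _ h _ _] := E_relations R N|have [_ _ h _ _] := F_relations R N]; exact: h.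
Qed.

Lemma serre_relation s i j m (k : 'I_m -> int) l : i != j -> m%:Z = 1 - cartan i j ->
  \sum_(sigma : 'S_m)
     iter_comm [seq xcomp R s i (k (sigma p)) | p <- enum 'I_m] (xcomp R s j l) = 0.
Proof.
move=> ne em; have [far|] := nonfar_cases i j.
  (* Distinct nodes leave two cases: a zero Cartan entry, where the relation is plain commutation,
     and the entry -1, where the two permutations give the two terms of [serre]. *)
  have m1 : m = 1%N by move: em; rewrite far_cartan0 // subr0 => -[].
  move: k em; rewrite m1 => k _; apply: serre_sum1 => a.
  by case: s; [have [_ _ _ h _] := E_relations R N|have [_ _ _ h _] := F_relations R N]; exact: h.
rewrite (negPf ne) /= => near.
have m2 : m = 2%N by move: em; rewrite cartan_spec (negPf ne) near => -[].
move: k em; rewrite m2 => k _; apply: serre_sum2 => a b.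
by case: s; [have [_ _ _ _ h] := E_relations R N|have [_ _ _ _ h] := F_relations R N]; exact: h.
Qed.
End Final.

Theorem corollary3p5 (R : realType) (N : nat) (hN : (2 <= N)%N) :
  (forall (i j : 'I_N.-1) (k l : int),
     comm (hcomp R i k) (hcomp R j l) = 0) /\
  (forall (s : bool) (i j : 'I_N.-1) (l : int),
     comm (hcomp R i 0) (xcomp R s j l)
     = sgn s (scal0 N (2%:R * Bform R i j) * xcomp R s j l)) /\
  (forall (i j : 'I_N.-1) (k l : int),
     comm (xcomp R true i k) (xcomp R false j l)
     = if i == j then hcomp R i (k + l) else 0) /\
  (forall (s : bool) (i j : 'I_N.-1) (k l : int),
     comm (hcomp R i (k + 1)) (xcomp R s j l) - comm (hcomp R i k) (xcomp R s j (l + 1))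
     = sgn s (hb0 R N * scal0 N (Bform R i j) * acomm (hcomp R i k) (xcomp R s j l))) /\
  (forall (s : bool) (i j : 'I_N.-1) (k l : int),
     comm (xcomp R s i (k + 1)) (xcomp R s j l) - comm (xcomp R s i k) (xcomp R s j (l + 1))
     = sgn s (hb0 R N * scal0 N (Bform R i j) * acomm (xcomp R s i k) (xcomp R s j l))) /\
  (forall (s : bool) (i j : 'I_N.-1) (m : nat) (k : 'I_m -> int) (l : int),
     i != j -> m%:Z = 1 - cartan i j ->
     \sum_(sigma : 'S_m)
        iter_comm [seq xcomp R s i (k (sigma p)) | p <- enum 'I_m] (xcomp R s j l)
     = 0).
Proof.
split; first by move=> i j k l; apply/eqP; rewrite subr_eq0; apply/eqP; exact: H_H.
split; first exact: comm_h0_x.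
split; first exact: E_F.
split; first exact: comm_h_x.
split; first exact: comm_x_x.
exact: serre_relation.
Qed.
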